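(* Consider the minimization over $\mathbb{R}^d$ of $f=\frac1M\sum_{m=1}^M f_m$, where every $f_m$ is $\delta$-related to $f$ and $f$ is $\mu$-strongly convex, and let $x_*$ be its minimizer. Let the problem be solved by the algorithm EF-OLGA (described in the context) with a biased compressor $C$ with constant $\beta>1$ and compression power $\gamma_\beta>1$, and with parameters $$p=\frac1{\gamma_\beta},\quad \theta=\frac{p^{3/2}}{24\delta},\quad \tau=\min\left\{\frac{\sqrt\mu\,\theta^{1/2}p^{-1/2}}{18},\frac1{18}\right\},\quad \alpha=\frac{\theta p^{-1}}{36\tau}.$$ Then, to reach $\mathbb{E}[f(y_K)-f(x_* )]\le\varepsilon$, EF-OLGA has (in expectation) communication complexities $$\text{CC-1}:\ \tilde{\mathcal O}\left(\gamma_\beta+\gamma_\beta^{5/4}\sqrt{\tfrac{\delta}{\mu}}\right),\qquad \text{CC-2}:\ \tilde{\mathcal O}\left(M\gamma_\beta+M\gamma_\beta^{5/4}\sqrt{\tfrac{\delta}{\mu}}\right),\qquad \text{CC-3}:\ \tilde{\mathcal O}\left(1+\gamma_\beta^{1/4}\sqrt{\tfrac{\delta}{\mu}}\right).$$ Here $\tilde{\mathcal O}(A)$ means: there is a universal constant $c$ such that for every $\varepsilon>0$ there is a number $K$ of iterations with $\mathbb{E}[f(y_K)-f(x_* )]\le\varepsilon$ for which the expected value of the respective complexity over the first $K$ iterations is at most $c\,A\left(1+\log^+\frac{f(y_0)-f(x_* )}{\varepsilon}\right)$, with $\log^+ t=\max\{0,\log t\}$ and $\log^+0=0$.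
   Context: Setting: $f_1,\dots,f_M:\mathbb{R}^d\to\mathbb{R}$ are twice differentiable (in the application $f_m(x)=\frac1{n_m}\sum_{j=1}^{n_m}\ell(x,z_j^m)$ is the local loss on node $m$), $f=\frac1M\sum_{m=1}^M f_m$, node $1$ is the server. The norm is Euclidean (spectral norm for matrices). $\delta$-relatedness: $\delta>0$ and $\|\nabla^2 f_m(x)-\nabla^2 f(x)\|\le\delta$ for all $x\in\mathbb{R}^d$ and all $m$. (The $f_m$ may be non-convex.) $\mu$-strong convexity: $\mu>0$ and $f(x)\ge f(y)+\langle\nabla f(y),x-y\rangle+\frac\mu2\|x-y\|^2$ for all $x,y\in\mathbb{R}^d$. Biased compressor with constant $\beta>1$: a (possibly random) map $C:\mathbb{R}^d\to\mathbb{R}^d$ with $\mathbb{E}_C[\|C(x)-x\|^2]\le\left(1-\frac1\beta\right)\|x\|^2$ for all $x\in\mathbb{R}^d$. Each application of $C$ uses fresh randomness, independent of the variables $N$ below. Compression power $\gamma_\beta$: if $b$ is the number of bits representing one float and $\|\cdot\|_{bits}$ the number of bits needed to represent a vector, $\gamma_\beta^{-1}=\frac1{bd}\mathbb{E}\|C(z)\|_{bits}$ (i.e. on average a compressed vector costs a fraction $1/\gamma_\beta$ of an uncompressed one). Epoch procedure $\mathrm{EFEpoch}(u_0,\theta,p)$: draw $N\sim\mathrm{Geom}(p)$, i.e. $\Pr[N=n]=p(1-p)^{n-1}$ for $n=1,2,\dots$, and put $\epsilon_0^m=0\in\mathbb{R}^d$ for all $m$. The server collects $\nabla f(u_0)$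 (one round in which each node sends an uncompressed vector). For $j=0,1,\dots,N-1$: for each $m$ put $\hat g_j^m=\nabla f_m(u_j)-\nabla f_1(u_j)-\nabla f_m(u_0)+\nabla f_1(u_0)$, send $g_j^m=C(\epsilon_j^m+\theta\hat g_j^m)$ to the server (one round in which each node sends a compressed vector), and put $\epsilon_{j+1}^m=\epsilon_j^m-g_j^m+\theta\hat g_j^m$; put $g_j=\frac1M\sum_{m=1}^M g_j^m$ and $s_j=\frac1\theta g_j-\nabla f_1(u_0)+\nabla f(u_0)$; set $u_{j+1}=\arg\min_{u\in\mathbb{R}^d}\left\{\langle s_j,u-u_j\rangle+\frac1{2\theta}\|u-u_j\|^2+f_1(u)\right\}$. At the last step $j=N-1$ each node also sends $\epsilon_N^m$ uncompressed. Output the pair $\left(u_N,\ \frac1M\sum_{m=1}^M\epsilon_N^m\right)$. EF-OLGA: input $z_0=y_0\in\mathbb{R}^d$, $p\in(0,1)$, $\theta>0$, $\tau\in(0,1)$, $\alpha>0$. For $k=0,1,2,\dots$: $x_{k+1}=\tau z_k+(1-\tau)y_k$; $(y_{k+1},e_{k+1})=\mathrm{EFEpoch}(x_{k+1},\theta,p)$ (with fresh randomness); the server collects $\nabla f(y_{k+1})$ (one round in which each node sends an uncompressed vector); $t_k=\nabla(f_1-f)(x_{k+1})-\nabla(f_1-f)(y_{k+1})$; $\tilde y_{k+1}=y_{k+1}-e_{k+1}$ and $G_{k+1}=p\left(t_k+\frac{x_{k+1}-\tilde y_{k+1}}{\theta}\right)$; $z_{k+1}=\arg\min_{z\in\mathbb{R}^d}\left\{\frac1{2\alpha}\|z-z_k\|^2+\langle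 G_{k+1},z\rangle+\frac\mu2\|z-y_{k+1}\|^2\right\}$. Complexity measures: CC-1 is the number of communication rounds; CC-2 is the number of client-server communications (a round involving all $M$ nodes counts $M$); CC-3 is the communication time, where nodes transmit in parallel and a round counts as the amount of information sent by each node, so (up to a fixed time unit) a round with uncompressed vectors counts $1$ and a round with compressed vectors counts $1/\gamma_\beta$ (average). Server-to-client communication is not counted. Thus one iteration of EF-OLGA has a fixed number (at most $3$) of uncompressed rounds and $N$ compressed rounds. $\mathbb{E}$ is expectation over all randomness. *)

(* Defs.v *)
From HB Require Import structures.
From mathcomp Require Import all_boot all_order all_algebra.
From mathcomp Require Import all_classical all_reals all_analysis.

Set Implicit Arguments.
Unset Strict Implicit.
Unset Printing Implicit Defensive.

Import Order.TTheory GRing.Theory Num.Theory.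
Import numFieldNormedType.Exports.

Local Open Scope classical_set_scope.
Local Open Scope ring_scope.

Section Euclidean.
Context {R : realType} {d : nat}.
Implicit Types (u v x y : 'rV[R]_d) (g : 'rV[R]_d -> R).

Definition dotv u v : R := \sum_(i < d) u 0 i * v 0 i.

(* The library norm `|u| on 'rV[R]_d is the sup norm; it is used here only
   through the topology it induces. *)
Definition norm2 u : R := Num.sqrt (dotv u u).

Definition spectral_norm (A : 'M[R]_d) : R :=
  sup [set norm2 (u *m A) | u in [set u | norm2 u <= 1]].

Definition grad g x : 'rV[R]_d := \row_(i < d) 'D_(delta_mx 0 i) g x.

Definition hess g x : 'M[R]_d := 'J (grad g) x.

Definition twice_differentiable g : Prop :=
  (forall x, differentiable g x) /\ (forall x, differentiable (grad g) x).

Definition strongly_convex (mu : R) g : Prop :=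
  forall x y,
    g y + dotv (grad g y) (x - y) + mu / 2 * norm2 (x - y) ^+ 2 <= g x.

Definition is_minimizer g x : Prop := forall y, g x <= g y.

(* Total: an arbitrary vector if there is no minimizer. *)
Definition argmin g : 'rV[R]_d := xget 0 [set x | is_minimizer g x].

End Euclidean.

Section Average.
Context {R : realType} {d M : nat}.

Definition avgv (v : 'I_M -> 'rV[R]_d) : 'rV[R]_d := M%:R^-1 *: \sum_m v m.

Definition avgf (f : 'I_M -> 'rV[R]_d -> R) : 'rV[R]_d -> R :=
  fun x => M%:R^-1 * \sum_m f m x.

Definition related (delta : R) (f : 'I_M -> 'rV[R]_d -> R) : Prop :=
  forall m x, spectral_norm (hess (f m) x - hess (avgf f) x) <= delta.

End Average.

(* 'rV[R]_d with its Borel sigma-algebra. *)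
Notation borelV R d := (g_sigma_algebraType (@open 'rV[R]_d)).

Section Compressor.
Context {R : realType} {d : nat} {dW : measure_display} {W : measurableType dW}.
Variables (Q : probability W R) (C : W -> 'rV[R]_d -> 'rV[R]_d).

(* A random map is a map C with an additional argument, the seed, of law Q.
   Joint measurability is what makes the expectations along the algorithm
   meaningful. *)
Definition biased_compressor (beta : R) : Prop :=
  measurable_fun setT (fun wx : W * borelV R d => C wx.1 wx.2 : borelV R d) /\
  forall x, ('E_Q[fun w => (norm2 (C w x - x) ^+ 2)%R]
               <= ((1 - beta^-1) * norm2 x ^+ 2)%:E)%E.

(* bits v is the number of bits needed to represent v, and b the number of bits
   of one float; the average cost of a compressed vector is the same for every
   input z. *)
Definition compression_power (bits : 'rV[R]_d -> nat) (b : nat) (gamma : R) :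
    Prop :=
  [/\ (0 < b)%N, measurable_fun setT (bits : borelV R d -> nat) &
    forall z, ((gamma^-1)%:E
      = ((b * d)%:R^-1)%:E * 'E_Q[fun w => (bits (C w z))%:R%R])%E].

End Compressor.

(* The algorithm is a deterministic function of its random inputs: the epoch
   lengths N and the seeds of the compressor. *)
Section Algorithm.
Context {R : realType} {d M : nat} {W : Type}.
Variables (s : 'I_M) (f : 'I_M -> 'rV[R]_d -> R)
  (C : W -> 'rV[R]_d -> 'rV[R]_d).

(* From (u_j, (epsilon_j^m)_m) to (u_(j+1), (epsilon_(j+1)^m)_m). *)
Definition epoch_step (u0 : 'rV[R]_d) (theta : R) (seed : 'I_M -> W)
    (st : 'rV[R]_d * ('I_M -> 'rV[R]_d)) : 'rV[R]_d * ('I_M -> 'rV[R]_d) :=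
  let u := st.1 in
  let e := st.2 in
  let ghat := fun m =>
    grad (f m) u - grad (f s) u - grad (f m) u0 + grad (f s) u0 in
  let g := fun m => C (seed m) (e m + theta *: ghat m) in
  let sj := theta^-1 *: avgv g - grad (f s) u0 + grad (avgf f) u0 in
  (argmin (fun v =>
     dotv sj (v - u) + (2 * theta)^-1 * norm2 (v - u) ^+ 2 + f s v),
   fun m => e m - g m + theta *: ghat m).

Fixpoint epoch_state (u0 : 'rV[R]_d) (theta : R) (seed : nat -> 'I_M -> W)
    (j : nat) : 'rV[R]_d * ('I_M -> 'rV[R]_d) :=
  if j is j'.+1 then
    epoch_step u0 theta (seed j') (epoch_state u0 theta seed j')
  else (u0, fun=> 0).

Definition EFEpoch (u0 : 'rV[R]_d) (theta : R) (N : nat)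
    (seed : nat -> 'I_M -> W) : 'rV[R]_d * 'rV[R]_d :=
  let st := epoch_state u0 theta seed N in (st.1, avgv st.2).

(* From (y_k, z_k) to (y_(k+1), z_(k+1)). *)
Definition EF_OLGA_step (mu p theta tau alpha : R) (N : nat)
    (seed : nat -> 'I_M -> W) (yz : 'rV[R]_d * 'rV[R]_d) :
    'rV[R]_d * 'rV[R]_d :=
  let y := yz.1 in
  let z := yz.2 in
  let x' := tau *: z + (1 - tau) *: y in
  let ye := EFEpoch x' theta N seed in
  let y' := ye.1 in
  let ytilde := y' - ye.2 in
  let h := fun v => f s v - avgf f v in
  let t := grad h x' - grad h y' in
  let G := p *: (t + theta^-1 *: (x' - ytilde)) in
  (y', argmin (fun v =>
     (2 * alpha)^-1 * norm2 (v - z) ^+ 2 + dotv G v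
     + mu / 2 * norm2 (v - y') ^+ 2)).

Fixpoint EF_OLGA (mu p theta tau alpha : R) (y0 : 'rV[R]_d) (N : nat -> nat)
    (seed : nat -> nat -> 'I_M -> W) (k : nat) : 'rV[R]_d * 'rV[R]_d :=
  if k is k'.+1 then
    EF_OLGA_step mu p theta tau alpha (N k') (seed k')
      (EF_OLGA mu p theta tau alpha y0 N seed k')
  else (y0, y0).

End Algorithm.

Section Complexity.
Context {R : realType}.

(* Cost of K iterations when an uncompressed round costs a and a compressed
   round costs b.  The three uncompressed rounds of an iteration collect
   grad f (x_(k+1)), the final errors epsilon_N^m and grad f (y_(k+1)). *)
Definition comm_cost (a b : R) (N : nat -> nat) (K : nat) : R :=
  \sum_(k < K) (3 * a + (N k)%:R * b).

Definition CC1 : (nat -> nat) -> nat -> R := comm_cost 1 1.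
Definition CC2 (M : nat) : (nat -> nat) -> nat -> R := comm_cost M%:R M%:R.
Definition CC3 (gamma : R) : (nat -> nat) -> nat -> R := comm_cost 1 gamma^-1.

(* logp 0 = 0 because ln 0 = 0. *)
Definition logp (t : R) : R := Num.max 0 (ln t).

End Complexity.

Section Randomness.
Context {R : realType} {dO : measure_display} {Omega : measurableType dO}.
Variable P : probability Omega R.

Definition mutually_independent (I : eqType) (F : I -> set (set Omega)) : Prop :=
  forall (J : seq I) (E : I -> set Omega), uniq J ->
    (forall i, i \in J -> F i (E i)) ->
    (P (\big[setI/setT]_(i <- J) E i) = \prod_(i <- J) P (E i))%E.

Definition sigma_of d' (T' : measurableType d') (X : Omega -> T') :
    set (set Omega) := preimage_set_system setT X measurable.

Definition geometric_law (p : R) (X : {RV P >-> nat}) : Prop :=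
  forall n, (0 < n)%N ->
    (P (X @^-1` [set n]) = (p * (1 - p) ^+ n.-1)%:E)%E.

(* N k is the length of the epoch of iteration k, and seed k j m the seed used
   by node m at the j-th step of that epoch. *)
Definition EF_OLGA_randomness (M : nat) (dW : measure_display)
    (W : measurableType dW) (Q : probability W R) (p : R)
    (N : nat -> {RV P >-> nat})
    (seed : nat -> nat -> 'I_M -> {RV P >-> W}) : Prop :=
  [/\ forall k, geometric_law p (N k),
      forall k j m B, measurable B -> distribution P (seed k j m) B = Q B &
      mutually_independent (fun i : nat + nat * nat * 'I_M =>
        match i with
        | inl k => sigma_of (N k)
        | inr (k, j, m) => sigma_of (seed k j m)
        end)].

End Randomness.

(* Main.v *)
Require Import Defs.
From HB Require Import structures.
From mathcomp Require Import all_boot all_order all_algebra.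
From mathcomp Require Import all_classical all_reals all_analysis.
From mathcomp Require Import measurable_realfun.
From mathcomp Require Import ring lra.

Set Implicit Arguments.
Unset Strict Implicit.
Unset Printing Implicit Defensive.

Import Order.TTheory GRing.Theory Num.Theory.
Import numFieldNormedType.Exports.

Local Open Scope classical_set_scope.
Local Open Scope ring_scope.

(** Let [h] be the difference between the loss of the server and [f]; by
    relatedness its gradient is [delta]-Lipschitz. Error feedback is understood
    through the virtual iterates [u_j - e_j], where [e_j] is the average of the
    errors kept by the nodes: they satisfy (lemma [traj_step])
      [u_(j+1) - e_(j+1)
         = u_j - e_j - theta (grad f u_(j+1) + grad h u_(j+1) - grad h u_j)],
    so that compression enters only through the distance between the iterates
    and the virtual iterates. The gradient estimate [G] of an epoch of length [N]
    is therefore [p (grad f u_1 + ... + grad f u_N)] (lemma [GestE]), and since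
    [N] is geometric its mean is that of [grad f u_N] (lemma [Gest_unbiased]).

    The sizes of the errors are compared under the geometric weights
    [w_j = p (1 - p)^j]. Abel summation of the telescoping squared distances
    [a_j = |u_j - e_j - x|^2] to the start [x] of the epoch produces a negative
    term of the order of [p sum_j w_j a_(j+1)] (lemma [path_sum]). Compression
    does not increase second moments, so the error of a node grows, in mean
    square norm, by at most [2 theta delta |u_j - x|] per step; a Hardy inequality
    for geometric weights and [theta delta = p^(3/2) / 24] then bound the weighted
    errors by [(p / 17) sum_j w_j a_(j+1)] (lemmas [error_sum] and
    [Ex_error_sum]), which the negative term absorbs. The power 3/2 of [p] is
    exactly what this balance requires.

    With the errors absorbed, the usual argument for accelerated methods
    applies: the potential [f y - f xs + c |z - xs|^2], for the weight [c] called
    [cz], satisfies a one-step inequality along every realization of an epoch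
    (lemma [path_potential]), and hence decreases in expectation by the factor
    [1 - tau] per iteration (lemma [potential_step]). The inequality is first
    proved for sums over the lengths up to [T], so that only finitely many moments
    along the epoch are involved; the remainder tends to zero as [T] grows
    (lemma [Ex_Phi_sum]).

    The probabilistic side is one principle, [family_integral_le]: an expectation
    of a function of two disjoint sets of independent inputs is computed by
    freezing the first set and averaging over the second.

    Finally [1 / tau] is of the order of [1 + gamma^(1/4) sqrt (delta / mu)]
    (lemma [param_tauV]), the number of iterations is of the order of the
    logarithmic factor divided by [tau] (lemma [iteration_count]), and an
    iteration has on average [gamma] compressed rounds (lemma
    [expected_cost_le]). *)

(** * Euclidean geometry and first-order calculus on row vectors *)

Section DotProduct.
Context {R : realType} {d : nat}.
Implicit Types (u v w x y : 'rV[R]_d) (a : R).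

Lemma dotvC u v : dotv u v = dotv v u.
Proof. by apply: eq_bigr => i _; rewrite mulrC. Qed.

Lemma dotvDl u v w : dotv (u + v) w = dotv u w + dotv v w.
Proof. by rewrite -big_split; apply: eq_bigr => i _; rewrite mxE mulrDl. Qed.

Lemma dotvZl a u w : dotv (a *: u) w = a * dotv u w.
Proof. by rewrite mulr_sumr; apply: eq_bigr => i _; rewrite mxE mulrA. Qed.

Lemma dotvNl u w : dotv (- u) w = - dotv u w.
Proof. by rewrite -scaleN1r dotvZl mulN1r. Qed.

Lemma dotvBl u v w : dotv (u - v) w = dotv u w - dotv v w.
Proof. by rewrite dotvDl dotvNl. Qed.

Lemma dotvDr w u v : dotv w (u + v) = dotv w u + dotv w v.
Proof. by rewrite dotvC dotvDl ![dotv _ w]dotvC. Qed.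

Lemma dotvZr a w u : dotv w (a *: u) = a * dotv w u.
Proof. by rewrite dotvC dotvZl dotvC. Qed.

Lemma dotvNr w u : dotv w (- u) = - dotv w u.
Proof. by rewrite dotvC dotvNl dotvC. Qed.

Lemma dotvBr w u v : dotv w (u - v) = dotv w u - dotv w v.
Proof. by rewrite dotvDr dotvNr. Qed.

Lemma dot0v w : dotv 0 w = 0.
Proof. by rewrite -(scale0r w) dotvZl mul0r. Qed.

Lemma dotv0 w : dotv w 0 = 0.
Proof. by rewrite dotvC dot0v. Qed.

Definition dotvE := (dotvDl, dotvDr, dotvNl, dotvNr, dotvZl, dotvZr, dot0v, dotv0).

Lemma dotv_ge0 u : 0 <= dotv u u.
Proof. by apply: sumr_ge0 => i _; rewrite -expr2 sqr_ge0. Qed.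

Lemma dotv_sum (I : Type) (r : seq I) (F : I -> 'rV[R]_d) w :
  dotv (\sum_(i <- r) F i) w = \sum_(i <- r) dotv (F i) w.
Proof.
elim: r => [|i r IH]; first by rewrite !big_nil dot0v.
by rewrite !big_cons dotvDl IH.
Qed.

Lemma dotv_eq0 u : dotv u u = 0 -> u = 0.
Proof.
move=> /eqP; rewrite psumr_eq0 => [/allP u0|i _]; last by rewrite -expr2 sqr_ge0.
apply/rowP => i; rewrite mxE; apply/eqP.
by have := u0 i (mem_index_enum i); rewrite /= mulf_eq0 orbb.
Qed.

Lemma norm2_sqr u : norm2 u ^+ 2 = dotv u u.
Proof. by rewrite sqr_sqrtr// dotv_ge0. Qed.

Lemma norm2_ge0 u : 0 <= norm2 u.
Proof. exact: sqrtr_ge0. Qed.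

Lemma dotv_young a u v : 0 < a ->
  dotv u v <= a / 2 * dotv u u + a^-1 / 2 * dotv v v.
Proof.
move=> a0; have := dotv_ge0 (a *: u - v); rewrite !dotvE (dotvC v u) => h.
have aV0 : 0 < a^-1 by rewrite invr_gt0.
suff -> : a / 2 * dotv u u + a^-1 / 2 * dotv v v =
    dotv u v + a^-1 / 2 *
      (a * (a * dotv u u) + - (a * dotv u v) + (- (a * dotv u v) - - dotv v v)).
  by rewrite lerDl; apply: mulr_ge0 => //; lra.
by field; rewrite gt_eqF.
Qed.

Lemma dotv_CS u v : dotv u v ^+ 2 <= dotv u u * dotv v v.
Proof.
have [->|v0] := eqVneq v 0; first by rewrite !dotv0 mulr0 expr0n.
have vv : 0 < dotv v v.
  by rewrite lt_def dotv_ge0 andbT; apply: contra_neq v0; exact: dotv_eq0.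
have := dotv_ge0 (dotv v v *: u - dotv u v *: v).
rewrite !dotvE (dotvC v u) => h.
suff : 0 <= dotv v v * (dotv u u * dotv v v - dotv u v ^+ 2).
  by rewrite pmulr_rge0// subr_ge0.
by lra.
Qed.

Lemma sqr_coord_le u i : u 0 i ^+ 2 <= dotv u u.
Proof.
rewrite /dotv (bigD1 i)//= -expr2 lerDl.
by apply: sumr_ge0 => j _; rewrite -expr2 sqr_ge0.
Qed.

Lemma dotvD_le2 u v : dotv (u + v) (u + v) <= 2 * dotv u u + 2 * dotv v v.
Proof. by have := dotv_ge0 (u - v); rewrite !dotvE (dotvC v u); lra. Qed.

Lemma dotvB_le2 u v : dotv (u - v) (u - v) <= 2 * dotv u u + 2 * dotv v v.
Proof. by have := dotv_ge0 (u + v); rewrite !dotvE (dotvC v u); lra. Qed.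

(** Jensen's inequality, obtained from the nonnegativity of the variance of the
    family around its mean. *)
Lemma dotv_avg (M : nat) (F : 'I_M -> 'rV[R]_d) :
  dotv (avgv F) (avgv F) <= M%:R^-1 * \sum_m dotv (F m) (F m).
Proof.
case: M F => [|M] F.
  by rewrite /avgv invr0 scale0r dot0v mul0r.
set s := \sum_m dotv (F m) (F m).
have M0 : (0 : R) < M.+1%:R by rewrite ltr0n.
have : 0 <= \sum_m dotv (F m - avgv F) (F m - avgv F).
  by apply: sumr_ge0 => i _; exact: dotv_ge0.
have -> : \sum_m dotv (F m - avgv F) (F m - avgv F) =
    s - M.+1%:R * dotv (avgv F) (avgv F).
  transitivity (\sum_(m < M.+1) (dotv (F m) (F m) - 2 * dotv (F m) (avgv F)
                            + dotv (avgv F) (avgv F))).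
    apply: eq_bigr => i _; move: (avgv F) => c.
    by rewrite !dotvE (dotvC c); ring.
  rewrite big_split/= sumrB -mulr_sumr -dotv_sum sumr_const card_ord -/s.
  have -> : \sum_(i < M.+1) F i = M.+1%:R *: avgv F.
    by rewrite scalerA divff ?gt_eqF// scale1r.
  by rewrite dotvZl -mulr_natl; ring.
by rewrite ler_pdivlMl// subr_ge0.
Qed.

End DotProduct.

Section SpectralNorm.
Context {R : realType} {d : nat}.

(** The supremum defining the spectral norm is finite because every entry of [u]
    is at most 1 in absolute value on the unit ball; homogeneity then extends
    the bound from unit vectors to all vectors. *)
Lemma spectral_norm_le (A : 'M[R]_d) (delta : R) (v : 'rV[R]_d) :
  0 <= delta -> spectral_norm A <= delta ->
  dotv (v *m A) (v *m A) <= delta ^+ 2 * dotv v v.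
Proof.
move=> d0 Ad.
have [->|v0] := eqVneq v 0; first by rewrite mul0mx !dot0v mulr0.
have vv : 0 < dotv v v.
  by rewrite lt_def dotv_ge0 andbT; apply: contra_neq v0; exact: dotv_eq0.
have nv : 0 < norm2 v by rewrite sqrtr_gt0.
set S := [set norm2 (u *m A) | u in [set u | norm2 u <= 1]].
have supS : has_sup S.
  split.
    exists (norm2 ((0 : 'rV[R]_d) *m A)); exists 0 => //=.
    by rewrite /norm2 dot0v sqrtr0.
  exists (Num.sqrt (\sum_j (\sum_i `|A i j|) ^+ 2)) => _ [u /= u1 <-].
  apply: ler_wsqrtr; apply: ler_sum => j _; rewrite -expr2.
  have ui i : `|u 0 i| <= 1.
    rewrite -(@ler_pXn2r _ 2)// ?nnegrE// expr1n real_normK ?num_real//.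
    apply: (le_trans (sqr_coord_le _ _)).
    by rewrite -norm2_sqr -(expr1n _ 2) ler_pXn2r// nnegrE ?norm2_ge0.
  rewrite -real_normK ?num_real// ler_pXn2r// ?nnegrE ?sumr_ge0//.
  rewrite mxE (le_trans (ler_norm_sum _ _ _))//.
  apply: ler_sum => i _; rewrite normrM -[leRHS]mul1r.
  exact: ler_pM.
have : norm2 (((norm2 v)^-1 *: v) *m A) <= delta.
  apply: le_trans Ad; apply: sup_upper_bound => //.
  exists ((norm2 v)^-1 *: v) => //=.
  rewrite /norm2 dotvZl dotvZr -/(norm2 v) -norm2_sqr expr2.
  by rewrite mulKf ?gt_eqF// mulVf ?gt_eqF// sqrtr1.
rewrite -(@ler_pXn2r _ 2)// ?nnegrE ?norm2_ge0// norm2_sqr.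
rewrite -scalemxAl dotvZl dotvZr -[dotv v v]norm2_sqr => h.
set B := dotv (v *m A) _ in h *.
rewrite -ler_pdivrMr ?exprn_gt0//.
suff -> : B / norm2 v ^+ 2 = (norm2 v)^-1 * ((norm2 v)^-1 * B) by [].
by field; rewrite gt_eqF.
Qed.

End SpectralNorm.

Section Calculus.
Context {R : realType} {d : nat}.
Implicit Types (g : 'rV[R]_d -> R) (x y v w : 'rV[R]_d).

Lemma dotv_grad g x v : differentiable g x -> 'D_v g x = dotv (grad g x) v.
Proof.
move=> dg; rewrite deriveE// {1}[v]row_sum_delta linear_sum /=.
by apply: eq_bigr => i _; rewrite linearZ /= mxE deriveE// mulrC.
Qed.

(** Reduces every multivariate estimate below to a one-dimensional mean value
    theorem. *)
Lemma is_derive_line (W : normedModType R) (g : 'rV[R]_d -> W) x v (t : R) :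
  differentiable g (x + t *: v) ->
  is_derive t 1 (fun s => g (x + s *: v)) ('D_v g (x + t *: v)).
Proof.
move=> dg; pose l : R -> 'rV[R]_d := cst x + *:%R ^~ v.
have dl : is_diff t l (cst 0 + *:%R ^~ v).
  exact: (is_diffD (is_diff_cst x t) (is_diff_scalel t v)).
have dfl : differentiable l t by [].
have dgl : differentiable (g \o l) t by exact: differentiable_comp.
split; first exact/derivable1_diffP.
have -> : (fun s => g (x + s *: v)) = g \o l by [].
rewrite deriveE// diff_comp//= deriveE// diff_val.
by congr ('d _ _ _); rewrite /GRing.add/= /cst add0r scale1r.
Qed.

Lemma gradD g1 g2 x : differentiable g1 x -> differentiable g2 x ->
  grad (fun z => g1 z + g2 z) x = grad g1 x + grad g2 x.
Proof.
by move=> d1 d2; apply/rowP => i; rewrite !mxE deriveD//; exact: diff_derivable.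
Qed.

Lemma gradB g1 g2 x : differentiable g1 x -> differentiable g2 x ->
  grad (fun z => g1 z - g2 z) x = grad g1 x - grad g2 x.
Proof.
by move=> d1 d2; apply/rowP => i; rewrite !mxE deriveB//; exact: diff_derivable.
Qed.

Lemma grad_avgf M (f : 'I_M -> 'rV[R]_d -> R) x :
  (forall m, differentiable (f m) x) ->
  grad (avgf f) x = avgv (fun m => grad (f m) x).
Proof.
move=> df; apply/rowP => i; rewrite !mxE summxE.
have -> : avgf f = M%:R^-1 *: \sum_(m < M) f m.
  by apply/funext => z; rewrite scalrfctE /avgf fct_sumE.
rewrite deriveZ; last by apply: derivable_sum => m; exact: diff_derivable.
rewrite derive_sum; last by move=> m; exact: diff_derivable.
by congr (_ * _); apply: eq_bigr => m _; rewrite mxE.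
Qed.

Lemma differentiable_avgf M (f : 'I_M -> 'rV[R]_d -> R) x :
  (forall m, differentiable (f m) x) -> differentiable (avgf f) x.
Proof.
move=> df.
have -> : avgf f = M%:R^-1 *: \sum_(m < M) f m.
  by apply/funext => z; rewrite scalrfctE /avgf fct_sumE.
by apply: differentiableZ; apply: differentiable_sum.
Qed.

End Calculus.

(** * Lipschitz gradients and proximal steps *)

Section Calculus2.
Context {R : realType} {d : nat}.
Implicit Types (g : 'rV[R]_d -> R) (x y v w q c : 'rV[R]_d) (a : R).

Lemma differentiable_coordv (G : 'rV[R]_d -> 'rV[R]_d) x i :
  differentiable G x -> differentiable (fun z => G z 0 i) x.
Proof.
move=> dG; have dc := @differentiable_coord R _ _ (G x) 0 i.
exact: (@differentiable_comp _ _ _ _ G (fun N : 'rV[R]_d => N 0 i : R) x dG dc).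
Qed.

Lemma derive_coordv (G : 'rV[R]_d -> 'rV[R]_d) x v i :
  differentiable G x -> 'D_v (fun z => G z 0 i) x = 'D_v G x 0 i.
Proof.
by move=> dG; rewrite [in RHS]derive_mx; [rewrite mxE|exact: diff_derivable].
Qed.

Lemma dotv_fieldE (G : 'rV[R]_d -> 'rV[R]_d) c :
  (fun z => dotv (G z) c) = \sum_(i < d) (c 0 i *: (fun z => G z 0 i)).
Proof.
apply/funext => z; rewrite fct_sumE; apply: eq_bigr => i _.
by rewrite mulrC.
Qed.

Lemma differentiable_dotv (G : 'rV[R]_d -> 'rV[R]_d) c x :
  differentiable G x -> differentiable (fun z => dotv (G z) c) x.
Proof.
move=> dG; rewrite dotv_fieldE; apply: differentiable_sum => i.
by apply: differentiableZ; exact: differentiable_coordv.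
Qed.

Lemma derive_dotv (G : 'rV[R]_d -> 'rV[R]_d) c x v :
  differentiable G x -> 'D_v (fun z => dotv (G z) c) x = dotv ('D_v G x) c.
Proof.
move=> dG; rewrite dotv_fieldE derive_sum => [|i]; last first.
  by apply/derivableZ/diff_derivable; exact: differentiable_coordv.
apply: eq_bigr => i _; rewrite deriveZ; last first.
  by apply/diff_derivable; exact: differentiable_coordv.
by rewrite derive_coordv// mulrC.
Qed.

Lemma MVT_line g x v : (forall z, differentiable g z) ->
  exists2 t, 0 < t < 1 & g (x + v) - g x = dotv (grad g (x + t *: v)) v.
Proof.
move=> dg.
have dl (t : R) := is_derive_line (dg (x + t *: v)).
have cl : {within `[0, 1], continuous (fun s : R => g (x + s *: v))}.
  by apply: derivable_within_continuous => t _; apply: ex_derive.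
have [t t01] := MVT ltr01 (fun t _ => dl t) cl.
rewrite scale1r scale0r addr0 subr0 mulr1 => ->.
by exists t; [rewrite in_itv in t01|rewrite dotv_grad].
Qed.

(** Apply the mean value theorem to [z |-> <G z, G x - G y>] on the segment from
    [y] to [x]: the increment of this function is [|G x - G y|^2], and
    Cauchy-Schwarz bounds its derivative by [delta |x - y| |G x - G y|]. *)
Lemma lipschitz_field (G : 'rV[R]_d -> 'rV[R]_d) (delta : R) :
  (forall z, differentiable G z) ->
  (forall z v, dotv ('D_v G z) ('D_v G z) <= delta ^+ 2 * dotv v v) ->
  forall x y, dotv (G x - G y) (G x - G y) <= delta ^+ 2 * dotv (x - y) (x - y).
Proof.
move=> dG bG x y; set w := G x - G y; set v := x - y.
have dgw z : differentiable (fun z => dotv (G z) w) z by exact: differentiable_dotv.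
have [t _] := MVT_line y v dgw.
rewrite -dotv_grad// derive_dotv// {1}/v subrKC -dotvBl -/w => e.
have [->|w0] := eqVneq w 0; first by rewrite dot0v mulr_ge0// ?sqr_ge0// dotv_ge0.
have ww : 0 < dotv w w.
  by rewrite lt_def dotv_ge0 andbT; apply: contra_neq w0; exact: dotv_eq0.
rewrite -(ler_pM2r ww) -expr2 [in leLHS]e.
apply: (le_trans (dotv_CS _ _)).
by rewrite ler_pM2r.
Qed.

Lemma quad_coordE a q : (fun z => a / 2 * dotv (z - q) (z - q)) =
  (a / 2) *: \sum_(i < d) ((fun z : 'rV[R]_d => z 0 i) - cst (q 0 i)) ^+ 2.
Proof.
apply/funext => z; rewrite scalrfctE fct_sumE; congr (_ * _).
by apply: eq_bigr => i _; rewrite !mxE -expr2.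
Qed.

Lemma differentiable_quad a q x :
  differentiable (fun z => a / 2 * dotv (z - q) (z - q)) x.
Proof.
rewrite quad_coordE.
apply: differentiableZ; apply: differentiable_sum => i.
apply: differentiableX; apply: differentiableB => //.
exact: differentiable_coord.
Qed.

Lemma grad_quad a q x :
  grad (fun z => a / 2 * dotv (z - q) (z - q)) x = a *: (x - q).
Proof.
have dc i : differentiable ((fun z : 'rV[R]_d => z 0 i) - cst (q 0 i)) x.
  by apply: differentiableB => //; exact: differentiable_coord.
apply/rowP => j; rewrite !mxE.
rewrite quad_coordE.
rewrite deriveZ; last first.
  by apply: derivable_sum => i; apply: derivableX; exact: diff_derivable.
rewrite derive_sum; last by move=> i; apply: derivableX; exact: diff_derivable.
have dE i : 'D_(delta_mx 0 j) (((fun z : 'rV[R]_d => z 0 i) - cst (q 0 i)) ^+ 2) x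
    = (j == i)%:R * (2 * (x 0 i - q 0 i)).
  rewrite deriveX; last exact: diff_derivable.
  have dx : derivable (fun z : 'rV[R]_d => z 0 i) x (delta_mx 0 j).
    by apply: diff_derivable; exact: differentiable_coord.
  rewrite deriveB//.
  rewrite derive_cst subr0 (@derive_coordv id)// derive_id mxE eqxx/= eq_sym.
  by rewrite expr1 -mulr_natl mulr1; exact: mulrC.
rewrite (bigD1 j)//= big1 => [|i ij]; last by rewrite dE eq_sym (negbTE ij) mul0r.
by rewrite dE eqxx addr0 mul1r [LHS]mulrA divfK ?pnatr_eq0.
Qed.

Lemma differentiable_dotr c x : differentiable (fun z => dotv c z) x.
Proof.
have -> : (fun z => dotv c z) = (fun z => dotv (id z) c).
  by apply/funext => z; rewrite dotvC.
by apply: differentiable_dotv.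
Qed.

Lemma grad_dotr c x : grad (fun z => dotv c z) x = c.
Proof.
have -> : (fun z => dotv c z) = (fun z => dotv (id z) c).
  by apply/funext => z; rewrite dotvC.
apply/rowP => i; rewrite mxE derive_dotv// derive_id.
rewrite /dotv (bigD1 i)//= big1 => [|j ji]; last first.
  by rewrite mxE (negbTE ji) andbF mul0r.
by rewrite mxE !eqxx mul1r addr0.
Qed.

Lemma differentiable_mulr a g x :
  differentiable g x -> differentiable (fun z => a * g z) x.
Proof.
move=> dg; rewrite (_ : (fun z => a * g z) = a *: g)//.
exact: differentiableZ.
Qed.

Lemma gradZ a g x : differentiable g x -> grad (fun z => a * g z) x = a *: grad g x.
Proof.
move=> dg; apply/rowP => i; rewrite !mxE.
by rewrite (_ : (fun z => a * g z) = a *: g)// deriveZ//; exact: diff_derivable.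
Qed.

(** Weak convexity: subtracting its linearization at [y] from [g] and adding
    [delta / 2 |z - y|^2] gives a function that is nondecreasing along rays
    issued from [y]. *)
Lemma lipschitz_grad_lower g (delta : R) : 0 <= delta ->
  (forall z, differentiable g z) ->
  (forall x y, dotv (grad g x - grad g y) (grad g x - grad g y)
                 <= delta ^+ 2 * dotv (x - y) (x - y)) ->
  forall x y, g y + dotv (grad g y) (x - y) - delta / 2 * dotv (x - y) (x - y) <= g x.
Proof.
move=> d0 dg lg x y; set v := x - y; set c := grad g y.
pose k z := (g z - dotv c z) + delta / 2 * dotv (z - y) (z - y).
have dk1 z : differentiable (fun z => g z - dotv c z) z.
  by apply: differentiableB => //; exact: differentiable_dotr.
have dk z : differentiable k z.
  by apply: differentiableD => //; exact: differentiable_quad.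
have gk z : grad k z = grad g z - c + delta *: (z - y).
  rewrite gradD//; last exact: differentiable_quad.
  by rewrite gradB//; [rewrite grad_quad grad_dotr|exact: differentiable_dotr].
have [t /andP[t0 t1] e] := MVT_line y v dk.
suff : 0 <= k (y + v) - k y.
  rewrite {1}/v subrKC /k subrr dot0v mulr0 addr0 -/v.
  have -> : dotv c v = dotv c x - dotv c y by rewrite dotvBr.
  by move: (dotv v v) (dotv c x) (dotv c y) => *; lra.
rewrite e gk [y + _]addrC addrK [_ + y]addrC.
set D := grad g _ - c.
have hD : dotv D D <= (delta * t) ^+ 2 * dotv v v.
  apply: (le_trans (lg _ _)); rewrite [y + _]addrC addrK dotvZl dotvZr.
  by rewrite exprMn le_eqVlt; apply/orP; left; apply/eqP; ring.
rewrite dotvDl !dotvZl.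
have vv := dotv_ge0 v.
suff : - (delta * (t * dotv v v)) <= dotv D v by lra.
rewrite lerNl; apply: (le_trans (ler_norm _)).
rewrite normrN -(@ler_pXn2r _ 2)// ?nnegrE ?mulr_ge0 ?(ltW t0)//.
rewrite real_normK ?num_real//.
apply: (le_trans (dotv_CS _ _)).
apply: (le_trans (ler_wpM2r vv hD)).
by rewrite le_eqVlt; apply/orP; left; apply/eqP; ring.
Qed.

Lemma minimizer_grad0 g x : (forall z, differentiable g z) ->
  is_minimizer g x -> grad g x = 0.
Proof.
move=> dg gx; apply: dotv_eq0; set v := grad g x.
have dl (t : R) := is_derive_line (dg (x + t *: v)).
have l0 : (0 : R) \in `](-1)%R, (1%R : R)[ by rewrite in_itv /= ltrN10 ltr01.
have N11 : (-1 : R) <= 1 by lra.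
have dr t : t \in `](-1)%R, (1%R : R)[ -> derivable (fun s : R => g (x + s *: v)) t 1.
  by move=> _; case: (dl t).
have mn t : t \in `](-1)%R, (1%R : R)[ -> g (x + 0 *: v) <= g (x + t *: v).
  by move=> _; rewrite scale0r addr0; exact: gx.
have h := derive1_at_min N11 dr l0 mn.
have := dl 0; case: h => _ h [_]; rewrite h scale0r addr0 dotv_grad//.
Qed.

Lemma continuous_dotv (x : 'rV[R]_d) : {for x, continuous (fun z => dotv z z)}.
Proof.
have := @differentiable_quad 2 0 x.
rewrite (_ : (fun z => _) = (fun z => dotv z z)).
  exact: differentiable_continuous.
by apply/funext => z; rewrite subr0 divff ?mul1r// pnatr_eq0.
Qed.

Lemma compact_dotv_ball (B : R) : compact [set z : 'rV[R]_d | dotv z z <= B].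
Proof.
apply: bounded_closed_compact.
  exists (Num.max 0 (Num.sqrt B)); split; first exact: num_real.
  move=> M; rewrite gt_max => /andP[M0 BM] z /= zB.
  rewrite [leLHS]/Num.Def.normr/= mx_normrE (bigmax_le _ (ltW M0))//= => -[i j] _ /=.
  rewrite (ord1 i); apply: le_trans (ltW BM).
  by rewrite -sqrtr_sqr ler_wsqrtr// (le_trans (sqr_coord_le _ _)).
rewrite (_ : [set z | _] = (fun z : 'rV[R]_d => dotv z z) @^-1` [set r | r <= B])//.
apply: closed_comp; last exact: closed_le.
by move=> z _; exact: continuous_dotv.
Qed.

End Calculus2.

(** The local loss of the server is only weakly convex, so the modulus [m] below
    may be negative; a step size with [theta m > -1] still makes the proximal
    problem strongly convex. *)
Section Prox.
Context {R : realType} {d : nat}.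
Implicit Types (x y u v w q s : 'rV[R]_d).
Variables (g : 'rV[R]_d -> R) (theta m : R).
Hypothesis dg : forall z, differentiable g z.
Hypothesis cg : forall v w,
  g v + dotv (grad g v) (w - v) + m / 2 * dotv (w - v) (w - v) <= g w.
Hypothesis theta0 : 0 < theta.
Hypothesis sigma0 : 0 < 1 + theta * m.

(** The proximal objective [psi] is coercive, hence attains its minimum on a ball
    outside of which it exceeds [psi 0]; its stationarity is the claim. *)
Lemma prox_ex q : exists v, v + theta *: grad g v = q.
Proof.
pose psi v := theta * g v + 1 / 2 * dotv (v - q) (v - q).
have dpsi v : differentiable psi v.
  apply: differentiableD; last exact: differentiable_quad.
  exact: differentiable_mulr.
have gpsi v : grad psi v = theta *: grad g v + (v - q).
  have e1 := differentiable_mulr theta (dg v).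
  by rewrite (gradD e1 (differentiable_quad 1 q v)) gradZ// grad_quad scale1r.
have sg0 := sigma0; set sg := 1 + theta * m in sg0.
pose a := theta *: grad g 0 - q.
(* psi w >= psi 0 + <a, w> + sg / 2 |w|^2, which exceeds psi 0 as soon as
   |w| > 2 |a| / sg *)
pose B := 4 * (sg^-1 ^+ 2 * dotv a a).
have B0 : 0 <= B by rewrite !mulr_ge0// ?exprn_ge0 ?invr_ge0 ?dotv_ge0// ltW.
have psi_out w : B < dotv w w -> psi 0 <= psi w.
  move=> Bw; have := cg 0 w; rewrite subr0 => /(ler_wpM2l (ltW theta0)) h.
  have sg0V : 0 < 2 / sg by rewrite divr_gt0.
  have yg := dotv_young (- a) w sg0V.
  have : sg / 4 * B <= sg / 4 * dotv w w by rewrite ler_wpM2l ?ltW// divr_gt0.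
  have -> : sg / 4 * B = sg^-1 * dotv a a by rewrite /B; field; rewrite gt_eqF.
  move: yg h; rewrite invf_div /psi.
  have -> : 2 / sg / 2 = sg^-1 by field; rewrite gt_eqF.
  have -> : dotv (- a) w = - (theta * dotv (grad g 0) w - dotv q w).
    by rewrite dotvNl /a dotvBl dotvZl.
  have -> : dotv (- a) (- a) = dotv a a by rewrite dotvNl dotvNr opprK.
  have -> : dotv (0 - q) (0 - q) = dotv q q by rewrite sub0r dotvNl dotvNr opprK.
  have -> : dotv (w - q) (w - q) = dotv w w - 2 * dotv q w + dotv q q.
    by rewrite !dotvE (dotvC w q); ring.
  rewrite /sg; move: (sg^-1 * dotv a a) => aa.
  move: (dotv w w) (dotv q w) (dotv (grad g 0) w) (g 0) (g w) (dotv q q) => *.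
  lra.
have A0 : [set z : 'rV[R]_d | dotv z z <= B] !=set0 by exists 0; rewrite /= dot0v.
have cpsi' : {within [set z : 'rV[R]_d | dotv z z <= B], continuous psi}.
  by apply: continuous_subspaceT => v; exact: differentiable_continuous.
have [c cB cmin] := EVT_min_rV A0 (@compact_dotv_ball _ _ B) cpsi'.
have cpsi : is_minimizer psi c.
  move=> w; have [wB|Bw] := leP (dotv w w) B; first by apply: cmin; rewrite inE.
  apply: le_trans (psi_out _ Bw); apply: cmin.
  by rewrite inE /= dot0v.
exists c; have := minimizer_grad0 dpsi cpsi; rewrite gpsi.
by rewrite addrCA addrA => /eqP; rewrite subr_eq0 => /eqP.
Qed.

Definition prox q : 'rV[R]_d := xget 0 [set v | v + theta *: grad g v = q].

Lemma proxP q : prox q + theta *: grad g (prox q) = q.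
Proof. by rewrite /prox; case: xgetP => // /(_ _) no; have [v /no] := prox_ex q. Qed.

(** Strong monotonicity of [v |-> v + theta grad g v]. This makes the proximal map
    continuous, which is what its measurability rests on. *)
Lemma prox_lipschitz q q' :
  (1 + theta * m) ^+ 2 * dotv (prox q - prox q') (prox q - prox q')
    <= dotv (q - q') (q - q').
Proof.
have -> : q - q' = prox q + theta *: grad g (prox q)
                  - (prox q' + theta *: grad g (prox q')) by rewrite !proxP.
move: (prox q) (prox q') => v v'.
have h2 := cg v' v; have h1 := cg v v'.
rewrite -(opprB v v') dotvNl !dotvNr opprK in h1.
have mono : m * dotv (v - v') (v - v') <= dotv (grad g v - grad g v') (v - v').
  by rewrite [leRHS]dotvBl; lra.
set D := v - v' in mono *; set S := grad g v - grad g v' in mono *.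
have -> : v + theta *: grad g v - (v' + theta *: grad g v') = D + theta *: S.
  by rewrite /S scalerBr /D addrACA opprD.
clearbody D S.
have -> : dotv (D + theta *: S) (D + theta *: S) =
  (1 + theta * m) ^+ 2 * dotv D D
  + theta ^+ 2 * dotv (S - m *: D) (S - m *: D)
  + 2 * (1 + theta * m) * theta * (dotv S D - m * dotv D D).
  by rewrite !dotvE (dotvC D S); ring.
rewrite -addrA lerDl addr_ge0// mulr_ge0// ?dotv_ge0 ?sqr_ge0 ?subr_ge0//.
by rewrite !mulr_ge0// ltW.
Qed.

Lemma prox_argmin u s :
  argmin (fun v => dotv s (v - u) + (2 * theta)^-1 * norm2 (v - u) ^+ 2 + g v)
  = prox (u - theta *: s).
Proof.
set F := fun v => _; set c := prox _.
have cE := proxP (u - theta *: s); rewrite -/c in cE.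
have cF w : F c + (1 + theta * m) / (2 * theta) * dotv (w - c) (w - c) <= F w.
  have := cg c w; rewrite /F !norm2_sqr.
  have sE : dotv s (w - c) = theta^-1 * (dotv (u - c) (w - c)) - dotv (grad g c) (w - c).
    apply: (@mulfI _ theta); first by rewrite gt_eqF.
    have -> : theta * (theta^-1 * dotv (u - c) (w - c) - dotv (grad g c) (w - c)) =
       dotv (u - c) (w - c) - theta * dotv (grad g c) (w - c).
      by field; rewrite gt_eqF.
    rewrite -!dotvZl -dotvBl; congr (dotv _ _).
    have -> : theta *: s = u - (c + theta *: grad g c) by rewrite cE subKr.
    by rewrite opprD addrA.
  have -> : dotv s (w - u) = dotv s (w - c) + dotv s (c - u).
    by rewrite -dotvDr addrA subrK.
  rewrite sE.
  have -> : w - u = (w - c) - (u - c) by rewrite opprB addrA subrK.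
  have -> : c - u = - (u - c) by rewrite opprB.
  move: (u - c) (w - c) => a b; rewrite !dotvE (dotvC b a).
  have -> : (1 + theta * m) / (2 * theta) = (2 * theta)^-1 + m / 2.
    by field; rewrite gt_eqF.
  have -> : (2 * theta)^-1 = theta^-1 / 2 by field; rewrite gt_eqF.
  lra.
have k0 : 0 < (1 + theta * m) / (2 * theta) by rewrite divr_gt0// mulr_gt0.
rewrite /argmin; case: xgetP => [v vE vmin|/(_ c) []]; last first.
  move=> w; apply: le_trans (cF w); rewrite lerDl mulr_ge0 ?dotv_ge0// ltW//.
have := le_trans (cF v) (vmin c); rewrite gerDl pmulr_rle0// => vc.
apply/eqP; rewrite -subr_eq0; apply/eqP/dotv_eq0/eqP.
by rewrite eq_le vc dotv_ge0.
Qed.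

End Prox.

(** * Measurability of random vectors and independence *)

Lemma bigsetI_seqE (T : Type) (I : eqType) (s : seq I) (E : I -> set T) :
  \big[setI/setT]_(i <- s) E i = [set w | forall i, i \in s -> E i w].
Proof.
elim: s => [|i s IH]; first by rewrite big_nil; apply/seteqP; split.
rewrite big_cons IH; apply/seteqP; split=> [w [Ei h] j|w h].
  by rewrite inE => /orP[/eqP->|/h].
by split; [apply: h; rewrite mem_head|move=> j js; apply: h; rewrite inE js orbT].
Qed.

Section BorelVectors.
Context {R : realType} {d : nat}.

(** Balls with rational centres and radii [1 / (n + 1)] form a countable basis.
    Together with the fact that a ball of the sup norm is a finite intersection
    of conditions on coordinates, this reduces Borel measurability of a random
    vector to that of its coordinates. *)
Lemma open_rV_bigcup (U : set 'rV[R]_d) : open U ->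
  U = \bigcup_(qn in [set qn : 'rV[rat]_d * nat |
         ball (map_mx ratr qn.1 : 'rV[R]_d) qn.2.+1%:R^-1 `<=` U])
        ball (map_mx ratr qn.1 : 'rV[R]_d) qn.2.+1%:R^-1.
Proof.
move=> oU; apply/seteqP; split=> [x Ux|x [qn /= h /h]//].
have /nbhs_ballP[e /= e0 xe] : nbhs x U by exact: open_nbhs_nbhs.
have e20 : 0 < e / 2 by rewrite divr_gt0.
have [n _ /= ne] := @near_infty_natSinv_lt R (PosNum e20).
have /(_ n (leqnn n))/= {}ne := ne.
have n0 : (0 : R) < n.+1%:R^-1 by rewrite invr_gt0.
have /choice[q qx] (i : 'I_d) : exists q : rat, ball (x 0 i) n.+1%:R^-1 (ratr q : R).
  have : ball (x 0 i) n.+1%:R^-1 !=set0 by exists (x 0 i); exact: ballxx.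
  move=> Bne; have [r [bq [q _ qr]]] := dense_rat Bne (@ball_open _ _ _ _).
  by exists q; rewrite qr.
exists (\row_i q i, n) => /=; last first.
  by split=> // i j; rewrite !mxE (ord1 i); apply: ball_sym.
move=> y [_ qy]; apply: xe; split=> // i j.
rewrite (ord1 i); have := qy 0 j; rewrite !mxE => {}qy.
apply: (@le_ball _ _ _ (n.+1%:R^-1 + n.+1%:R^-1)).
  by rewrite [leRHS]splitr lerD// ltW.
by apply: ball_triangle qy; exact: qx.
Qed.

Context {dT : measure_display} {T : measurableType dT}.

Lemma measurable_rV (X : T -> borelV R d) :
  (forall i, measurable_fun setT (fun t => (X t : 'rV[R]_d) 0 i)) ->
  measurable_fun setT X.
Proof.
move=> mX; apply: (@measurability _ _ _ (borelV R d) setT _ (@open 'rV[R]_d)) => // _ [U oU <-].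
rewrite setTI (open_rV_bigcup oU) preimage_bigcup bigcup_mkcond.
apply: countable_bigcupT_measurable => [|[q n]]; first exact: countableP.
case: ifPn => // _ /=.
have n0 : (0 : R) < n.+1%:R^-1 by rewrite invr_gt0.
have -> : X @^-1` ball (map_mx ratr q : 'rV[R]_d) n.+1%:R^-1 =
    \big[setI/setT]_(i < d)
      ((fun t => (X t : 'rV[R]_d) 0 i) @^-1` ball (ratr (q 0 i) : R) n.+1%:R^-1).
  rewrite bigsetI_seqE; apply/seteqP; split=> [t [_ h] i _|t h] /=.
    by have := h 0 i; rewrite mxE.
  split=> // i j; rewrite (ord1 i) mxE; apply: h.
  exact: mem_index_enum.
apply: bigsetI_measurable => i _; rewrite -[X in measurable X]setTI.
by apply: mX => //; apply: open_measurable; exact: ball_open.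
Qed.

Lemma measurable_comp_continuous (g : 'rV[R]_d -> R) (X : T -> borelV R d) :
  continuous g -> measurable_fun setT X ->
  measurable_fun setT (fun t => g (X t)).
Proof.
move=> cg mX; apply: (@measurable_comp _ _ _ _ _ _ setT (g : borelV R d -> R)) => //.
apply: (measurability _ (RGenOpens.measurableE R)).
move=> _ [_ [a [b ->] <-]]; rewrite setTI; apply: sub_sigma_algebra.
by apply: open_comp; [move=> x _; exact: cg|exact: interval_open].
Qed.

Lemma measurable_comp_continuousV (g : 'rV[R]_d -> 'rV[R]_d) (X : T -> borelV R d) :
  continuous g -> measurable_fun setT X ->
  measurable_fun setT (fun t => g (X t) : borelV R d).
Proof.
move=> cg mX; apply: (@measurable_comp _ _ _ _ _ _ setT (g : borelV R d -> borelV R d)) => //.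
apply: (@measurability _ _ _ (borelV R d) setT _ (@open 'rV[R]_d)) => // _ [U oU <-].
by rewrite setTI; apply: sub_sigma_algebra; apply: open_comp.
Qed.

Lemma measurable_coordv (X : T -> borelV R d) i : measurable_fun setT X ->
  measurable_fun setT (fun t => (X t : 'rV[R]_d) 0 i).
Proof.
move=> mX; apply: (@measurable_comp_continuous (fun v => v 0 i)) => //.
exact: coord_continuous.
Qed.

Lemma measurable_addv (X Y : T -> borelV R d) :
  measurable_fun setT X -> measurable_fun setT Y ->
  measurable_fun setT (fun t => (X t : 'rV[R]_d) + Y t : borelV R d).
Proof.
move=> mX mY; apply: measurable_rV => i; under eq_fun do rewrite mxE.
by apply: measurable_funD; exact: measurable_coordv.
Qed.

Lemma measurable_scalev (a : R) (X : T -> borelV R d) :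
  measurable_fun setT X ->
  measurable_fun setT (fun t => a *: (X t : 'rV[R]_d) : borelV R d).
Proof.
move=> mX; apply: measurable_rV => i; under eq_fun do rewrite mxE.
by apply: measurable_funM => //; exact: measurable_coordv.
Qed.

Lemma measurable_subv (X Y : T -> borelV R d) :
  measurable_fun setT X -> measurable_fun setT Y ->
  measurable_fun setT (fun t => (X t : 'rV[R]_d) - Y t : borelV R d).
Proof.
move=> mX mY; apply: measurable_addv => //; under eq_fun do rewrite -scaleN1r.
exact: measurable_scalev.
Qed.

Lemma measurable_sumv (I : Type) (r : seq I) (X : I -> T -> borelV R d) :
  (forall i, measurable_fun setT (X i)) ->
  measurable_fun setT (fun t => \sum_(i <- r) (X i t : 'rV[R]_d) : borelV R d).
Proof.
move=> mX; elim: r => [|i r IH].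
  by under eq_fun do rewrite big_nil; exact: measurable_cst.
by under eq_fun do rewrite big_cons; exact: measurable_addv.
Qed.

Lemma measurable_avgv (M : nat) (X : 'I_M -> T -> borelV R d) :
  (forall i, measurable_fun setT (X i)) ->
  measurable_fun setT (fun t => avgv (fun m => X m t : 'rV[R]_d) : borelV R d).
Proof. by move=> mX; apply: measurable_scalev; exact: measurable_sumv. Qed.

Lemma measurable_dotv (X Y : T -> borelV R d) :
  measurable_fun setT X -> measurable_fun setT Y ->
  measurable_fun setT (fun t => dotv (X t) (Y t)).
Proof.
move=> mX mY; apply: measurable_sum => i.
by apply: measurable_funM; exact: measurable_coordv.
Qed.

End BorelVectors.

Section Independence.
Context {R : realType} {dO : measure_display} {Omega : measurableType dO}.
Variable P : probability Omega R.

Section Pair.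
Context {d1 d2} {T1 : measurableType d1} {T2 : measurableType d2}.
Variables (X : {RV P >-> T1}) (Y : {RV P >-> T2}).
Hypothesis XY : forall A B, measurable A -> measurable B ->
  P (X @^-1` A `&` Y @^-1` B) = (P (X @^-1` A) * P (Y @^-1` B))%E.

(** The joint law of two independent variables is the product of their laws, by
    uniqueness of the product measure, so Tonelli's theorem applies. *)
Lemma indep_integral (phi : T1 * T2 -> \bar R) :
  measurable_fun setT phi -> (forall xy, 0 <= phi xy)%E ->
  (\int[P]_w phi (X w, Y w) = \int[P]_w1 \int[P]_w2 phi (X w1, Y w2))%E.
Proof.
move=> mphi phi0.
have mXY : measurable_fun setT (fun w => (X w, Y w)) by exact: measurable_fun_pair.
pose Z : {RV P >-> (T1 * T2)%type} := HB.pack (fun w => (X w, Y w))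
  (isMeasurableFun.Build _ _ _ _ _ mXY).
rewrite -[LHS](@ge0_integral_distribution _ _ _ _ _ P Z)//.
transitivity (\int[distribution P X \x distribution P Y]_z phi z)%E.
  apply: eq_measure_integral => A mA _; apply/esym.
  exact: (@product_measure_unique _ _ _ _ _ (distribution P X) (distribution P Y)
           (distribution P Z)).
rewrite fubini_tonelli1// ge0_integral_distribution//; last 2 first.
- exact: measurable_fun_fubini_tonelli_F.
- by move=> x; apply: integral_ge0.
apply: eq_integral => w _ /=; rewrite /fubini_F ge0_integral_distribution//.
exact: measurableT_comp.
Qed.

Lemma indep_integral_le (phi : T1 * T2 -> \bar R) (psi : Omega -> \bar R) :
  measurable_fun setT phi -> (forall xy, 0 <= phi xy)%E ->
  measurable_fun setT psi ->
  (forall w1, \int[P]_w2 phi (X w1, Y w2) <= psi w1)%E ->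
  (\int[P]_w phi (X w, Y w) <= \int[P]_w psi w)%E.
Proof.
move=> mphi phi0 mpsi le_psi; rewrite indep_integral//.
apply: ge0_le_integral => //.
- by move=> w _; apply: integral_ge0.
- have mF := measurable_fun_fubini_tonelli_F (m2 := distribution P Y) phi mphi phi0.
  apply: eq_measurable_fun (measurableT_comp mF (measurable_funPT X)) => w _ /=.
  by rewrite /fubini_F ge0_integral_distribution//; exact: measurableT_comp.
Qed.

End Pair.

(** The variables of a family that are indexed by a set [J] are represented by the
    sub-sigma-algebra that they generate on [Omega] itself; a quantity depends
    only on these variables when it is measurable for it. This avoids building
    infinite product spaces: an epoch reads an unbounded number of seeds. *)
Section Family.
Context {I : eqType}.
Variable F : I -> set (set Omega).
Hypothesis FI : forall i, setI_closed (F i).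
Hypothesis FT : forall i, F i setT.
Hypothesis Fm : forall i, F i `<=` measurable.
Hypothesis Find : mutually_independent P F.

(** A pi-system generating the sigma-algebra of [J]: the events on which mutual
    independence is defined. *)
Definition family_pi (J : set I) : set (set Omega) :=
  [set A | exists s : seq I, exists E : I -> set Omega,
     [/\ uniq s, forall i, i \in s -> J i, forall i, F i (E i) &
         A = \big[setI/setT]_(i <- s) E i]].

Definition family_gen (J : set I) : set (set Omega) := \bigcup_(i in J) F i.

Lemma family_pi_setI J : setI_closed (family_pi J).
Proof.
move=> _ _ [s1 [E1 [u1 s1J F1 ->]]] [s2 [E2 [u2 s2J F2 ->]]].
exists (undup (s1 ++ s2)), (fun i =>
  (if i \in s1 then E1 i else setT) `&` (if i \in s2 then E2 i else setT)).
split; first exact: undup_uniq.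
- by move=> i; rewrite mem_undup mem_cat => /orP[/s1J|/s2J].
- by move=> i; apply: FI; case: ifP.
rewrite !bigsetI_seqE; apply/seteqP; split=> [w [h1 h2] i _|w h].
  by split; case: ifPn => // ?; [exact: h1|exact: h2].
split=> i si.
  by have [] := h i; rewrite ?mem_undup ?mem_cat si.
by have [] := h i; rewrite ?mem_undup ?mem_cat si ?orbT.
Qed.

Lemma family_pi_measurable J : family_pi J `<=` measurable.
Proof.
move=> _ [s [E [_ _ FE ->]]]; apply: bigsetI_measurable => i _.
exact/Fm/FE.
Qed.

Lemma family_gen_sub J : <<s family_gen J >> `<=` <<s family_pi J >>.
Proof.
apply: smallest_sub; first exact: smallest_sigma_algebra.
move=> A [i Ji FA]; apply: sub_sigma_algebra.
exists [:: i], (fun j => if j == i then A else setT); split => //.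
- by move=> j; rewrite inE => /eqP->.
- by move=> j; case: eqP => // ->.
- by rewrite big_seq1 eqxx.
Qed.

Lemma family_pi_indep J1 J2 A B : J1 `&` J2 = set0 ->
  family_pi J1 A -> family_pi J2 B -> P (A `&` B) = (P A * P B)%E.
Proof.
move=> J12 [s1 [E1 [u1 s1J F1 ->]]] [s2 [E2 [u2 s2J F2 ->]]].
have s12 i : i \in s2 -> i \notin s1.
  move=> i2; apply/negP => i1; suff : (J1 `&` J2) i by rewrite J12.
  by split; [exact: s1J|exact: s2J].
pose E i := if i \in s1 then E1 i else E2 i.
have -> : \big[setI/setT]_(i <- s1) E1 i = \big[setI/setT]_(i <- s1) E i.
  by apply: eq_big_seq => i i1; rewrite /E i1.
have -> : \big[setI/setT]_(i <- s2) E2 i = \big[setI/setT]_(i <- s2) E i.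
  by apply: eq_big_seq => i i2; rewrite /E (negbTE (s12 _ i2)).
have FE i : F i (E i) by rewrite /E; case: ifP.
rewrite -big_cat !Find// ?big_cat// cat_uniq u1 u2 andbT/=.
by apply/hasPn => i /s12.
Qed.

(** Two finite measures, [A |-> P (A & B)] and [A |-> P A * P B], that agree on a
    pi-system agree on the sigma-algebra it generates. *)
Lemma sigma_pi_indep J (B : set Omega) : measurable B ->
  (forall A, family_pi J A -> P (A `&` B) = (P A * P B)%E) ->
  forall A, <<s family_pi J >> A -> P (A `&` B) = (P A * P B)%E.
Proof.
move=> mB h A sA.
have PB0 : 0 <= fine (P B) by rewrite fine_ge0.
have PBE : (fine (P B))%:E = P B by rewrite fineK// fin_num_measure.
have mE C : mscale (NngNum PB0) P C = (P C * P B)%E by rewrite muleC -[in RHS]PBE.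
have mrE C : mrestr P mB C = P (C `&` B) by [].
rewrite -mrE -mE.
apply: (@g_sigma_algebra_measure_unique _ R _ (family_pi J)
  (@family_pi_measurable J) (fun=> setT) _ _ (mrestr P mB)
  (mscale (NngNum PB0) P) (@family_pi_setI J)) => //.
- by move=> _; exists [::], (fun=> setT); rewrite big_nil.
- by rewrite bigcup_const.
- by move=> C PC; exact: etrans (h C PC) (esym (mE C)).
- move=> _; rewrite [X in (X < _)%E]mrE setTI.
  by rewrite (le_lt_trans (probability_le1 _ _))// ltry.
Qed.

Lemma family_indep J1 J2 A B : J1 `&` J2 = set0 ->
  <<s family_gen J1 >> A -> <<s family_gen J2 >> B -> P (A `&` B) = (P A * P B)%E.
Proof.
move=> J12 /family_gen_sub sA /family_gen_sub sB.
have mB : measurable B.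
  move: sB; apply: smallest_sub; last exact: family_pi_measurable.
  exact: sigma_algebra_measurable.
apply: (sigma_pi_indep mB) sA => {}A PA.
have mA : measurable A by exact: family_pi_measurable PA.
rewrite setIC muleC; apply: (sigma_pi_indep mA) sB => B' PB.
by rewrite setIC muleC; exact: family_pi_indep PA PB.
Qed.

Definition sub_sigmaType (J : set I) := g_sigma_algebraType (family_gen J).

Lemma measurable_family_id J : measurable_fun setT (id : Omega -> sub_sigmaType J).
Proof.
move=> _ B sB; rewrite setTI preimage_id.
move: sB; apply: smallest_sub; first exact: sigma_algebra_measurable.
by move=> A [i _ /Fm].
Qed.

(** To bound an expectation, freeze the variables of [J1] and average over those
    of [J2]. It is used in three places: for the fresh randomness of a single
    compression, for the length of an epoch, and for all the inputs of an
    iteration. *)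
Lemma family_integral_le J1 J2 (phi : sub_sigmaType J1 * sub_sigmaType J2 -> \bar R)
    (psi : Omega -> \bar R) :
  J1 `&` J2 = set0 -> measurable_fun setT phi -> (forall xy, 0 <= phi xy)%E ->
  measurable_fun setT psi ->
  (forall w1, \int[P]_w2 phi (w1, w2) <= psi w1)%E ->
  (\int[P]_w phi (w, w) <= \int[P]_w psi w)%E.
Proof.
move=> J12 mphi phi0 mpsi le_psi.
pose X : {RV P >-> sub_sigmaType J1} := HB.pack (id : Omega -> sub_sigmaType J1)
  (isMeasurableFun.Build _ _ _ _ _ (@measurable_family_id J1)).
pose Y : {RV P >-> sub_sigmaType J2} := HB.pack (id : Omega -> sub_sigmaType J2)
  (isMeasurableFun.Build _ _ _ _ _ (@measurable_family_id J2)).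
apply: (@indep_integral_le _ _ _ _ X Y) => // A B mA mB.
by rewrite !preimage_id; exact: (family_indep J12).
Qed.

End Family.
End Independence.

(** * The inequality along one realization of an epoch *)

Section WeightedSums.
Context {R : realType}.
Variable p : R.
Hypothesis p01 : 0 < p < 1.

Let p0 : 0 < p. Proof. by case/andP: p01. Qed.
Let q0 : 0 <= 1 - p. Proof. by case/andP: p01 => _; lra. Qed.

(** [geom p j] is the probability that an epoch has length [j + 1]. *)
Definition geom (j : nat) : R := p * (1 - p) ^+ j.

Lemma geom_ge0 j : 0 <= geom j.
Proof. by rewrite mulr_ge0 ?exprn_ge0// ltW. Qed.

Lemma geomS j : geom j.+1 = (1 - p) * geom j.
Proof. by rewrite /geom exprS; ring. Qed.

Lemma sum_geom T : \sum_(j < T) geom j = 1 - (1 - p) ^+ T.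
Proof.
elim: T => [|T IH]; first by rewrite big_ord0 expr0 subrr.
by rewrite big_ord_recr /= IH exprS /geom; ring.
Qed.

(** Replacing [a_(j+1)] by [a_j] under geometric weights costs a factor [1 - p];
    the resulting gain [p * sum_j w_j a_(j+1)] is what the whole analysis of an
    epoch lives on. *)
Lemma geom_shift (a : nat -> R) T : (forall j, 0 <= a j) -> a 0%N = 0 ->
  \sum_(j < T) geom j * a j <= (1 - p) * \sum_(j < T) geom j * a j.+1.
Proof.
move=> a0 a00; elim: T => [|T IH]; first by rewrite !big_ord0 mulr0.
case: T IH => [_|T _].
  rewrite !big_ord1 a00 mulr0; apply: mulr_ge0 => //.
  by rewrite mulr_ge0// geom_ge0.
rewrite big_ord_recl a00 mulr0 add0r [in leRHS]big_ord_recr/= mulrDr.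
rewrite mulr_sumr.
under eq_bigr do rewrite /bump/= add1n geomS -mulrA.
by rewrite lerDl mulr_ge0// mulr_ge0// geom_ge0.
Qed.

End WeightedSums.

(** A realization of an epoch started at [x]: [u] are the iterates, [e] the average
    compression errors, [u - e] the virtual iterates, whose update [ustep] is
    free of errors. *)
Section Path.
Context {R : realType} {d : nat}.
Implicit Types (v w x y z : 'rV[R]_d).
Variables (f h : 'rV[R]_d -> R) (mu delta theta p : R).
Hypothesis mu0 : 0 < mu.
Hypothesis fsc : strongly_convex mu f.
Hypothesis hlip : forall v w, dotv (grad h v - grad h w) (grad h v - grad h w)
  <= delta ^+ 2 * dotv (v - w) (v - w).
Hypothesis p01 : 0 < p < 1.
Hypothesis theta0 : 0 < theta.
Hypothesis theta_delta : (theta * delta) ^+ 2 = p ^+ 3 / 576.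
Let p0 : 0 < p. Proof. by case/andP: p01. Qed.
Let p1 : p < 1. Proof. by case/andP: p01. Qed.
Variables (x : 'rV[R]_d) (u e : nat -> 'rV[R]_d).
Hypothesis u0 : u 0%N = x.
Hypothesis e0 : e 0%N = 0.
Hypothesis ustep : forall j, u j.+1 - e j.+1 =
  u j - e j - theta *: (grad f (u j.+1) + grad h (u j.+1) - grad h (u j)).

Local Notation w_ := (geom p).
Let a_ j := dotv (u j - e j - x) (u j - e j - x).
Let b_ j := dotv (e j) (e j).

Let hlip2 v w : theta ^+ 2 * dotv (grad h v - grad h w) (grad h v - grad h w)
  <= p ^+ 3 / 576 * dotv (v - w) (v - w).
Proof.
rewrite -theta_delta exprMn -[leRHS]mulrA.
by apply: ler_wpM2l; [exact: sqr_ge0|exact: hlip].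
Qed.

(** By [ustep], [theta grad f (u_(j+1))] is the displacement of the virtual iterate
    up to the Lipschitz term in [h], so the inner product telescopes in [a_j] up
    to errors. The squared displacement gained in the telescoping absorbs the
    cross terms, each of which is split by Young's inequality. *)
Lemma path_step j :
  theta * dotv (grad f (u j.+1)) (u j.+1 - x) <=
  (a_ j - a_ j.+1) / 2 + p / 8 * a_ j.+1 + 6 / 5 * b_ j.+1 + 36^-1 * b_ j.
Proof.
have [pp0 pp1] := andP p01.
rewrite /a_ /b_.
set H := grad h (u j.+1) - grad h (u j).
set b := u j.+1 - e j.+1 - x; set a := u j - e j - x.
have Fe : theta *: grad f (u j.+1) = a - b - theta *: H.
  have -> : a - b = theta *: (grad f (u j.+1) + grad h (u j.+1) - grad h (u j)).
    rewrite /a /b ustep; move: (u j - e j) (theta *: _) => A K.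
    by apply/rowP => i; rewrite !mxE; ring.
  by rewrite -addrA scalerDr -/H addrK.
have ue : u j.+1 - x = b + e j.+1 by rewrite /b addrAC subrK.
have uu : u j.+1 - u j = (b - a) + (e j.+1 - e j).
  by rewrite /b /a; apply/rowP => i; rewrite !mxE; ring.
have hH := hlip2 (u j.+1) (u j); rewrite -/H uu in hH.
rewrite -dotvZl Fe ue.
move: (e j.+1) (e j) hH => e1 e2 hH {Fe ue uu}; clearbody a b H.
have p18 : 0 < p / 8 by lra.
have y1 : - (theta * dotv H (b + e1)) <=
    4 / p * (theta ^+ 2 * dotv H H) + p / 16 * dotv (b + e1) (b + e1).
  have := @dotv_young _ _ (8 / p) (- (theta *: H)) (b + e1) (ltac:(by rewrite divr_gt0)).
  rewrite dotvNl dotvNr dotvNl opprK dotvZl [dotv (_ *: _) (_ *: _)]dotvZl dotvZr invf_div.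
  suff -> : 8 / p / 2 * (theta * (theta * dotv H H)) + p / 8 / 2 * dotv (b + e1) (b + e1) =
    4 / p * (theta ^+ 2 * dotv H H) + p / 16 * dotv (b + e1) (b + e1) by [].
  by field; rewrite gt_eqF.
have y2 : 4 / p * (theta ^+ 2 * dotv H H) <=
    144^-1 * dotv (b - a + (e1 - e2)) (b - a + (e1 - e2)).
  apply: (@le_trans _ _ (4 / p * (p ^+ 3 / 576 * dotv (b - a + (e1 - e2)) (b - a + (e1 - e2))))).
    by apply: ler_wpM2l => //; rewrite divr_ge0// ltW.
  have -> : 4 / p * (p ^+ 3 / 576 * dotv (b - a + (e1 - e2)) (b - a + (e1 - e2))) =
    p ^+ 2 * (144^-1 * dotv (b - a + (e1 - e2)) (b - a + (e1 - e2))).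
    by field; rewrite gt_eqF.
  rewrite -[leRHS]mul1r ler_wpM2r ?mulr_ge0 ?dotv_ge0 ?invr_ge0//.
  by rewrite expr_le1//; lra.
have y3 := dotvD_le2 (b - a) (e1 - e2).
have y4 := dotvB_le2 e1 e2.
have y5 : p / 16 * dotv (b + e1) (b + e1) <= p / 8 * dotv b b + 8^-1 * dotv e1 e1.
  apply: (@le_trans _ _ (p / 16 * (2 * dotv b b + 2 * dotv e1 e1))).
    by apply: ler_wpM2l; [lra|exact: dotvD_le2].
  have : p * dotv e1 e1 <= 1 * dotv e1 e1 by apply: ler_wpM2r; [exact: dotv_ge0|lra].
  lra.
have y6 : dotv (a - b) e1 <= 4^-1 * dotv (b - a) (b - a) + dotv e1 e1.
  have := @dotv_young _ _ (1 / 2) (a - b) e1 (ltac:(lra)).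
  have -> : dotv (a - b) (a - b) = dotv (b - a) (b - a).
    by rewrite -opprB dotvNl dotvNr opprK.
  by rewrite invf_div divr1 mulrC; lra.
have y7 : dotv (a - b) b = (dotv a a - dotv b b - dotv (b - a) (b - a)) / 2.
  by rewrite !dotvE (dotvC b a); field.
have -> : dotv (a - b - theta *: H) (b + e1) =
    dotv (a - b) b + dotv (a - b) e1 - theta * dotv H (b + e1).
  by rewrite [LHS]dotvBl dotvZl dotvDr.
rewrite y7.
have D0 := dotv_ge0 (b - a); have E0 := dotv_ge0 e1.
move: (dotv (b - a) (b - a)) (dotv (b - a + (e1 - e2)) (b - a + (e1 - e2)))
  (dotv (e1 - e2) (e1 - e2)) (dotv (a - b) e1) (dotv H (b + e1)) (dotv H H)
  (dotv (b + e1) (b + e1)) y1 y2 y3 y4 y5 y6 D0 {y7 hH}.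
move=> ? ? ? ? ? ? ? *.
by lra.
Qed.

Let a_ge0 j : 0 <= a_ j. Proof. exact: dotv_ge0. Qed.
Let b_ge0 j : 0 <= b_ j. Proof. exact: dotv_ge0. Qed.
Let a_0 : a_ 0%N = 0. Proof. by rewrite /a_ e0 u0 subr0 subrr dot0v. Qed.
Let b_0 : b_ 0%N = 0. Proof. by rewrite /b_ e0 dot0v. Qed.

(** Abel summation: the telescoping part of [path_step], weighted geometrically,
    leaves [- p / 2] times the weighted sum of [a_(j+1)]. *)
Lemma path_sum T :
  \sum_(j < T) w_ j * (theta * dotv (grad f (u j.+1)) (u j.+1 - x)) <=
  - (3 / 8) * p * (\sum_(j < T) w_ j * a_ j.+1) + 5 / 4 * (\sum_(j < T) w_ j * b_ j.+1).
Proof.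
have [pp0 pp1] := andP p01.
have sa := geom_shift p01 T a_ge0 a_0.
have sb := geom_shift p01 T b_ge0 b_0.
have sb0 : 0 <= \sum_(j < T) w_ j * b_ j.+1.
  by apply: sumr_ge0 => j _; rewrite mulr_ge0// geom_ge0.
set A := \sum_(j < T) w_ j * a_ j.+1 in sa *.
set B := \sum_(j < T) w_ j * b_ j.+1 in sb sb0 *.
apply: (@le_trans _ _ ((\sum_(j < T) w_ j * a_ j - A) / 2 + p / 8 * A + 6 / 5 * B
   + 36^-1 * \sum_(j < T) w_ j * b_ j)).
  rewrite /A /B -sumrB mulr_suml !mulr_sumr -!big_split /=.
  apply: ler_sum => j _.
  apply: (le_trans (ler_wpM2l (geom_ge0 p01 j) (path_step j))).
  by rewrite le_eqVlt; apply/orP; left; apply/eqP; field.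
have : p * B <= B by rewrite -[leRHS]mul1r ler_wpM2r//; lra.
have : 0 <= p * B by rewrite mulr_ge0//; lra.
lra.
Qed.

Variable fmin : R.
Hypothesis fminP : forall v, fmin <= f v.

(** By convexity the inner products of [path_sum] are at least
    [f (u_(j+1)) - f x], hence at least [fmin - f x]. *)
Lemma path_bound T :
  3 / 8 * p * (\sum_(j < T) w_ j * a_ j.+1) <=
  5 / 4 * (\sum_(j < T) w_ j * b_ j.+1) + theta * (f x - fmin).
Proof.
have [pp0 pp1] := andP p01.
have := path_sum T.
suff : - (theta * (f x - fmin)) <=
  \sum_(j < T) w_ j * (theta * dotv (grad f (u j.+1)) (u j.+1 - x)) by lra.
have s1 : \sum_(j < T) w_ j <= 1.
  by rewrite sum_geom gerBl exprn_ge0// subr_ge0 ltW.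
have c0 : 0 <= theta * (f x - fmin) by rewrite mulr_ge0 ?subr_ge0// ltW.
apply: (@le_trans _ _ (\sum_(j < T) w_ j * - (theta * (f x - fmin)))).
  rewrite -mulr_suml mulrN lerN2.
  by rewrite -[leRHS]mul1r ler_wpM2r.
apply: ler_sum => j _; apply: ler_wpM2l; first exact: geom_ge0.
rewrite -mulrN; apply: ler_wpM2l; first exact: ltW.
have := fsc x (u j.+1).
have : 0 <= mu / 2 * norm2 (x - u j.+1) ^+ 2.
  by rewrite mulr_ge0 ?sqr_ge0// divr_ge0// ltW.
have := fminP (u j.+1).
rewrite -(opprB (u j.+1) x) dotvNr; lra.
Qed.

(** The gradient estimate of the algorithm, before it is known to be a sum of
    gradients. *)
Definition Gest n := p *: (grad h x - grad h (u n) + theta^-1 *: (x - (u n - e n))).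

(** The virtual update telescopes, and the terms in [h] cancel against the
    correction [grad h x - grad h (u n)]. *)
Lemma GestE n : Gest n = p *: \sum_(j < n) grad f (u j.+1).
Proof.
congr (_ *: _); elim: n => [|n IH].
  by rewrite big_ord0 u0 e0 !subrr add0r subr0 subrr scaler0.
rewrite big_ord_recr /= -IH ustep.
move: (grad h x) (grad h (u n.+1)) (grad h (u n)) (grad f _) (u n - e n).
move=> Hx H' H F A; apply/rowP => i; rewrite !mxE.
by field; rewrite gt_eqF.
Qed.

Lemma GestS n : Gest n.+1 = Gest n + p *: grad f (u n.+1).
Proof. by rewrite !GestE big_ord_recr /= scalerDr. Qed.

(** A geometric variable [N] satisfies [E (p * sum_(j <= N) c_j) = E c_N]: in mean
    [Gest N] is the gradient at the output of the epoch. Truncation of the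
    expectation at length [T] leaves the last term, whose expectation vanishes
    as [T] grows. *)
Lemma Gest_unbiased T v :
  \sum_(j < T) w_ j * dotv (Gest j.+1) v =
  \sum_(j < T) w_ j * dotv (grad f (u j.+1)) v - (1 - p) ^+ T * dotv (Gest T) v.
Proof.
elim: T => [|T IH].
  by rewrite !big_ord0 GestE big_ord0 scaler0 dot0v mulr0 subrr.
by rewrite !big_ord_recr /= IH GestS !dotvE exprS /geom; ring.
Qed.

Lemma Gest_le n :
  dotv (Gest n) (Gest n) <= (p / theta) ^+ 2 * (3 * a_ n + b_ n).
Proof.
have [pp0 pp1] := andP p01.
rewrite /Gest dotvZl dotvZr /a_ /b_.
set H := grad h x - grad h (u n); set a := u n - e n - x.
have -> : x - (u n - e n) = - a.
  by rewrite /a; apply/rowP => i; rewrite !mxE; ring.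
have hH := hlip2 x (u n); rewrite -/H in hH.
have xu : x - u n = - a - e n.
  by rewrite /a; apply/rowP => i; rewrite !mxE; ring.
rewrite xu in hH; move: (e n) hH => b hH {xu}; clearbody a H.
have th : theta != 0 by rewrite gt_eqF.
have -> : p * (p * dotv (H + theta^-1 *: - a) (H + theta^-1 *: - a)) =
   (p / theta) ^+ 2 * dotv (theta *: H - a) (theta *: H - a).
  by rewrite !dotvE (dotvC a H); field.
apply: ler_wpM2l; first exact: sqr_ge0.
have h1 := dotvB_le2 (theta *: H) a.
have h2 := dotvB_le2 (- a) b; rewrite dotvNl dotvNr opprK in h2.
have p3 : p ^+ 3 <= 1 by rewrite exprn_ile1//; lra.
have h3 : p ^+ 3 / 576 * dotv (- a - b) (- a - b) <= 576^-1 * dotv (- a - b) (- a - b).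
  by apply: ler_wpM2r; [exact: dotv_ge0|lra].
have hE : dotv (theta *: H) (theta *: H) = theta ^+ 2 * dotv H H.
  by rewrite dotvZl dotvZr expr2 mulrA.
have := dotv_ge0 a; have := dotv_ge0 b.
rewrite hE in h1; lra.
Qed.

Variables (y z xs : 'rV[R]_d) (tau alpha : R).
Hypothesis tau01 : 0 < tau <= 1.
Let tau0 : 0 < tau. Proof. by case/andP: tau01. Qed.
Hypothesis xE : x = tau *: z + (1 - tau) *: y.
Hypothesis alpha0 : 0 < alpha.
Hypothesis alphaE : tau * alpha = theta / (36 * p).
Hypothesis xs_min : fmin = f xs.

(** Weight of the squared distance of [z] to the minimizer in the potential. *)
Definition cz := tau * ((2 * alpha)^-1 + mu / 2).

Definition zstep (G yy : 'rV[R]_d) : 'rV[R]_d :=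
  (alpha^-1 + mu)^-1 *: (alpha^-1 *: z - G + mu *: yy).

Lemma zstep_argmin G yy :
  argmin (fun v => (2 * alpha)^-1 * norm2 (v - z) ^+ 2 + dotv G v
     + mu / 2 * norm2 (v - yy) ^+ 2) = zstep G yy.
Proof.
set F := fun v => _; set c := zstep G yy.
have am : 0 < alpha^-1 + mu by rewrite addr_gt0// invr_gt0.
have cE : (alpha^-1 + mu) *: c = alpha^-1 *: z - G + mu *: yy.
  by rewrite /c /zstep scalerA divff ?scale1r// gt_eqF.
have FE v : F v = F c + (alpha^-1 + mu) / 2 * dotv (v - c) (v - c).
  rewrite /F !norm2_sqr.
  have GE : G = alpha^-1 *: z + mu *: yy - (alpha^-1 + mu) *: c.
    by rewrite cE opprD opprB addrACA addrA addrK addrC subrK.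
  have -> : (2 * alpha)^-1 = alpha^-1 / 2 by field; rewrite gt_eqF.
  rewrite GE; clearbody c; rewrite !dotvE (dotvC z v) (dotvC c v) (dotvC yy v) (dotvC z c) (dotvC yy c).
  by field; rewrite gt_eqF.
rewrite /argmin; case: xgetP => [v _ vmin|/(_ c) []]; last first.
  move=> v; rewrite (FE v) lerDl mulr_ge0 ?dotv_ge0//.
  by rewrite divr_ge0// ltW.
have := vmin c; rewrite [leLHS]FE gerDl pmulr_rle0 ?divr_gt0// => vc.
apply/eqP; rewrite -subr_eq0; apply/eqP/dotv_eq0/eqP.
by rewrite eq_le vc dotv_ge0.
Qed.

(** Three-point inequality for the mirror step, in the form of the nonnegativity of
    two squares. *)
Lemma zstep_bound G yy :
  cz * dotv (zstep G yy - xs) (zstep G yy - xs) <=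
  tau / (2 * alpha) * dotv (z - xs) (z - xs) + tau * mu / 2 * dotv (yy - xs) (yy - xs)
  + tau * alpha / 2 * dotv G G - tau * dotv G (z - xs).
Proof.
have [pp0 pp1] := andP p01.
have [tt0 tt1] := andP tau01.
have am : 0 < alpha^-1 + mu by rewrite addr_gt0// invr_gt0.
set c := zstep G yy.
have cE : (alpha^-1 + mu) *: c = alpha^-1 *: z - G + mu *: yy.
  by rewrite /c /zstep scalerA divff ?scale1r// gt_eqF.
have GE : G = alpha^-1 *: (z - c) + mu *: (yy - c).
  have -> : G = alpha^-1 *: z + mu *: yy - (alpha^-1 + mu) *: c.
    by rewrite cE opprD opprB addrACA addrA addrK addrC subrK.
  by rewrite scalerDl !scalerBr opprD addrACA.
clearbody c; rewrite /cz.
have -> : z - xs = (z - c) + (c - xs) by rewrite addrA subrK.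
have -> : yy - xs = (yy - c) + (c - xs) by rewrite addrA subrK.
move: (z - c) (yy - c) (c - xs) GE => A B D GE {cE}.
have hG : 0 <= dotv (A - alpha *: G) (A - alpha *: G) by exact: dotv_ge0.
have hB := dotv_ge0 B.
have an0 : alpha != 0 by rewrite gt_eqF.
have GD : dotv G D = alpha^-1 * dotv A D + mu * dotv B D by rewrite GE !dotvE.
rewrite -subr_ge0.
have -> : tau / (2 * alpha) * dotv (A + D) (A + D)
   + tau * mu / 2 * dotv (B + D) (B + D) + tau * alpha / 2 * dotv G G
   - tau * dotv G (A + D) - tau * ((2 * alpha)^-1 + mu / 2) * dotv D D =
   tau / (2 * alpha) * dotv (A - alpha *: G) (A - alpha *: G)
   + tau * mu / 2 * dotv B B.
  rewrite !dotvDr GD !dotvE (dotvC D A) (dotvC D B) (dotvC G A).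
  by field.
have k1 : 0 <= tau / (2 * alpha) by rewrite divr_ge0 ?mulr_ge0 ?ltW.
have k2 : 0 <= tau * mu / 2 by rewrite divr_ge0 ?mulr_ge0 ?ltW.
by rewrite addr_ge0// mulr_ge0.
Qed.

Definition potential (yy zz : 'rV[R]_d) := f yy - fmin + cz * dotv (zz - xs) (zz - xs).

(** The coupling argument of accelerated methods. Strong convexity at [u_(j+1)] is
    used towards [y] with weight [1 - tau] and towards [xs] with weight [tau];
    since [x = tau z + (1 - tau) y], what remains is [tau <grad f, z - xs>],
    which [Gest_unbiased] trades for [tau <Gest, z - xs>] and [zstep_bound]
    estimates. The term [tau alpha / 2 |Gest|^2] this costs is a small fraction
    of the decrease provided by [path_sum]. *)
Lemma path_potential T :
  \sum_(j < T) w_ j * potential (u j.+1) (zstep (Gest j.+1) (u j.+1)) <=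
  (1 - tau) * (f y - fmin) + tau / (2 * alpha) * dotv (z - xs) (z - xs)
  + (1 - p) ^+ T * ((p / theta) ^+ 2 * (3 * a_ T + b_ T) + dotv (z - xs) (z - xs))
  + theta^-1 * (- (p / 3) * (\sum_(j < T) w_ j * a_ j.+1)
                + 4 / 3 * (\sum_(j < T) w_ j * b_ j.+1)).
Proof.
have [pp0 pp1] := andP p01.
have [tt0 tt1] := andP tau01.
set A := \sum_(j < T) w_ j * a_ j.+1.
set B := \sum_(j < T) w_ j * b_ j.+1.
have B0 : 0 <= B by apply: sumr_ge0 => j _; rewrite mulr_ge0// geom_ge0.
have A0 : 0 <= A by apply: sumr_ge0 => j _; rewrite mulr_ge0// geom_ge0.
set C := (1 - tau) * (f y - fmin) + tau / (2 * alpha) * dotv (z - xs) (z - xs).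
have C0 : 0 <= C.
  rewrite addr_ge0// mulr_ge0// ?subr_ge0 ?dotv_ge0//.
  by rewrite divr_ge0 ?mulr_ge0 ?ltW.
pose S1 := \sum_(j < T) w_ j * (theta * dotv (grad f (u j.+1)) (u j.+1 - x)).
have hS1 : S1 <= _ := path_sum T; rewrite -/A -/B in hS1.
have step j : potential (u j.+1) (zstep (Gest j.+1) (u j.+1)) <=
   C + theta^-1 * (theta * dotv (grad f (u j.+1)) (u j.+1 - x))
   + tau * (dotv (grad f (u j.+1)) (z - xs) - dotv (Gest j.+1) (z - xs))
   + theta / (72 * p) * ((p / theta) ^+ 2 * (3 * a_ j.+1 + b_ j.+1)).
  have zb := zstep_bound (Gest j.+1) (u j.+1).
  have f1 := fsc y (u j.+1); have f2 := fsc xs (u j.+1).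
  rewrite /potential /C.
  have -> : theta^-1 * (theta * dotv (grad f (u j.+1)) (u j.+1 - x)) =
     dotv (grad f (u j.+1)) (u j.+1 - x) by rewrite mulKf// gt_eqF.
  have gb : tau * alpha / 2 * dotv (Gest j.+1) (Gest j.+1) <=
     theta / (72 * p) * ((p / theta) ^+ 2 * (3 * a_ j.+1 + b_ j.+1)).
    have -> : tau * alpha / 2 = theta / (72 * p).
      by rewrite alphaE; field; rewrite gt_eqF.
    by apply: ler_wpM2l; [rewrite divr_ge0 ?mulr_ge0// ltW|exact: Gest_le].
  have ey : (1 - tau) * (dotv (grad f (u j.+1)) (y - u j.+1))
     + tau * dotv (grad f (u j.+1)) (xs - u j.+1) =
     - dotv (grad f (u j.+1)) (u j.+1 - x) - tau * dotv (grad f (u j.+1)) (z - xs).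
    by rewrite xE !dotvE; ring.
  have sy : 0 <= mu / 2 * norm2 (y - u j.+1) ^+ 2.
    by rewrite mulr_ge0 ?sqr_ge0// divr_ge0// ltW.
  have f1' : (1 - tau) * (f (u j.+1) + dotv (grad f (u j.+1)) (y - u j.+1)) <= (1 - tau) * f y.
    by apply: ler_wpM2l; lra.
  rewrite norm2_sqr in f2.
  have xu : dotv (xs - u j.+1) (xs - u j.+1) = dotv (u j.+1 - xs) (u j.+1 - xs).
    by rewrite -opprB dotvNl dotvNr opprK.
  rewrite xu in f2.
  have f2' := ler_wpM2l (ltac:(lra) : 0 <= tau) f2.
  rewrite xs_min; lra.
have : \sum_(j < T) w_ j * potential (u j.+1) (zstep (Gest j.+1) (u j.+1)) <=
   (\sum_(j < T) w_ j) * C + theta^-1 * S1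
   + tau * (\sum_(j < T) w_ j * dotv (grad f (u j.+1)) (z - xs)
           - \sum_(j < T) w_ j * dotv (Gest j.+1) (z - xs))
   + theta / (72 * p) * ((p / theta) ^+ 2 * (3 * A + B)).
  rewrite /S1 /A /B -sumrB mulr_suml !mulr_sumr -!big_split/= !mulr_sumr -!big_split/=.
  apply: ler_sum => j _.
  apply: (le_trans (ler_wpM2l (geom_ge0 p01 j) (step j))).
  by rewrite le_eqVlt; apply/orP; left; apply/eqP; ring.
rewrite Gest_unbiased opprB [X in tau * X]addrC subrK sum_geom.
have q0 : 0 <= (1 - p) ^+ T by rewrite exprn_ge0//; lra.
have r1 : (1 - (1 - p) ^+ T) * C <= C by rewrite mulrBl mul1r gerBl mulr_ge0.
have r2 : tau * ((1 - p) ^+ T * dotv (Gest T) (z - xs)) <=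
    (1 - p) ^+ T * ((p / theta) ^+ 2 * (3 * a_ T + b_ T) + dotv (z - xs) (z - xs)).
  rewrite mulrCA; apply: ler_wpM2l => //.
  have yg := @dotv_young _ _ 1 (Gest T) (z - xs) ltr01; rewrite invr1 in yg.
  have G0 := dotv_ge0 (Gest T); have Z0 := dotv_ge0 (z - xs).
  have Gl := Gest_le T.
  have yg' : dotv (Gest T) (z - xs) <= dotv (Gest T) (Gest T) + dotv (z - xs) (z - xs).
    by lra.
  have s0 : 0 <= dotv (Gest T) (Gest T) + dotv (z - xs) (z - xs) by lra.
  apply: (@le_trans _ _ (tau * (dotv (Gest T) (Gest T) + dotv (z - xs) (z - xs)))).
    by apply: ler_wpM2l => //; lra.
  apply: (@le_trans _ _ (1 * (dotv (Gest T) (Gest T) + dotv (z - xs) (z - xs)))).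
    by apply: ler_wpM2r => //; lra.
  lra.
have r3 : theta^-1 * S1 + theta / (72 * p) * ((p / theta) ^+ 2 * (3 * A + B)) <=
    theta^-1 * (- (p / 3) * A + 4 / 3 * B).
  have -> : theta / (72 * p) * ((p / theta) ^+ 2 * (3 * A + B)) =
    theta^-1 * (p / 72 * (3 * A + B)).
    by field; rewrite !gt_eqF.
  rewrite -mulrDr; apply: ler_wpM2l; first by rewrite invr_ge0 ltW.
  have : p * B <= B by rewrite -[leRHS]mul1r ler_wpM2r//; lra.
  lra.
lra.
Qed.

End Path.

(** * The epoch in terms of its virtual iterate *)

Section Epoch.
Context {R : realType} {d M : nat} {W : Type}.
Variables (s : 'I_M) (f : 'I_M -> 'rV[R]_d -> R).
Variables (delta mu theta : R).
Hypothesis ftd : forall m, twice_differentiable (f m).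
Hypothesis delta0 : 0 < delta.
Hypothesis frel : related delta f.
Hypothesis mu0 : 0 < mu.
Hypothesis fsc : strongly_convex mu (avgf f).
Hypothesis theta0 : 0 < theta.
Hypothesis theta_small : theta * delta < 1.

Local Notation fa := (avgf f).
Local Notation h := (fun v => f s v - avgf f v).

Lemma diff_f m x : differentiable (f m) x. Proof. by case: (ftd m). Qed.
Lemma diff_grad m x : differentiable (grad (f m)) x. Proof. by case: (ftd m). Qed.
Lemma diff_fa x : differentiable fa x.
Proof. by apply: differentiable_avgf => m; exact: diff_f. Qed.

Lemma grad_fa x : grad fa x = avgv (fun m => grad (f m) x).
Proof. by apply: grad_avgf => m; exact: diff_f. Qed.

Lemma diff_grad_fa x : differentiable (grad fa) x.
Proof.
have -> : grad fa = M%:R^-1 *: \sum_(m < M) grad (f m).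
  by apply/funext => z; rewrite scalrfctE fct_sumE grad_fa.
by apply: differentiableZ; apply: differentiable_sum => m; exact: diff_grad.
Qed.

Lemma M_gt0 : 0 < M%:R :> R.
Proof. by rewrite ltr0n; case: M s => // -[]. Qed.

Lemma avgvD (F G : 'I_M -> 'rV[R]_d) :
  avgv (fun m => F m + G m) = avgv F + avgv G.
Proof. by rewrite /avgv big_split scalerDr. Qed.

Lemma avgvZ (a : R) (F : 'I_M -> 'rV[R]_d) :
  avgv (fun m => a *: F m) = a *: avgv F.
Proof. rewrite /avgv -scaler_sumr. by rewrite !scalerA mulrC. Qed.

Lemma avgvN (F : 'I_M -> 'rV[R]_d) : avgv (fun m => - F m) = - avgv F.
Proof. by rewrite /avgv sumrN scalerN. Qed.

Lemma avgv_cst (v : 'rV[R]_d) : avgv (fun _ : 'I_M => v) = v.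
Proof.
rewrite /avgv sumr_const card_ord -[v *+ _]scaler_nat scalerA mulVf ?scale1r//.
by rewrite gt_eqF// M_gt0.
Qed.

Lemma related_lipschitz m x y :
  dotv (grad (f m) x - grad fa x - (grad (f m) y - grad fa y))
       (grad (f m) x - grad fa x - (grad (f m) y - grad fa y))
  <= delta ^+ 2 * dotv (x - y) (x - y).
Proof.
have dG z : differentiable (grad (f m) - grad fa) z.
  by apply: differentiableB; [exact: diff_grad|exact: diff_grad_fa].
apply: (lipschitz_field dG) => z v.
rewrite deriveB; [|exact/diff_derivable/diff_grad|exact/diff_derivable/diff_grad_fa].
rewrite !deriveEjacobian; [|exact: diff_grad_fa|exact: diff_grad].
rewrite -mulmxBr; apply: spectral_norm_le; first exact: ltW.
exact: frel.
Qed.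

Lemma diff_h x : differentiable h x.
Proof. by apply: differentiableB; [exact: diff_f|exact: diff_fa]. Qed.

Lemma grad_h x : grad h x = grad (f s) x - grad fa x.
Proof. by rewrite gradB//; [exact: diff_f|exact: diff_fa]. Qed.

Lemma h_lipschitz x y :
  dotv (grad h x - grad h y) (grad h x - grad h y) <= delta ^+ 2 * dotv (x - y) (x - y).
Proof. by rewrite !grad_h; exact: related_lipschitz. Qed.

Lemma fs_convex v w :
  f s v + dotv (grad (f s) v) (w - v) + (mu - delta) / 2 * dotv (w - v) (w - v) <= f s w.
Proof.
have h1 := lipschitz_grad_lower (ltW delta0) diff_h h_lipschitz w v.
have h2 := fsc w v.
have eh : dotv (grad h v) (w - v) =
    dotv (grad (f s) v) (w - v) - dotv (grad fa v) (w - v).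
  by rewrite grad_h dotvBl.
by rewrite norm2_sqr in h2; rewrite eh /= in h1; lra.
Qed.

Lemma sigma_gt0 : 0 < 1 + theta * (mu - delta).
Proof.
have ts := theta_small; have tm : 0 < theta * mu by exact: mulr_gt0.
by rewrite mulrBr; lra.
Qed.

Local Notation pr := (prox (f s) theta).

Lemma prE q : pr q + theta *: grad (f s) (pr q) = q.
Proof. exact: (proxP (diff_f s) fs_convex theta0 sigma_gt0). Qed.

(** Topology on row vectors comes from the sup norm, the Lipschitz bound from the
    Euclidean one; a coordinate is dominated by the Euclidean norm, and the
    Euclidean distance to [q] is continuous. *)
Lemma continuous_prox : continuous pr.
Proof.
move=> q; apply/(@cvgrPdist_lt R 'rV[R]_d _ (nbhs q) (nbhs_filter q)) => eps eps0.
set sg := 1 + theta * (mu - delta).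
have sg0 : 0 < sg := sigma_gt0.
have c : (fun z => 2 / 2 * dotv (z - q) (z - q)) x @[x --> q] --> (0 : R).
  have := differentiable_continuous (differentiable_quad 2 q q).
  by rewrite /prop_for /continuous_at /= subrr dot0v mulr0.
have e2 : 0 < (sg * eps) ^+ 2 by rewrite exprn_gt0// mulr_gt0.
move/(@cvgrPdist_lt R R^o _ (nbhs q) (nbhs_filter q)) : c => /(_ _ e2); apply: (@filterS _ _ (nbhs_filter q)) => q' /=.
rewrite sub0r normrN divff ?pnatr_eq0// mul1r ger0_norm ?dotv_ge0// => hq.
have hp := prox_lipschitz (diff_f s) fs_convex theta0 sigma_gt0 q q'.
rewrite -/sg in hp.
have qq : dotv (q - q') (q - q') = dotv (q' - q) (q' - q).
  by rewrite -opprB dotvNl dotvNr opprK.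
rewrite [ltLHS]/Num.Def.normr/= mx_normrE.
apply/bigmax_ltP; split => // -[i j] _ /=; rewrite (ord1 i).
have := sqr_coord_le (pr q - pr q') j.
set t := (pr q - pr q') 0 j => ht.
rewrite -(@ltr_pXn2r _ 2)// ?nnegrE// 1?ltW// real_normK ?num_real//.
rewrite -(@ltr_pM2l _ (sg ^+ 2)) ?exprn_gt0// -[ltRHS]exprMn.
apply: le_lt_trans hq; rewrite -qq; apply: le_trans hp.
by apply: ler_wpM2l => //; exact: sqr_ge0.
Qed.

Variable C : W -> 'rV[R]_d -> 'rV[R]_d.

Section Trajectory.
Variables (x : 'rV[R]_d) (seed : nat -> 'I_M -> W).

Definition epoch_u j := (epoch_state s f C x theta seed j).1.
Definition epoch_err j := (epoch_state s f C x theta seed j).2.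
Definition epoch_ghat j m :=
  grad (f m) (epoch_u j) - grad (f s) (epoch_u j) - grad (f m) x + grad (f s) x.

Lemma epoch_u0 : epoch_u 0 = x. Proof. by []. Qed.
Lemma avg_epoch_err0 : avgv (epoch_err 0) = 0. Proof. exact: avgv_cst. Qed.

Lemma epoch_errS j m : epoch_err j.+1 m =
  epoch_err j m + theta *: epoch_ghat j m - C (seed j m) (epoch_err j m + theta *: epoch_ghat j m).
Proof. by rewrite /epoch_err /= -/(epoch_err j) addrAC. Qed.

Lemma epoch_uS j : epoch_u j.+1 = pr (epoch_u j - theta *:
  (theta^-1 *: avgv (fun m => C (seed j m) (epoch_err j m + theta *: epoch_ghat j m))
   - grad (f s) x + grad fa x)).
Proof.
by rewrite [LHS](prox_argmin (diff_f s) fs_convex theta0 sigma_gt0).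
Qed.

Lemma avg_epoch_ghat j : avgv (epoch_ghat j) =
  grad fa (epoch_u j) - grad (f s) (epoch_u j) - grad fa x + grad (f s) x.
Proof.
rewrite !grad_fa /epoch_ghat !avgvD !avgvN.
by rewrite !avgv_cst.
Qed.

(** Error feedback in one identity: [e_(j+1)] stores exactly the part of the message
    that compression lost, so it cancels in [u_(j+1) - e_(j+1)]. What is left of
    the proximal equation is a step along [grad f] with a lagged term in [h]. *)
Lemma traj_step j : epoch_u j.+1 - avgv (epoch_err j.+1) =
  epoch_u j - avgv (epoch_err j)
  - theta *: (grad fa (epoch_u j.+1) + grad h (epoch_u j.+1) - grad h (epoch_u j)).
Proof.
have uE := epoch_uS j; set g := avgv (fun m => C _ _) in uE.
have := prE (epoch_u j - theta *: (theta^-1 *: g - grad (f s) x + grad fa x)).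
rewrite -uE => pE.
have eE : avgv (epoch_err j.+1) = avgv (epoch_err j) + theta *: avgv (epoch_ghat j) - g.
  have -> : epoch_err j.+1 = (fun m => epoch_err j m + theta *: epoch_ghat j m
     + - C (seed j m) (epoch_err j m + theta *: epoch_ghat j m)).
    by apply/funext => m; exact: epoch_errS.
  by rewrite [LHS]avgvD avgvN [in LHS]avgvD avgvZ.
rewrite eE avg_epoch_ghat !grad_h.
clearbody g; move: (epoch_u j.+1) pE {uE eE} => u'.
move: (grad (f s) u') (grad fa u') (grad fa (epoch_u j)) (grad (f s) (epoch_u j))
  (grad fa x) (grad (f s) x) (avgv (epoch_err j)) (epoch_u j) => A B D E F G H I pE.
have -> : u' = I - theta *: (theta^-1 *: g - G + F) - theta *: A.
  by rewrite -pE addrK.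
by apply/rowP => i; rewrite !mxE; field; rewrite gt_eqF.
Qed.

Lemma epoch_ghat_le j m : dotv (epoch_ghat j m) (epoch_ghat j m) <=
  4 * delta ^+ 2 * dotv (epoch_u j - x) (epoch_u j - x).
Proof.
have h1 := related_lipschitz m (epoch_u j) x; have h2 := related_lipschitz s (epoch_u j) x.
have -> : epoch_ghat j m =
   (grad (f m) (epoch_u j) - grad fa (epoch_u j) - (grad (f m) x - grad fa x)) -
   (grad (f s) (epoch_u j) - grad fa (epoch_u j) - (grad (f s) x - grad fa x)).
  rewrite /epoch_ghat; move: (grad (f m) _) (grad (f s) _) (grad (f m) _) (grad (f s) _)
    (grad fa _) (grad fa _) => ? ? ? ? ? ?.
  by apply/rowP => i; rewrite !mxE; ring.
by apply: (le_trans (dotvB_le2 _ _)); lra.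
Qed.

End Trajectory.
End Epoch.

Section Measurability.
Context {R : realType} {d M : nat} {dW : measure_display} {W : measurableType dW}.
Variables (s : 'I_M) (f : 'I_M -> 'rV[R]_d -> R).
Variables (delta mu theta : R).
Hypothesis ftd : forall m, twice_differentiable (f m).
Hypothesis delta0 : 0 < delta.
Hypothesis frel : related delta f.
Hypothesis mu0 : 0 < mu.
Hypothesis fsc : strongly_convex mu (avgf f).
Hypothesis theta0 : 0 < theta.
Hypothesis theta_small : theta * delta < 1.
Variable C : W -> 'rV[R]_d -> 'rV[R]_d.
Hypothesis mC : measurable_fun setT (fun wx : W * borelV R d => C wx.1 wx.2 : borelV R d).

Context {dT : measure_display} {T : measurableType dT}.

Lemma measurable_gradf m (X : T -> borelV R d) : measurable_fun setT X ->
  measurable_fun setT (fun t => grad (f m) (X t) : borelV R d).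
Proof.
apply: measurable_comp_continuousV => z.
by apply: differentiable_continuous; exact: diff_grad.
Qed.

Lemma measurable_gradfa (X : T -> borelV R d) : measurable_fun setT X ->
  measurable_fun setT (fun t => grad (avgf f) (X t) : borelV R d).
Proof.
apply: measurable_comp_continuousV => z.
by apply: differentiable_continuous; exact: diff_grad_fa.
Qed.

Lemma measurable_C (S : T -> W) (X : T -> borelV R d) :
  measurable_fun setT S -> measurable_fun setT X ->
  measurable_fun setT (fun t => C (S t) (X t) : borelV R d).
Proof.
move=> mS mX; have mSX := measurable_fun_pair mS mX.
exact: (measurableT_comp mC mSX).
Qed.

Section OneEpoch.
Variables (X : T -> borelV R d) (S : nat -> 'I_M -> T -> W).
Hypothesis mX : measurable_fun setT X.

(** Stated over an arbitrary measurable space [T], because it is applied to the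
    sub-sigma-algebras generated by the inputs and to their products. *)
Lemma measurable_epoch j : (forall i m, (i < j)%N -> measurable_fun setT (S i m)) ->
  measurable_fun setT (fun t => epoch_u s f theta C (X t) (fun i m => S i m t) j : borelV R d) /\
  (forall m, measurable_fun setT
    (fun t => epoch_err s f theta C (X t) (fun i m => S i m t) j m : borelV R d)).
Proof.
elim: j => [_|j IH mS]; first by split=> // m; exact: measurable_cst.
have {IH}[|mu_ me_] := IH; first by move=> i m ij; apply: mS; rewrite ltnS ltnW.
have mg m : measurable_fun setT
    (fun t => epoch_ghat s f theta C (X t) (fun i m => S i m t) j m : borelV R d).
  by apply: measurable_addv; [apply: measurable_subv; [apply: measurable_subv|]|];
    exact: measurable_gradf.
have mXj m : measurable_fun setT
    (fun t => epoch_err s f theta C (X t) (fun i m => S i m t) j m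
     + theta *: epoch_ghat s f theta C (X t) (fun i m => S i m t) j m : borelV R d).
  by apply: measurable_addv => //; exact: measurable_scalev.
have mCj m : measurable_fun setT
    (fun t => C (S j m t) (epoch_err s f theta C (X t) (fun i m => S i m t) j m
     + theta *: epoch_ghat s f theta C (X t) (fun i m => S i m t) j m) : borelV R d).
  by apply: measurable_C => //; exact: mS.
split=> [|m]; last first.
  by under eq_fun do rewrite epoch_errS; exact: measurable_subv.
under eq_fun do rewrite (epoch_uS s ftd delta0 frel mu0 fsc theta0 theta_small).
apply: (measurable_comp_continuousV (g := prox (f s) theta)).
  exact: (continuous_prox ftd delta0 frel mu0 fsc theta0 theta_small).
apply: measurable_subv => //; apply: measurable_scalev; apply: measurable_addv.
  apply: measurable_subv; last exact: measurable_gradf.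
  by apply: measurable_scalev; exact: measurable_avgv.
exact: measurable_gradfa.
Qed.

End OneEpoch.

Lemma measurable_nat_dep d' (U : measurableType d') (N : T -> nat) (F : nat -> T -> U) :
  measurable_fun setT N -> (forall n, measurable_fun setT (F n)) ->
  measurable_fun setT (fun t => F (N t) t).
Proof.
move=> mN mF _ B mB; rewrite setTI.
have -> : (fun t => F (N t) t) @^-1` B = \bigcup_n (N @^-1` [set n] `&` F n @^-1` B).
  apply/seteqP; split=> [t /= Bt|t [n _ [/= <-]]//].
  by exists (N t).
apply: bigcupT_measurable => n; apply: measurableI.
  by rewrite -[X in measurable X]setTI; exact: mN.
by rewrite -[X in measurable X]setTI; exact: mF.
Qed.

End Measurability.

(** * Second moments along an epoch *)

Section RealExpectation.
Context {dO : measure_display} {Omega : measurableType dO} {R : realType}.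
Variable P : probability Omega R.
Implicit Types g : Omega -> R.

(** Real-valued expectations [Ex] of integrable functions, so that the inequalities
    of this part can be handled by linear arithmetic. *)
Definition L1 g := P.-integrable setT (EFin \o g).
Definition Ex g : R := Rintegral P setT g.

Lemma EFin_Ex g : L1 g -> (Ex g)%:E = (\int[P]_w (g w)%:E)%E.
Proof. by move=> ig; rewrite fineK//; exact: integrable_fin_num. Qed.

Lemma L1_cst r : L1 (cst r).
Proof. exact: finite_measure_integrable_cst. Qed.

Lemma Ex_cst r : Ex (fun=> r) = r.
Proof. by rewrite /Ex Rintegral_cst//= probability_setT mulr1. Qed.

Lemma L1_add g1 g2 : L1 g1 -> L1 g2 -> L1 (fun w => g1 w + g2 w).
Proof. by move=> i1 i2; exact: (integrableD measurableT i1 i2). Qed.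

Lemma L1_scale a g : L1 g -> L1 (fun w => a * g w).
Proof. by move=> ig; exact: (integrableZl measurableT a ig). Qed.

Lemma Ex_add g1 g2 : L1 g1 -> L1 g2 -> Ex (fun w => g1 w + g2 w) = Ex g1 + Ex g2.
Proof. by move=> i1 i2; exact: RintegralD. Qed.

Lemma Ex_scale a g : L1 g -> Ex (fun w => a * g w) = a * Ex g.
Proof. by move=> ig; exact: RintegralZl. Qed.

Lemma L1_sum (I : Type) (r : seq I) (F : I -> Omega -> R) :
  (forall i, L1 (F i)) -> L1 (fun w => \sum_(i <- r) F i w).
Proof.
move=> iF; elim: r => [|i r IH].
  by under eq_fun do rewrite big_nil; exact: L1_cst.
by under eq_fun do rewrite big_cons; exact: L1_add.
Qed.

Lemma Ex_sum (I : Type) (r : seq I) (F : I -> Omega -> R) :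
  (forall i, L1 (F i)) -> Ex (fun w => \sum_(i <- r) F i w) = \sum_(i <- r) Ex (F i).
Proof.
move=> iF; elim: r => [|i r IH].
  by under eq_fun do rewrite big_nil; rewrite Ex_cst big_nil.
under eq_fun do rewrite big_cons.
by rewrite Ex_add ?IH ?big_cons//; exact: L1_sum.
Qed.

Lemma Ex_le g1 g2 : L1 g1 -> L1 g2 -> (forall w, g1 w <= g2 w) -> Ex g1 <= Ex g2.
Proof. by move=> i1 i2 le12; exact: le_Rintegral. Qed.

Lemma Ex_ge0 g : (forall w, 0 <= g w) -> 0 <= Ex g.
Proof. by move=> g0; exact: Rintegral_ge0. Qed.

Lemma L1_le g1 g2 : measurable_fun setT g1 -> (forall w, 0 <= g1 w <= g2 w) ->
  L1 g2 -> L1 g1.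
Proof.
move=> m1 le12; apply: le_integrable => //; first exact/measurable_EFinP.
move=> w _ /=; have /andP[g0 g12] := le12 w.
by rewrite lee_fin !ger0_norm// (le_trans g0).
Qed.

Lemma L1_lt_pinfty g : measurable_fun setT g -> (forall w, 0 <= g w) ->
  (\int[P]_w (g w)%:E < +oo)%E -> L1 g.
Proof.
move=> mg g0 goo; apply/integrableP; split; first exact/measurable_EFinP.
by under eq_integral do rewrite /= ger0_norm//.
Qed.

End RealExpectation.

Section ErrorSum.
Context {R : realType}.
Variable p : R.
Hypothesis p01 : 0 < p < 1.

(** A Hardy inequality with geometric weights, in the form of a recursion. The
    growth factor [1 + p / 2] beats the decay [1 - p] of the weights, so [v] is
    bounded in weighted sum by [4 / p^2] times its source. The size of the
    source, [p^3 / 144] times [r], is dictated by [theta delta = p^(3/2) / 24];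
    the product is of order [p], which is what [path_sum] can absorb. *)
Lemma error_sum (v A r : nat -> R) T :
  (forall j, 0 <= v j) -> (forall j, 0 <= r j) ->
  v 0%N = 0 -> r 0%N = 0 ->
  (forall j, v j.+1 <= (1 + p / 2) * v j + (1 + 2 / p) * (p ^+ 3 / 144 * r j)) ->
  (forall j, r j <= 2 * A j + 2 * v j) ->
  \sum_(j < T) geom p j * v j.+1 <= p / 17 * \sum_(j < T) geom p j * A j.+1.
Proof.
move=> v0 r0 v00 r00 vS rA.
have /andP[p0 p1] := p01.
have sv := geom_shift p01 T v0 v00.
have sr := geom_shift p01 T r0 r00.
set V := \sum_(j < T) geom p j * v j.+1 in sv *.
set Rs := \sum_(j < T) geom p j * r j.+1 in sr *.
set As := \sum_(j < T) geom p j * A j.+1.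
have V0 : 0 <= V by apply: sumr_ge0 => j _; rewrite mulr_ge0// geom_ge0.
have Rs0 : 0 <= Rs by apply: sumr_ge0 => j _; rewrite mulr_ge0// geom_ge0.
have RA : Rs <= 2 * As + 2 * V.
  rewrite /Rs /As /V !mulr_sumr -big_split/=; apply: ler_sum => j _.
  apply: (le_trans (ler_wpM2l (geom_ge0 p01 j) (rA j.+1))).
  by rewrite le_eqVlt; apply/orP; left; apply/eqP; ring.
set v' := \sum_(j < T) geom p j * v j in sv.
set r' := \sum_(j < T) geom p j * r j in sr.
have h : V <= (1 + p / 2) * v' + (1 + 2 / p) * (p ^+ 3 / 144) * r'.
  rewrite /V /v' /r' !mulr_sumr -big_split/=; apply: ler_sum => j _.
  apply: (le_trans (ler_wpM2l (geom_ge0 p01 j) (vS j))).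
  by rewrite le_eqVlt; apply/orP; left; apply/eqP; ring.
have c1 : (1 + p / 2) * v' <= (1 + p / 2) * ((1 - p) * V) by apply: ler_wpM2l => //; lra.
have c20 : 0 <= (1 + 2 / p) * (p ^+ 3 / 144).
  by rewrite mulr_ge0 ?addr_ge0 ?divr_ge0 ?exprn_ge0// ltW.
have c2 := ler_wpM2l c20 sr.
have e2 : (1 + 2 / p) * (p ^+ 3 / 144) * ((1 - p) * Rs) =
    p ^+ 2 * ((p + 2) * (1 - p)) / 144 * Rs by field; rewrite gt_eqF.
rewrite e2 in c2.
have c3 : p ^+ 2 * ((p + 2) * (1 - p)) / 144 * Rs <= p ^+ 2 * 2 / 144 * Rs.
  apply: ler_wpM2r => //; apply: ler_wpM2r; first by rewrite invr_ge0.
  by apply: ler_wpM2l; [exact: sqr_ge0|nra].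
have c4 : p * (p * V) >= 0 by rewrite !mulr_ge0// ltW.
have key : p * (V / 2) <= p * (p / 72 * Rs) by lra.
rewrite ler_pM2l// in key.
have key2 : p / 72 * Rs <= p / 72 * (2 * As + 2 * V).
  by apply: ler_wpM2l => //; rewrite divr_ge0// ltW.
have pV : p * V <= V by rewrite -[leRHS]mul1r ler_wpM2r// ltW.
lra.
Qed.

End ErrorSum.

Section EpochExpectation.
Context {R : realType} {d M : nat}.
Variables (s : 'I_M) (f : 'I_M -> 'rV[R]_d -> R) (delta mu : R).
Context {dW : measure_display} {W : measurableType dW}.
Variables (Q : probability W R) (C : W -> 'rV[R]_d -> 'rV[R]_d) (beta p theta : R).
Context {dO : measure_display} {Omega : measurableType dO}.
Variables (P : probability Omega R) (N : nat -> {RV P >-> nat}).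
Variable seed : nat -> nat -> 'I_M -> {RV P >-> W}.
Hypothesis ftd : forall m, twice_differentiable (f m).
Hypothesis delta0 : 0 < delta.
Hypothesis frel : related delta f.
Hypothesis mu0 : 0 < mu.
Hypothesis fsc : strongly_convex mu (avgf f).
Hypothesis beta1 : 1 < beta.
Hypothesis HC : biased_compressor Q C beta.
Hypothesis p01 : 0 < p < 1.
Hypothesis theta0 : 0 < theta.
Hypothesis theta_delta : (theta * delta) ^+ 2 = p ^+ 3 / 576.
Hypothesis rnd : EF_OLGA_randomness Q p N seed.

Lemma theta_small : theta * delta < 1.
Proof.
have /andP[p0 p1] := p01.
rewrite -(@ltr_pXn2r _ 2)// ?nnegrE ?mulr_ge0 ?(ltW theta0) ?(ltW delta0)//.
rewrite theta_delta expr1n.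
have : p ^+ 3 <= 1 by apply: exprn_ile1; lra.
lra.
Qed.

Let mC : measurable_fun setT (fun wx : W * borelV R d => C wx.1 wx.2 : borelV R d).
Proof. by case: HC. Qed.

Definition input_index : eqType := (nat + nat * nat * 'I_M)%type.

Definition inputs (i : input_index) : set (set Omega) :=
  match i with
  | inl k => sigma_of (N k)
  | inr (k, j, m) => sigma_of (seed k j m)
  end.

Lemma sigma_of_setI d' (T' : measurableType d') (X : Omega -> T') :
  setI_closed (sigma_of X).
Proof.
move=> _ _ [A mA <-] [B mB <-]; exists (A `&` B); first exact: measurableI.
by rewrite !setTI preimage_setI.
Qed.

Lemma inputs_setI i : setI_closed (inputs i).
Proof. by case: i => [k|[[k j] m]]; exact: sigma_of_setI. Qed.

Lemma inputs_setT i : inputs i setT.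
Proof. by case: i => [k|[[k j] m]]; exists setT => //; rewrite setTI preimage_setT. Qed.

Lemma inputs_measurable i : inputs i `<=` measurable.
Proof.
case: i => [k|[[k j] m]] A [B mB <-]; rewrite setTI.
  by rewrite -[X in measurable X]setTI; exact: (measurable_funPT (N k)).
by rewrite -[X in measurable X]setTI; exact: (measurable_funPT (seed k j m)).
Qed.

Lemma inputs_indep : mutually_independent P inputs.
Proof. by case: rnd. Qed.

Local Notation subT J := (sub_sigmaType inputs J).

Lemma measurable_inputN (J : set input_index) k : J (inl k) ->
  measurable_fun setT (N k : subT J -> nat).
Proof.
by move=> Jk _ B mB; apply: sub_sigma_algebra; exists (inl k) => //; exists B.
Qed.

Lemma measurable_input_seed (J : set input_index) k j m : J (inr (k, j, m)) ->
  measurable_fun setT (seed k j m : subT J -> W).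
Proof.
by move=> Jk _ B mB; apply: sub_sigma_algebra; exists (inr (k, j, m)) => //; exists B.
Qed.

Lemma measurable_sub d' (T' : measurableType d') (J : set input_index) (X : Omega -> T') :
  measurable_fun setT (X : subT J -> T') -> measurable_fun setT X.
Proof.
move=> mX; have mid := @measurable_family_id _ _ _ inputs inputs_measurable J.
exact: (measurableT_comp mX mid).
Qed.

Definition seeds_before (k j : nat) : set input_index :=
  [set i | if i is inr (k', j', _) then (k' == k) && (j' < j)%N else false].

(** Compression does not increase second moments. The seed is independent of the
    compressed vector [X], so the expectation is taken over the seed first, with
    [X] frozen. *)
Lemma compress_le (J : set input_index) k j m (X : Omega -> 'rV[R]_d) :
  ~ J (inr (k, j, m)) -> measurable_fun setT (X : subT J -> borelV R d) ->
  (\int[P]_w (dotv (X w - C (seed k j m w) (X w)) (X w - C (seed k j m w) (X w)))%:E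
   <= \int[P]_w (dotv (X w) (X w))%:E)%E.
Proof.
move=> nJ mX.
pose J2 : set input_index := [set inr (k, j, m)].
pose phi (ww : subT J * subT J2) := (dotv (X ww.1 - C (seed k j m ww.2) (X ww.1))
  (X ww.1 - C (seed k j m ww.2) (X ww.1)))%:E.
have mX1 : measurable_fun setT (fun ww : subT J * subT J2 => X ww.1 : borelV R d).
  exact: (measurableT_comp mX measurable_fst).
have mS2 : measurable_fun setT (fun ww : subT J * subT J2 => seed k j m ww.2 : W).
  have mS : measurable_fun setT (seed k j m : subT J2 -> W).
    exact: measurable_input_seed.
  exact: (measurableT_comp mS measurable_snd).
have mCX := measurable_C mC mS2 mX1.
apply: (@family_integral_le _ _ _ P _ inputs inputs_setI inputs_setT inputs_measurable
  inputs_indep J J2 phi).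
- by apply/seteqP; split=> // i [Ji /= iE]; apply: nJ; rewrite -iE.
- apply/measurable_EFinP; apply: measurable_dotv; exact: measurable_subv.
- by move=> ww; rewrite lee_fin dotv_ge0.
- apply/measurable_EFinP; have mX' := measurable_sub mX.
  exact: (measurable_dotv mX' mX').
move=> w1; rewrite /phi /=; set v := X w1.
pose psi (wq : W) := (dotv (v - C wq v) (v - C wq v))%:E.
have mpsi : measurable_fun setT psi.
  apply/measurable_EFinP.
  have mv : measurable_fun setT (fun _ : W => v : borelV R d) by exact: measurable_cst.
  have mid : measurable_fun setT (id : W -> W) by exact: measurable_id.
  have mCv := measurable_C mC mid mv.
  by apply: measurable_dotv; exact: measurable_subv.
have psi0 wq : (0 <= psi wq)%E by rewrite lee_fin dotv_ge0.
rewrite -[leLHS](@ge0_integral_distribution _ _ _ _ _ P (seed k j m) psi)//.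
have [_ seedQ _] := rnd.
rewrite (eq_measure_integral Q) => [|A mA _]; last exact: seedQ.
have [_ /(_ v)] := HC; rewrite unlock.
have -> : (\int[Q]_w (norm2 (C w v - v) ^+ 2)%:E = \int[Q]_w psi w)%E.
  apply: eq_integral => w _; rewrite /psi norm2_sqr.
  by rewrite -(opprB v) dotvNl dotvNr opprK.
move=> /le_trans; apply; rewrite lee_fin norm2_sqr -[leRHS]mul1r.
by rewrite ler_wpM2r ?dotv_ge0// gerBl invr_ge0; have := beta1; lra.
Qed.

Section FixedStart.
Variables (k : nat) (x : 'rV[R]_d).

Local Notation u_ := (fun j w => epoch_u s f theta C x (fun i m => seed k i m w) j).
Local Notation eps_ := (fun j m w => epoch_err s f theta C x (fun i m => seed k i m w) j m).
Local Notation e_ := (fun j w => avgv (fun m => eps_ j m w)).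
Local Notation gh_ := (fun j m w => epoch_ghat s f theta C x (fun i m => seed k i m w) j m).
Local Notation fa := (avgf f).
Local Notation h := (fun v => f s v - avgf f v).

Definition sq_virtual j w := dotv (u_ j w - e_ j w - x) (u_ j w - e_ j w - x).
Definition sq_err j w := dotv (e_ j w) (e_ j w).
Definition sq_disp j w := dotv (u_ j w - x) (u_ j w - x).
Definition sq_node_err j m w := dotv (eps_ j m w) (eps_ j m w).

Lemma measurable_traj (J : set input_index) j : (forall i, seeds_before k j i -> J i) ->
  measurable_fun setT (u_ j : subT J -> borelV R d) /\
  (forall m, measurable_fun setT (eps_ j m : subT J -> borelV R d)).
Proof.
move=> JJ.
apply: (@measurable_epoch _ _ _ _ _ s f delta mu theta ftd delta0 frel mu0 fsc theta0
  theta_small C mC _ (subT J) (fun=> x) (fun i m => seed k i m)).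
  exact: measurable_cst.
move=> i m ij; apply: measurable_input_seed; apply: JJ.
by rewrite /seeds_before/= eqxx ij.
Qed.

Lemma measurable_trajO j :
  measurable_fun setT (u_ j : Omega -> borelV R d) /\
  (forall m, measurable_fun setT (eps_ j m : Omega -> borelV R d)).
Proof.
have [mu_ me_] := @measurable_traj (seeds_before k j) j (fun i h => h).
by split=> [|m]; exact: (measurable_sub (J := seeds_before k j)).
Qed.

Lemma measurable_gh (J : set input_index) j m : (forall i, seeds_before k j i -> J i) ->
  measurable_fun setT (gh_ j m : subT J -> borelV R d).
Proof.
move=> JJ; have [mu_ _] := measurable_traj JJ.
have mx : measurable_fun setT (fun _ : subT J => x : borelV R d) by exact: measurable_cst.
apply: measurable_addv; last exact: (measurable_gradf ftd).
apply: measurable_subv; last exact: (measurable_gradf ftd).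
by apply: measurable_subv; exact: (measurable_gradf ftd).
Qed.

Lemma measurable_sq_virtual j : measurable_fun setT (sq_virtual j).
Proof.
have [mu_ me_] := measurable_trajO j.
have ma : measurable_fun setT ((fun w => u_ j w - e_ j w - x) : Omega -> borelV R d).
  apply: measurable_subv; last exact: measurable_cst.
  by apply: measurable_subv => //; exact: measurable_avgv.
exact: measurable_dotv.
Qed.

Lemma measurable_sq_err j : measurable_fun setT (sq_err j).
Proof.
have [mu_ me_] := measurable_trajO j.
by have me := measurable_avgv me_; exact: (measurable_dotv me me).
Qed.

Lemma measurable_sq_node_err j m : measurable_fun setT (sq_node_err j m).
Proof. by have [mu_ me_] := measurable_trajO j; exact: (measurable_dotv (me_ m) (me_ m)). Qed.

Lemma measurable_sq_disp j : measurable_fun setT (sq_disp j).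
Proof.
have [mu_ me_] := measurable_trajO j.
have md : measurable_fun setT ((fun w => u_ j w - x) : Omega -> borelV R d).
  by apply: measurable_subv => //; exact: measurable_cst.
exact: (measurable_dotv md md).
Qed.

Lemma sq_err_le j w : sq_err j w <= M%:R^-1 * \sum_m sq_node_err j m w.
Proof. exact: dotv_avg. Qed.

Lemma sq_disp_le j w : sq_disp j w <= 2 * sq_virtual j w + 2 * sq_err j w.
Proof.
rewrite /sq_disp; have -> : u_ j w - x = (u_ j w - e_ j w - x) + e_ j w.
  by rewrite addrAC subrK.
exact: dotvD_le2.
Qed.

Lemma sq_node_err_young j m w :
  dotv (eps_ j m w + theta *: gh_ j m w) (eps_ j m w + theta *: gh_ j m w) <=
  (1 + p / 2) * sq_node_err j m w + (1 + 2 / p) * (p ^+ 3 / 144 * sq_disp j w).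
Proof.
have /andP[p0 p1] := p01.
have gl := epoch_ghat_le s theta ftd delta0 frel C x (fun i m => seed k i m w) j m.
rewrite -/(gh_ j m w) -/(sq_disp j w) in gl.
have -> : p ^+ 3 / 144 = theta ^+ 2 * (4 * delta ^+ 2).
  by have := theta_delta; rewrite exprMn; lra.
rewrite /sq_node_err; move: (eps_ j m w) (gh_ j m w) gl => a g gl.
have p20 : 0 < p / 2 by rewrite divr_gt0.
have yg := dotv_young a (theta *: g) p20.
have c0 : 0 <= (1 + 2 / p) * theta ^+ 2.
  by rewrite mulr_ge0 ?sqr_ge0// addr_ge0// divr_ge0// ltW.
have gl' := ler_wpM2l c0 gl.
have e : dotv (theta *: g) (theta *: g) = theta ^+ 2 * dotv g g.
  by rewrite dotvZl dotvZr expr2 mulrA.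
have -> : dotv (a + theta *: g) (a + theta *: g) =
    dotv a a + 2 * dotv a (theta *: g) + theta ^+ 2 * dotv g g.
  by rewrite -e !dotvDl !dotvDr (dotvC (theta *: g) a); ring.
rewrite invf_div e in yg.
have e2 : 2 / p / 2 = p^-1 by field; rewrite gt_eqF.
by rewrite e2 in yg; lra.
Qed.

Variables (fmin : R).
Hypothesis fminP : forall v, fmin <= fa v.

Lemma traj_ustep w j : u_ j.+1 w - e_ j.+1 w =
  u_ j w - e_ j w - theta *: (grad fa (u_ j.+1 w) + grad h (u_ j.+1 w) - grad h (u_ j w)).
Proof. exact: (traj_step s ftd delta0 frel mu0 fsc theta0 theta_small). Qed.

Lemma traj_e0 w : e_ 0%N w = 0.
Proof. exact: avg_epoch_err0. Qed.

(** Convexity turns [path_step] into a bound of the next virtual iterate by its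
    predecessor and the errors; it propagates integrability along the epoch. *)
Lemma sq_virtual_step j w : sq_virtual j.+1 w <=
  2 * sq_virtual j w + 4 * sq_err j.+1 w + sq_err j w + 3 * (theta * (fa x - fmin)).
Proof.
have /andP[p0 p1] := p01.
have st := path_step (h_lipschitz s ftd delta0 frel) p01 theta_delta x (traj_ustep w) j.
rewrite /= -/(sq_virtual j w) -/(sq_virtual j.+1 w) -/(sq_err j w) -/(sq_err j.+1 w) in st.
have cv := fsc x (u_ j.+1 w); have fm := fminP (u_ j.+1 w).
have n0 : 0 <= mu / 2 * norm2 (x - u_ j.+1 w) ^+ 2.
  by rewrite mulr_ge0 ?sqr_ge0// divr_ge0// ltW.
rewrite -[x - u_ _ _]opprB dotvNr in cv n0.
have lo : theta * (fmin - fa x) <=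
    theta * dotv (grad (avgf f) (u_ j.+1 w)) (u_ j.+1 w - x).
  by apply: ler_wpM2l; [exact: ltW|lra].
have a0 : 0 <= sq_virtual j w := dotv_ge0 _.
have a1 : 0 <= sq_virtual j.+1 w := dotv_ge0 _.
have b0 : 0 <= sq_err j w := dotv_ge0 _.
have b1 : 0 <= sq_err j.+1 w := dotv_ge0 _.
have pa : p / 8 * sq_virtual j.+1 w <= 8^-1 * sq_virtual j.+1 w by apply: ler_wpM2r => //; lra.
have c0 : 0 <= theta * (fa x - fmin) by rewrite mulr_ge0 ?subr_ge0// ltW.
lra.
Qed.

Lemma sq_node_errS j m w : sq_node_err j.+1 m w =
  let X := eps_ j m w + theta *: gh_ j m w in
  dotv (X - C (seed k j m w) X) (X - C (seed k j m w) X).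
Proof. by rewrite /sq_node_err epoch_errS. Qed.

Lemma L1_sq_node_err_bound j m : L1 P (sq_node_err j m) -> L1 P (sq_disp j) ->
  L1 P (fun w => (1 + p / 2) * sq_node_err j m w + (1 + 2 / p) * (p ^+ 3 / 144 * sq_disp j w)).
Proof.
by move=> i1 i2; apply: L1_add; apply: L1_scale => //; exact: L1_scale.
Qed.

Lemma int_sq_node_errS j m :
  (\int[P]_w (sq_node_err j.+1 m w)%:E <=
   \int[P]_w ((1 + p / 2) * sq_node_err j m w
              + (1 + 2 / p) * (p ^+ 3 / 144 * sq_disp j w))%:E)%E.
Proof.
have [_ me_] := @measurable_traj (seeds_before k j) j (fun i h => h).
have mg := @measurable_gh (seeds_before k j) j m (fun i h => h).
pose X w := eps_ j m w + theta *: gh_ j m w.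
have mX : measurable_fun setT (X : subT (seeds_before k j) -> borelV R d).
  by apply: measurable_addv => //; exact: measurable_scalev.
have nJ : ~ seeds_before k j (inr (k, j, m)) by rewrite /seeds_before/= eqxx ltnn.
have mXO := measurable_sub mX.
apply: le_trans (le_trans (compress_le nJ mX) _).
  by under eq_integral do rewrite sq_node_errS.
apply: ge0_le_integral => //.
- by move=> w _; rewrite lee_fin dotv_ge0.
- by apply/measurable_EFinP; exact: (measurable_dotv mXO mXO).
- apply/measurable_EFinP; apply: measurable_funD; apply: measurable_funM => //.
    exact: measurable_sq_node_err.
  by apply: measurable_funM => //; exact: measurable_sq_disp.
- by move=> w _; rewrite lee_fin; exact: sq_node_err_young.
Qed.

Lemma L1_sq_err_node j : (forall m, L1 P (sq_node_err j m)) -> L1 P (sq_err j).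
Proof.
move=> ie; apply: (L1_le (g2 := fun w => M%:R^-1 * \sum_m sq_node_err j m w)).
- exact: measurable_sq_err.
- by move=> w; rewrite dotv_ge0 sq_err_le.
- by apply: L1_scale; exact: L1_sum.
Qed.

Lemma L1_sq_disp_err j : L1 P (sq_virtual j) -> L1 P (sq_err j) -> L1 P (sq_disp j).
Proof.
move=> ia ib; apply: (L1_le (g2 := fun w => 2 * sq_virtual j w + 2 * sq_err j w)).
- exact: measurable_sq_disp.
- by move=> w; rewrite dotv_ge0 sq_disp_le.
- by apply: L1_add; exact: L1_scale.
Qed.

Lemma traj_L1 j : L1 P (sq_virtual j) /\ forall m, L1 P (sq_node_err j m).
Proof.
elim: j => [|j [ia ie]].
  split=> [|m].
    suff -> : sq_virtual 0 = cst 0 by exact: L1_cst.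
    by apply/funext => w; rewrite /sq_virtual traj_e0 subr0 epoch_u0 subrr dot0v.
  suff -> : sq_node_err 0 m = cst 0 by exact: L1_cst.
  by apply/funext => w; rewrite /sq_node_err dot0v.
have id := L1_sq_disp_err ia (L1_sq_err_node ie).
have ie' m : L1 P (sq_node_err j.+1 m).
  apply: L1_lt_pinfty; first exact: measurable_sq_node_err.
    by move=> w; exact: dotv_ge0.
  apply: le_lt_trans (int_sq_node_errS j m) _.
  by rewrite -(EFin_Ex (L1_sq_node_err_bound (ie m) id)) ltry.
split=> //.
apply: (L1_le (g2 := fun w => 2 * sq_virtual j w + 4 * sq_err j.+1 w + sq_err j w
    + 3 * (theta * (fa x - fmin)))).
- exact: measurable_sq_virtual.
- by move=> w; rewrite dotv_ge0 sq_virtual_step.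
- apply: L1_add; last exact: L1_cst.
  apply: L1_add; last exact: L1_sq_err_node.
  by apply: L1_add; apply: L1_scale => //; exact: L1_sq_err_node.
Qed.

Lemma L1_sq_virtual j : L1 P (sq_virtual j). Proof. by case: (traj_L1 j). Qed.
Lemma L1_sq_node_err j m : L1 P (sq_node_err j m). Proof. by case: (traj_L1 j). Qed.
Lemma L1_sq_err j : L1 P (sq_err j). Proof. by apply: L1_sq_err_node => m; exact: L1_sq_node_err. Qed.
Lemma L1_sq_disp j : L1 P (sq_disp j).
Proof. by apply: L1_sq_disp_err; [exact: L1_sq_virtual|exact: L1_sq_err]. Qed.

Lemma Ex_sq_node_errS j m : Ex P (sq_node_err j.+1 m) <=
  (1 + p / 2) * Ex P (sq_node_err j m) + (1 + 2 / p) * (p ^+ 3 / 144 * Ex P (sq_disp j)).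
Proof.
have := int_sq_node_errS j m.
rewrite -(EFin_Ex (L1_sq_node_err j.+1 m)).
rewrite -(EFin_Ex (L1_sq_node_err_bound (L1_sq_node_err j m) (L1_sq_disp j))) lee_fin.
rewrite Ex_add ?Ex_scale//; try exact: L1_sq_disp; try exact: L1_sq_node_err.
- by apply: L1_scale; exact: L1_sq_disp.
- by apply: L1_scale; exact: L1_sq_node_err.
- by apply: L1_scale; apply: L1_scale; exact: L1_sq_disp.
Qed.

Lemma Ex_sq_err_le j : Ex P (sq_err j) <= M%:R^-1 * \sum_m Ex P (sq_node_err j m).
Proof.
rewrite -Ex_sum; last by move=> m; exact: L1_sq_node_err.
have iS : L1 P (fun w => \sum_m sq_node_err j m w) by apply: L1_sum => m; exact: L1_sq_node_err.
rewrite -Ex_scale//; apply: Ex_le; [exact: L1_sq_err|exact: L1_scale|].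
by move=> w; exact: sq_err_le.
Qed.

Lemma Ex_error_sum T :
  \sum_(j < T) geom p j * Ex P (sq_err j.+1) <=
  p / 17 * \sum_(j < T) geom p j * Ex P (sq_virtual j.+1).
Proof.
pose v j := M%:R^-1 * \sum_m Ex P (sq_node_err j m).
have M0 : (0 : R) < M%:R := M_gt0 s.
have /andP[p0 p1] := p01.
apply: (@le_trans _ _ (\sum_(j < T) geom p j * v j.+1)).
  by apply: ler_sum => j _; apply: ler_wpM2l; [exact: geom_ge0|exact: Ex_sq_err_le].
apply: (@error_sum _ p p01 v (fun j => Ex P (sq_virtual j)) (fun j => Ex P (sq_disp j))).
- move=> j; rewrite mulr_ge0 ?invr_ge0 ?(ltW M0)//.
  by apply: sumr_ge0 => m _; apply: Ex_ge0 => w; exact: dotv_ge0.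
- by move=> j; apply: Ex_ge0 => w; exact: dotv_ge0.
- rewrite /v big1 ?mulr0// => m _.
  have -> : sq_node_err 0 m = (fun=> 0) by apply/funext => w; rewrite /sq_node_err dot0v.
  exact: Ex_cst.
- have -> : sq_disp 0 = (fun=> 0).
    by apply/funext => w; rewrite /sq_disp epoch_u0 subrr dot0v.
  exact: Ex_cst.
- move=> j; rewrite /v.
  have -> : (1 + p / 2) * (M%:R^-1 * \sum_m Ex P (sq_node_err j m)) +
     (1 + 2 / p) * (p ^+ 3 / 144 * Ex P (sq_disp j)) =
     M%:R^-1 * \sum_m ((1 + p / 2) * Ex P (sq_node_err j m)
                       + (1 + 2 / p) * (p ^+ 3 / 144 * Ex P (sq_disp j))).
    rewrite big_split/= -mulr_sumr sumr_const card_ord -[_ *+ M]mulr_natl.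
    by field; rewrite !gt_eqF.
  apply: ler_wpM2l; first by rewrite invr_ge0 ltW.
  by apply: ler_sum => m _; exact: Ex_sq_node_errS.
- move=> j; apply: (@le_trans _ _ (2 * Ex P (sq_virtual j) + 2 * Ex P (sq_err j))).
    rewrite -!Ex_scale; [|exact: L1_sq_err|exact: L1_sq_virtual].
    rewrite -Ex_add; [|by apply: L1_scale; exact: L1_sq_virtual|by apply: L1_scale; exact: L1_sq_err].
    apply: Ex_le; first exact: L1_sq_disp.
      by apply: L1_add; apply: L1_scale; [exact: L1_sq_virtual|exact: L1_sq_err].
    by move=> w; exact: sq_disp_le.
  by rewrite lerD2l; apply: ler_wpM2l => //; exact: Ex_sq_err_le.
Qed.

Lemma Ex_wsum (g : nat -> Omega -> R) T : (forall j, L1 P (g j)) ->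
  L1 P (fun w => \sum_(j < T) geom p j * g j.+1 w) /\
  Ex P (fun w => \sum_(j < T) geom p j * g j.+1 w) =
  \sum_(j < T) geom p j * Ex P (g j.+1).
Proof.
move=> ig; split; first by apply: L1_sum => j; exact: L1_scale.
rewrite Ex_sum; last by move=> j; exact: L1_scale.
by apply: eq_bigr => j _; exact: Ex_scale.
Qed.

(** The expectation of [path_bound], in which the errors are absorbed. The bound does
    not depend on [T], so the general term of the sum tends to zero. *)
Lemma Ex_sq_virtual_bound T :
  p * (\sum_(j < T) geom p j * Ex P (sq_virtual j.+1)) <= 4 * (theta * (fa x - fmin)).
Proof.
have /andP[p0 p1] := p01.
have [La <-] := Ex_wsum T L1_sq_virtual; have [Lb Eb] := Ex_wsum T L1_sq_err.
have err := Ex_error_sum T; rewrite -Eb in err.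
have [_ Ea] := Ex_wsum T L1_sq_virtual; rewrite -Ea in err.
have c0 : 0 <= theta * (fa x - fmin) by rewrite mulr_ge0 ?subr_ge0// ltW.
have : Ex P (fun w => 3 / 8 * p * \sum_(j < T) geom p j * sq_virtual j.+1 w) <=
    Ex P (fun w => 5 / 4 * (\sum_(j < T) geom p j * sq_err j.+1 w)
                   + theta * (fa x - fmin)).
  apply: Ex_le; first exact: L1_scale.
    by apply: L1_add; [exact: L1_scale|exact: L1_cst].
  move=> w; exact: (path_bound mu0 fsc (h_lipschitz s ftd delta0 frel) p01 theta0
    theta_delta (u := fun j => u_ j w) (e := fun j => e_ j w) erefl (traj_e0 w)
    (traj_ustep w) fminP T).
rewrite Ex_scale// Ex_add ?Ex_cst//; [|exact: L1_scale|exact: L1_cst].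
rewrite Ex_scale//.
have A0 : 0 <= Ex P (fun w => \sum_(j < T) geom p j * sq_virtual j.+1 w).
  apply: Ex_ge0 => w; apply: sumr_ge0 => j _.
  by rewrite mulr_ge0 ?geom_ge0 ?dotv_ge0.
have pA := mulr_ge0 (ltW p0) A0.
lra.
Qed.

End FixedStart.
End EpochExpectation.

(** * Averaging over the geometric epoch length *)

Section GeometricLaw.
Context {R : realType} {dO : measure_display} {Omega : measurableType dO}.
Variables (P : probability Omega R) (p : R) (X : {RV P >-> nat}).
Hypothesis p01 : 0 < p < 1.
Hypothesis geoX : geometric_law p X.

Let mX n : measurable (X @^-1` [set n]).
Proof. by rewrite -[Y in measurable Y]setTI; exact: measurable_funPT. Qed.

(** Partition [Omega] according to the value of [X]. *)
Lemma integral_nat_law (psi : nat -> \bar R) : (forall n, 0 <= psi n)%E ->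
  (\int[P]_w psi (X w) = \sum_(0 <= n <oo) psi n * P (X @^-1` [set n]))%E.
Proof.
move=> psi0.
have mpsi : measurable_fun setT (fun w => psi (X w)).
  have mp : measurable_fun setT psi by [].
  by apply: (measurableT_comp mp); exact: measurable_funPT.
have UT : \bigcup_n (X @^-1` [set n]) = setT.
  by apply/seteqP; split=> // w _; exists (X w).
rewrite -[in LHS]UT ge0_integral_bigcup//; first last.
- apply/trivIsetP => i j _ _ ij; apply/seteqP; split=> // w /= [Xi Xj].
  by move: ij; rewrite -Xi -Xj eqxx.
- by rewrite UT.
apply: eq_eseriesr => n _.
rewrite -integral_cst//; apply: eq_integral => w.
by rewrite inE /= => ->.
Qed.

Lemma geom_law_geom n : P (X @^-1` [set n.+1]) = (geom p n)%:E.
Proof. by rewrite geoX. Qed.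

(** The law is prescribed on positive lengths only; there it already has total
    mass 1. *)
Lemma geom_law0 : P (X @^-1` [set 0%N]) = 0%E.
Proof.
have /andP[p0 p1] := p01.
apply/eqP; rewrite eq_le measure_ge0 andbT.
have h T : (P (X @^-1` [set 0%N]) <= ((1 - p) ^+ T)%:E)%E.
  have := integral_nat_law (psi := fun=> 1%E) (fun=> lee01).
  rewrite integral_cst// mul1e.
  under eq_eseriesr do rewrite mul1e.
  move=> /(etrans (esym (probability_setT P))) e.
  have : (\sum_(0 <= n < T.+1) P (X @^-1` [set n]) <= 1)%E.
    by rewrite [leRHS]e; exact: nneseries_lim_ge.
  rewrite big_nat_recl// big_mkord.
  under eq_bigr do rewrite geom_law_geom.
  rewrite sumEFin sum_geom//.
  have fP : P (X @^-1` [set 0%N]) \is a fin_num by rewrite fin_num_measure.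
  rewrite -(fineK fP) -EFinD !lee_fin; lra.
have q1 : `|1 - p| < 1 by rewrite ger0_norm; lra.
have cv : (fun T => ((1 - p) ^+ T)%:E) @ \oo --> 0%E.
  by apply: cvg_EFin; [exact: nearW|exact: cvg_expr].
by rewrite -(cvg_lim _ cv)//; apply: lime_ge; [apply/cvg_ex; exists 0%E|exact: nearW].
Qed.

Lemma geom_integral_le (psi : nat -> \bar R) (c : \bar R) :
  (forall n, 0 <= psi n)%E ->
  (forall T, (\sum_(j < T) (geom p j)%:E * psi j.+1 <= c)%E) ->
  (\int[P]_w psi (X w) <= c)%E.
Proof.
move=> psi0 hc; rewrite integral_nat_law//.
have cv : cvgn (fun T => \sum_(0 <= n < T) psi n * P (X @^-1` [set n]))%E.
  by apply: is_cvg_nneseries => n _ _; rewrite mule_ge0.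
apply: lime_le => //; apply: nearW => -[|T].
  by rewrite big_geq//; have := hc 0%N; rewrite big_ord0.
rewrite big_nat_recl// geom_law0 mule0 add0e big_mkord.
apply: le_trans (hc T); apply: lee_sum => j _.
by rewrite geom_law_geom muleC.
Qed.

Lemma geom_mean_le : (\int[P]_w (X w)%:R%:E <= (p^-1)%:E)%E.
Proof.
have /andP[p0 p1] := p01.
apply: (geom_integral_le (psi := fun n => n%:R%:E)) => [n|T].
  by rewrite lee_fin.
under eq_bigr do rewrite -EFinM.
rewrite sumEFin lee_fin.
have -> : \sum_(j < T) geom p j * j.+1%:R = p^-1 * (1 - (1 - p) ^+ T * (1 + T%:R * p)).
  elim: T => [|T IH].
    by rewrite big_ord0 expr0 mul0r addr0 mul1r subrr mulr0.
  rewrite big_ord_recr /= IH /geom exprS -natr1.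
  by field; rewrite gt_eqF.
rewrite -[leRHS]mulr1; apply: ler_wpM2l; first by rewrite invr_ge0 ltW.
have q0 : 0 <= (1 - p) ^+ T by rewrite exprn_ge0// subr_ge0 ltW.
have Tp0 : 0 <= T%:R * p by rewrite mulr_ge0// ltW.
by rewrite gerBl mulr_ge0// addr_ge0.
Qed.

End GeometricLaw.

Section Limits.
Context {R : realType}.

(** [S T <= S (n + 1) <= c + r n] for every [n >= T]. *)
Lemma nondecr_le_lim (S r : nat -> R) (c : R) :
  (forall m n, (m <= n)%N -> S m <= S n) -> (forall T, S T.+1 <= c + r T) ->
  r @ \oo --> 0 -> forall T, S T <= c.
Proof.
move=> ndS Sr r0 T; rewrite leNgt; apply/negP => cS.
have e0 : 0 < S T - c by rewrite subr_gt0.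
have [n _ hn] := (cvgrPdist_lt _ _).1 r0 _ e0.
have /= := hn (maxn n T) (leq_maxl _ _).
rewrite sub0r normrN => /(le_lt_trans (ler_norm _)).
rewrite ltNge => /negP; apply.
rewrite lerBlDl; apply: le_trans (Sr _); apply: ndS.
by rewrite ltnW// ltnS leq_maxr.
Qed.

Lemma bounded_sum_cvg0 (a : nat -> R) (B : R) : (forall j, 0 <= a j) ->
  (forall T, \sum_(j < T) a j <= B) -> a @ \oo --> 0.
Proof.
move=> a0 aB; apply: cvg_series_cvg_0.
apply: nondecreasing_is_cvgn.
  by apply: nondecreasing_series => n _ _.
by exists B => _ [T _ <-]; rewrite /series /= big_mkord.
Qed.

End Limits.

(** * Contraction of the potential *)

Section Recursion.
Context {R : realType} {d M : nat}.
Variables (s : 'I_M) (f : 'I_M -> 'rV[R]_d -> R) (delta mu : R).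
Context {dW : measure_display} {W : measurableType dW}.
Variables (Q : probability W R) (C : W -> 'rV[R]_d -> 'rV[R]_d) (beta p theta : R).
Context {dO : measure_display} {Omega : measurableType dO}.
Variables (P : probability Omega R) (N : nat -> {RV P >-> nat}).
Variable seed : nat -> nat -> 'I_M -> {RV P >-> W}.
Hypothesis ftd : forall m, twice_differentiable (f m).
Hypothesis delta0 : 0 < delta.
Hypothesis frel : related delta f.
Hypothesis mu0 : 0 < mu.
Hypothesis fsc : strongly_convex mu (avgf f).
Hypothesis beta1 : 1 < beta.
Hypothesis HC : biased_compressor Q C beta.
Hypothesis p01 : 0 < p < 1.
Hypothesis theta0 : 0 < theta.
Hypothesis theta_delta : (theta * delta) ^+ 2 = p ^+ 3 / 576.
Hypothesis rnd : EF_OLGA_randomness Q p N seed.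
Variables (xs : 'rV[R]_d) (tau alpha : R).
Hypothesis xs_min : is_minimizer (avgf f) xs.
Hypothesis tau01 : 0 < tau <= 1.
Hypothesis alpha0 : 0 < alpha.
Hypothesis alphaE : tau * alpha = theta / (36 * p).

Local Notation fa := (avgf f).
Local Notation h := (fun v => f s v - avgf f v).
Local Notation subT J := (sub_sigmaType (inputs N seed) J).
Local Notation pot := (potential fa mu (fa xs) xs tau alpha).

Let ts : theta * delta < 1 := theta_small delta0 p01 theta0 theta_delta.
Let mC : measurable_fun setT (fun wx : W * borelV R d => C wx.1 wx.2 : borelV R d).
Proof. by case: HC. Qed.

Definition next_y (x : 'rV[R]_d) (sd : nat -> 'I_M -> W) n := epoch_u s f theta C x sd n.

Definition next_z (z x : 'rV[R]_d) (sd : nat -> 'I_M -> W) n :=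
  zstep mu z alpha
    (Gest h theta p x (epoch_u s f theta C x sd) (fun j => avgv (epoch_err s f theta C x sd j)) n)
    (next_y x sd n).

Lemma EF_OLGA_stepE sd n y z :
  EF_OLGA_step s f C mu p theta tau alpha n sd (y, z) =
  (next_y (tau *: z + (1 - tau) *: y) sd n, next_z z (tau *: z + (1 - tau) *: y) sd n).
Proof. by rewrite /EF_OLGA_step /= (zstep_argmin mu0 _ alpha0). Qed.

Lemma pot_ge0 y z : 0 <= pot y z.
Proof.
have /andP[t0 _] := tau01.
apply: addr_ge0; first by rewrite subr_ge0; exact: xs_min.
by rewrite /cz mulr_ge0 ?dotv_ge0// mulr_ge0 ?addr_ge0 ?invr_ge0 ?divr_ge0 ?mulr_ge0 ?ltW.
Qed.

Section StepMeasurability.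
Context {dT : measure_display} {T : measurableType dT}.
Variables (X Z : T -> borelV R d) (S : nat -> 'I_M -> T -> W).
Hypothesis mX : measurable_fun setT X.
Hypothesis mZ : measurable_fun setT Z.

Lemma measurable_next n : (forall j m, (j < n)%N -> measurable_fun setT (S j m)) ->
  measurable_fun setT (fun t => next_y (X t) (fun j m => S j m t) n : borelV R d) /\
  measurable_fun setT (fun t => next_z (Z t) (X t) (fun j m => S j m t) n : borelV R d).
Proof.
move=> mS.
have [mu_ me_] := @measurable_epoch _ _ _ _ _ s f delta mu theta ftd delta0 frel mu0 fsc theta0
  ts C mC _ T X S mX n mS.
split=> //.
have me := measurable_avgv me_.
have mh (Y : T -> borelV R d) : measurable_fun setT Y ->
    measurable_fun setT (fun t => grad h (Y t) : borelV R d).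
  move=> mY; under eq_fun do rewrite (grad_h s ftd).
  by apply: measurable_subv; [exact: measurable_gradf|exact: measurable_gradfa].
apply: measurable_scalev; apply: measurable_addv; last exact: measurable_scalev.
apply: measurable_subv; first exact: measurable_scalev.
apply: measurable_scalev; apply: measurable_addv.
  by apply: measurable_subv; exact: mh.
by apply: measurable_scalev; apply: measurable_subv => //; exact: measurable_subv.
Qed.

End StepMeasurability.

Lemma measurable_pot {dT : measure_display} {T : measurableType dT}
    (Y Z : T -> borelV R d) :
  measurable_fun setT Y -> measurable_fun setT Z ->
  measurable_fun setT (fun t => pot (Y t) (Z t)).
Proof.
move=> mY mZ; apply: measurable_funD.
  apply: measurable_funB => //.
  apply: measurable_comp_continuous mY => v.
  by apply: differentiable_continuous; exact: diff_fa.
apply: measurable_funM => //.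
by apply: measurable_dotv; apply: measurable_subv => //; exact: measurable_cst.
Qed.

Section OneIteration.
Variables (k : nat) (y z : 'rV[R]_d).

Let x := tau *: z + (1 - tau) *: y.
Local Notation sd := (fun w => (fun i m => seed k i m w)).
Definition Phi n w := pot (next_y x (sd w) n) (next_z z x (sd w) n).
Local Notation A_ := (sq_virtual s f C theta seed k x).
Local Notation B_ := (sq_err s f C theta seed k x).

Let fminP v : fa xs <= fa v. Proof. exact: xs_min. Qed.

Let C0 := (1 - tau) * (fa y - fa xs) + tau / (2 * alpha) * dotv (z - xs) (z - xs).
Let rhs T w := C0
  + (1 - p) ^+ T * ((p / theta) ^+ 2 * (3 * A_ T w + B_ T w) + dotv (z - xs) (z - xs))
  + theta^-1 * (- (p / 3) * (\sum_(j < T) geom p j * A_ j.+1 w)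
                + 4 / 3 * (\sum_(j < T) geom p j * B_ j.+1 w)).

Lemma Phi_sum T w : \sum_(j < T) geom p j * Phi j.+1 w <= rhs T w.
Proof.
exact: (path_potential mu0 fsc (h_lipschitz s ftd delta0 frel) p01 theta0
  theta_delta (u := epoch_u s f theta C x (sd w))
  (e := fun j => avgv (epoch_err s f theta C x (sd w) j)) erefl (avg_epoch_err0 s f theta C x _)
  (traj_step s ftd delta0 frel mu0 fsc theta0 ts C x _) fminP tau01 erefl alpha0 alphaE
  erefl T).
Qed.

Let LA := L1_sq_virtual s ftd delta0 frel mu0 fsc beta1 HC p01 theta0 theta_delta rnd k x fminP.
Let LB := L1_sq_err s ftd delta0 frel mu0 fsc beta1 HC p01 theta0 theta_delta rnd k x fminP.

Let rhs_L1 T : L1 P (rhs T) /\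
  Ex P (rhs T) = C0
  + (1 - p) ^+ T * ((p / theta) ^+ 2 * (3 * Ex P (A_ T) + Ex P (B_ T)) + dotv (z - xs) (z - xs))
  + theta^-1 * (- (p / 3) * (\sum_(j < T) geom p j * Ex P (A_ j.+1))
                + 4 / 3 * (\sum_(j < T) geom p j * Ex P (B_ j.+1))).
Proof.
have [lA eA] := Ex_wsum p T LA; have [lB eB] := Ex_wsum p T LB.
have l1 : L1 P (fun w => 3 * A_ T w + B_ T w).
  by apply: L1_add; [exact: L1_scale|exact: LB].
have l2 : L1 P (fun w => (p / theta) ^+ 2 * (3 * A_ T w + B_ T w) + dotv (z - xs) (z - xs)).
  by apply: L1_add; [exact: L1_scale|exact: L1_cst].
have l3 : L1 P (fun w => C0 + (1 - p) ^+ T *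
   ((p / theta) ^+ 2 * (3 * A_ T w + B_ T w) + dotv (z - xs) (z - xs))).
  by apply: L1_add; [exact: L1_cst|exact: L1_scale].
have l4 : L1 P (fun w => - (p / 3) * (\sum_(j < T) geom p j * A_ j.+1 w)
                + 4 / 3 * (\sum_(j < T) geom p j * B_ j.+1 w)).
  by apply: L1_add; exact: L1_scale.
split; first by apply: L1_add => //; exact: L1_scale.
rewrite Ex_add//; last exact: L1_scale.
rewrite Ex_add ?Ex_cst; [|exact: L1_cst|exact: L1_scale].
rewrite Ex_scale// Ex_add ?Ex_cst; [|exact: L1_scale|exact: L1_cst].
rewrite Ex_scale// Ex_add; [|exact: L1_scale|exact: LB].
rewrite Ex_scale; last exact: LA.
rewrite Ex_scale// Ex_add; [|exact: L1_scale|exact: L1_scale].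
by rewrite Ex_scale// Ex_scale// eA eB.
Qed.

Lemma Phi_ge0 n w : 0 <= Phi n w. Proof. exact: pot_ge0. Qed.

Lemma measurable_Phi (J : set (@input_index M)) n : (forall i, seeds_before k n i -> J i) ->
  measurable_fun setT (Phi n : subT J -> R).
Proof.
move=> JJ.
have mS j m : (j < n)%N -> measurable_fun setT (seed k j m : subT J -> W).
  by move=> jn; apply: measurable_input_seed; apply: JJ; rewrite /seeds_before/= eqxx jn.
have mx (v : 'rV[R]_d) : measurable_fun setT (fun _ : subT J => v : borelV R d).
  exact: measurable_cst.
have [m1 m2] := measurable_next (mx x) (mx z) mS.
exact: measurable_pot.
Qed.

Lemma measurable_PhiO n : measurable_fun setT (Phi n).
Proof.
exact: (measurable_sub (measurable_Phi (J := seeds_before k n) (fun i h => h))).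
Qed.

Lemma L1_Phi n : L1 P (Phi n.+1).
Proof.
have /andP[p0 p1] := p01.
have g0 : 0 < geom p n by rewrite mulr_gt0// exprn_gt0// subr_gt0.
apply: (L1_le (g2 := fun w => (geom p n)^-1 * rhs n.+1 w)).
- exact: measurable_PhiO.
- move=> w; rewrite Phi_ge0/= ler_pdivlMl//.
  apply: le_trans (Phi_sum n.+1 w); rewrite big_ord_recr/= lerDr.
  by apply: sumr_ge0 => j _; rewrite mulr_ge0 ?geom_ge0 ?Phi_ge0.
- by apply: L1_scale; case: (rhs_L1 n.+1).
Qed.

(** Expectation of [path_potential]. The weighted errors are at most [p / 17] times
    the weighted distances, so the last line there is nonpositive, and the
    boundary term tends to zero because it is, up to a constant, the general
    term of a bounded sum of nonnegative terms. *)
Lemma Ex_Phi_sum T : \sum_(j < T) geom p j * Ex P (Phi j.+1) <= C0.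
Proof.
have /andP[p0 p1] := p01.
pose D := dotv (z - xs) (z - xs).
pose r T := (1 - p) ^+ T.+1 * ((p / theta) ^+ 2 * (3 * Ex P (A_ T.+1) + Ex P (B_ T.+1)) + D).
pose c := fa x - fa xs.
have EA0 j : 0 <= Ex P (A_ j) by apply: Ex_ge0 => w; exact: dotv_ge0.
have EB0 j : 0 <= Ex P (B_ j) by apply: Ex_ge0 => w; exact: dotv_ge0.
have ebound T' := Ex_sq_virtual_bound s ftd delta0 frel mu0 fsc beta1 HC p01 theta0 theta_delta rnd k x fminP T'.
have eerr T' := Ex_error_sum s ftd delta0 frel mu0 fsc beta1 HC p01 theta0 theta_delta rnd k x fminP T'.
apply: (@nondecr_le_lim _ (fun T => \sum_(j < T) geom p j * Ex P (Phi j.+1)) r).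
- move=> m n mn; rewrite -!(big_mkord xpredT (fun j => geom p j * Ex P (Phi j.+1))).
  rewrite [leRHS](big_cat_nat (n := m))//= lerDl.
  apply: sumr_ge0 => j _; rewrite mulr_ge0 ?geom_ge0//.
  by apply: Ex_ge0 => w; exact: Phi_ge0.
- move=> T'; have LP (j : nat) : L1 P (fun w => geom p j * Phi j.+1 w).
    by apply: L1_scale; exact: L1_Phi.
  have -> : \sum_(j < T'.+1) geom p j * Ex P (Phi j.+1) =
      Ex P (fun w => \sum_(j < T'.+1) geom p j * Phi j.+1 w).
    rewrite Ex_sum; last by move=> j; exact: LP.
    by apply: eq_bigr => j _; rewrite Ex_scale//; exact: L1_Phi.
  have [lr er] := rhs_L1 T'.+1.
  apply: le_trans (Ex_le _ lr (Phi_sum T'.+1)) _.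
    by apply: L1_sum => j; exact: LP.
  rewrite er -/(r T') gerDl.
  have := eerr T'.+1.
  set a := \sum_(j < T'.+1) geom p j * Ex P (A_ j.+1).
  set b := \sum_(j < T'.+1) geom p j * Ex P (B_ j.+1) => hb.
  have a0 : 0 <= p * a.
    by rewrite mulr_ge0 ?(ltW p0)// sumr_ge0// => j _; rewrite mulr_ge0 ?geom_ge0.
  rewrite mulr_ge0_le0 ?invr_ge0 ?(ltW theta0)//; lra.
- pose a j := geom p j * (3 * Ex P (A_ j.+1) + Ex P (B_ j.+1)).
  have ca : a @ \oo --> 0.
    apply: (@bounded_sum_cvg0 _ _ (4 * (4 * (theta * c) / p))).
      by move=> j; rewrite mulr_ge0 ?geom_ge0// addr_ge0// mulr_ge0.
    move=> T'; have h1 := ebound T'; have h2 := eerr T'.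
    have -> : \sum_(j < T') a j = 3 * (\sum_(j < T') geom p j * Ex P (A_ j.+1))
        + \sum_(j < T') geom p j * Ex P (B_ j.+1).
      rewrite mulr_sumr -big_split; apply: eq_bigr => j _ /=.
      by rewrite /a; ring.
    set u := \sum_(j < T') geom p j * Ex P (A_ j.+1) in h1 h2 *.
    have u0 : 0 <= u by rewrite sumr_ge0// => j _; rewrite mulr_ge0 ?geom_ge0.
    have pu : p / 17 * u <= u.
      by rewrite -[leRHS]mul1r ler_wpM2r//; lra.
    rewrite -ler_pdivlMl// -/c in h1.
    by move: h1; rewrite [p^-1 * _]mulrC => h1; lra.
  have cq : (fun T => (1 - p) ^+ T) @ \oo --> (0 : R).
    by apply: cvg_expr; rewrite ger0_norm; lra.
  have -> : r = (fun T => (1 - p) * (p / theta ^+ 2) * a T + (1 - p) * D * (1 - p) ^+ T).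
    apply/funext => T'; rewrite /r /a exprS /geom.
    by field; rewrite gt_eqF.
  rewrite -[X in _ --> X](_ : (1 - p) * (p / theta ^+ 2) * 0 + (1 - p) * D * 0 = 0).
    by apply: cvgD; apply: cvgMr.
  by rewrite !mulr0 addr0.
Qed.

(** The state is fixed here; the expectation is taken over the seeds, with the epoch
    length frozen, and then over the epoch length. *)
Lemma one_iteration : (\int[P]_w (Phi (N k w) w)%:E <= C0%:E)%E.
Proof.
have /andP[p0 p1] := p01.
pose J1 : set (@input_index M) := [set inl k].
pose J2 : set (@input_index M) := [set i | if i is inr (k', _, _) then k' == k else false].
have JJ n i : seeds_before k n i -> J2 i.
  by rewrite /seeds_before /J2; case: i => [//|[[k' j'] m]] /= /andP[].
pose phi (ww : subT J1 * subT J2) := (Phi (N k ww.1) ww.2)%:E.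
have mN1 : measurable_fun setT (N k : subT J1 -> nat) by exact: measurable_inputN.
have mphi : measurable_fun setT phi.
  apply/measurable_EFinP.
  apply: (measurable_nat_dep (N := fun ww : subT J1 * subT J2 => N k ww.1)
    (F := fun n (ww : subT J1 * subT J2) => Phi n ww.2)).
    exact: (measurableT_comp mN1 measurable_fst).
  move=> n; have mn := measurable_Phi (J := J2) (JJ n).
  exact: (measurableT_comp mn measurable_snd).
pose psi n := (\int[P]_w (Phi n w)%:E)%E.
apply: (@le_trans _ _ (\int[P]_w psi (N k w))%E).
  apply: (@family_integral_le _ _ _ P _ (inputs N seed) (@inputs_setI _ _ _ _ _ _ _ _ _)
    (@inputs_setT _ _ _ _ _ _ _ _ _) (@inputs_measurable _ _ _ _ _ _ _ _ _)
    (inputs_indep rnd) J1 J2 phi) => //.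
  - by apply/seteqP; split=> // i [-> /=].
  - by move=> ww; rewrite lee_fin Phi_ge0.
  - have mp : measurable_fun setT psi by [].
    by apply: (measurableT_comp mp); exact: measurable_funPT.
have [geoN _ _] := rnd.
apply: (geom_integral_le p01 (geoN k)).
  by move=> n; apply: integral_ge0 => w _; rewrite lee_fin Phi_ge0.
move=> T; rewrite (eq_bigr (fun j : 'I_T => (geom p j * Ex P (Phi j.+1))%:E)).
  by rewrite sumEFin lee_fin Ex_Phi_sum.
by move=> j _; rewrite [RHS]EFinM; congr (_ * _)%E; exact/esym/EFin_Ex/L1_Phi.
Qed.

End OneIteration.

Section Iterations.
Variable y0 : 'rV[R]_d.

Definition state K w := EF_OLGA s f C mu p theta tau alpha y0
  (fun k => N k w) (fun k j m => seed k j m w) K.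

Definition inputs_before K : set (@input_index M) :=
  [set i | match i with inl k => (k < K)%N | inr (k, _, _) => (k < K)%N end].

Definition inputs_of K : set (@input_index M) :=
  [set i | match i with inl k => k == K | inr (k, _, _) => k == K end].

Lemma stateS K w :
  state K.+1 w = EF_OLGA_step s f C mu p theta tau alpha (N K w) (fun j m => seed K j m w)
    (state K w).
Proof. by []. Qed.

Lemma measurable_step {dT : measure_display} {T : measurableType dT}
    (Y Z : T -> borelV R d) (S : nat -> 'I_M -> T -> W) (n : T -> nat) :
  measurable_fun setT Y -> measurable_fun setT Z ->
  (forall j m, measurable_fun setT (S j m)) -> measurable_fun setT n ->
  let nxt t := EF_OLGA_step s f C mu p theta tau alpha (n t) (fun j m => S j m t) (Y t, Z t) in
  measurable_fun setT (fun t => (nxt t).1 : borelV R d) /\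
  measurable_fun setT (fun t => (nxt t).2 : borelV R d).
Proof.
move=> mY mZ mS mn nxt.
pose X t : borelV R d := tau *: Z t + (1 - tau) *: Y t.
have mX : measurable_fun setT X.
  by apply: measurable_addv; exact: measurable_scalev.
have nxtE t : nxt t = (next_y (X t) (fun j m => S j m t) (n t),
    next_z (Z t) (X t) (fun j m => S j m t) (n t)) by exact: EF_OLGA_stepE.
split; under eq_fun do rewrite nxtE.
- apply: (measurable_nat_dep
    (F := fun n t => next_y (X t) (fun j m => S j m t) n : borelV R d) mn) => n'.
  by have [] := measurable_next mX mZ (fun j m (_ : (j < n')%N) => mS j m).
- apply: (measurable_nat_dep
    (F := fun n t => next_z (Z t) (X t) (fun j m => S j m t) n : borelV R d) mn) => n'.
  by have [] := measurable_next mX mZ (fun j m (_ : (j < n')%N) => mS j m).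
Qed.

Lemma measurable_state K (J : set (@input_index M)) : (forall i, inputs_before K i -> J i) ->
  measurable_fun setT (fun w : subT J => (state K w).1 : borelV R d) /\
  measurable_fun setT (fun w : subT J => (state K w).2 : borelV R d).
Proof.
elim: K => [_|K IH JJ]; first by split; exact: measurable_cst.
have {IH}[|m1 m2] := IH.
  by move=> i Ji; apply: JJ; move: i Ji => [k|[[k j] m]] /= kK; rewrite ltnS ltnW.
have mS j m : measurable_fun setT (seed K j m : subT J -> W).
  by apply: measurable_input_seed; apply: JJ; rewrite /inputs_before/=.
have mN : measurable_fun setT (N K : subT J -> nat).
  by apply: measurable_inputN; apply: JJ; rewrite /inputs_before/=.
have [n1 n2] := measurable_step m1 m2 mS mN.
split; under eq_fun do rewrite stateS [state K _]surjective_pairing.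
  exact: n1.
exact: n2.
Qed.

Lemma measurable_stateO K :
  measurable_fun setT (fun w : Omega => (state K w).1 : borelV R d) /\
  measurable_fun setT (fun w : Omega => (state K w).2 : borelV R d).
Proof.
have [m1 m2] := @measurable_state K (inputs_before K) (fun i h => h).
by split; [exact: (measurable_sub m1)|exact: (measurable_sub m2)].
Qed.

Lemma measurable_pot_state K :
  measurable_fun setT (fun w => pot (state K w).1 (state K w).2).
Proof. by have [m1 m2] := measurable_stateO K; exact: measurable_pot. Qed.

Hypothesis contraction : tau / (2 * alpha) <= (1 - tau) * cz mu tau alpha.

Lemma pot_contraction y z :
  (1 - tau) * (fa y - fa xs) + tau / (2 * alpha) * dotv (z - xs) (z - xs)
  <= (1 - tau) * pot y z.
Proof.
rewrite /potential [leRHS]mulrDr lerD2l mulrA.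
by apply: ler_wpM2r; [exact: dotv_ge0|exact: contraction].
Qed.

(** The state is frozen, being a function of the inputs of the earlier iterations,
    and [one_iteration] is applied to the fresh inputs. *)
Lemma potential_step K :
  (\int[P]_w (pot (state K.+1 w).1 (state K.+1 w).2)%:E <=
   \int[P]_w ((1 - tau) * pot (state K w).1 (state K w).2)%:E)%E.
Proof.
pose nxt (ww : subT (inputs_before K) * subT (inputs_of K)) :=
  EF_OLGA_step s f C mu p theta tau alpha (N K ww.2) (fun j m => seed K j m ww.2)
    ((state K ww.1).1, (state K ww.1).2).
pose phi ww := (pot (nxt ww).1 (nxt ww).2)%:E.
have [m1 m2] := @measurable_state K (inputs_before K) (fun i h => h).
have mN : measurable_fun setT (N K : subT (inputs_of K) -> nat).
  by apply: measurable_inputN; rewrite /inputs_of/=.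
have mS j m : measurable_fun setT (seed K j m : subT (inputs_of K) -> W).
  by apply: measurable_input_seed; rewrite /inputs_of/=.
have mY : measurable_fun setT
    (fun ww : subT (inputs_before K) * subT (inputs_of K) => (state K ww.1).1 : borelV R d).
  exact: (measurableT_comp m1 measurable_fst).
have mZ : measurable_fun setT
    (fun ww : subT (inputs_before K) * subT (inputs_of K) => (state K ww.1).2 : borelV R d).
  exact: (measurableT_comp m2 measurable_fst).
have mS2 j m : measurable_fun setT
    (fun ww : subT (inputs_before K) * subT (inputs_of K) => seed K j m ww.2 : W).
  exact: (measurableT_comp (mS j m) measurable_snd).
have mN2 : measurable_fun setT
    (fun ww : subT (inputs_before K) * subT (inputs_of K) => N K ww.2 : nat).
  exact: (measurableT_comp mN measurable_snd).
have [n1 n2] := measurable_step mY mZ mS2 mN2.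
have -> : (\int[P]_w (pot (state K.+1 w).1 (state K.+1 w).2)%:E = \int[P]_w phi (w, w))%E.
  apply: eq_integral => w _; rewrite /phi /nxt stateS.
  by rewrite -[((state K _).1, _)]surjective_pairing.
apply: (@family_integral_le _ _ _ P _ (inputs N seed) (@inputs_setI _ _ _ _ _ _ _ _ _)
    (@inputs_setT _ _ _ _ _ _ _ _ _) (@inputs_measurable _ _ _ _ _ _ _ _ _)
    (inputs_indep rnd) (inputs_before K) (inputs_of K) phi) => //.
- apply/seteqP; split=> // -[k|[[k j] m]] [] /=;
    by move=> h /eqP kK; move: h; rewrite kK ltnn.
- by apply/measurable_EFinP; exact: measurable_pot.
- by move=> ww; rewrite lee_fin pot_ge0.
- by apply/measurable_EFinP; apply: measurable_funM => //; exact: measurable_pot_state.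
move=> w1; have it := one_iteration K (state K w1).1 (state K w1).2.
have -> : (\int[P]_w2 phi (w1, w2) =
    \int[P]_w (Phi K (state K w1).1 (state K w1).2 (N K w) w)%:E)%E.
  by apply: eq_integral => w _; rewrite /phi /nxt EF_OLGA_stepE.
by apply: (le_trans it); rewrite lee_fin; exact: pot_contraction.
Qed.

Lemma potential_decay K :
  (\int[P]_w (pot (state K w).1 (state K w).2)%:E <=
   ((1 - tau) ^+ K * pot y0 y0)%:E)%E.
Proof.
have /andP[t0 t1] := tau01.
elim: K => [|K IH].
  rewrite expr0 mul1r -[in leRHS](Ex_cst P (pot y0 y0)) EFin_Ex//.
  exact: L1_cst.
apply: (le_trans (potential_step K)).
under eq_integral do rewrite EFinM.
rewrite ge0_integralZl_EFin ?subr_ge0//; first last.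
- by apply/measurable_EFinP; exact: measurable_pot_state.
- by move=> w _; rewrite lee_fin pot_ge0.
rewrite exprS -mulrA [leRHS]EFinM; apply: lee_wpmul2l => //.
by rewrite lee_fin subr_ge0.
Qed.

Lemma gap_decay K :
  (\int[P]_w (fa (state K w).1 - fa xs)%:E <= ((1 - tau) ^+ K * pot y0 y0)%:E)%E.
Proof.
have /andP[t0 t1] := tau01.
apply: le_trans (potential_decay K); apply: ge0_le_integral => //.
- by move=> w _; rewrite lee_fin subr_ge0; exact: xs_min.
- apply/measurable_EFinP; apply: measurable_funB => //.
  have [m1 _] := measurable_stateO K.
  apply: measurable_comp_continuous m1 => v.
  by apply: differentiable_continuous; exact: diff_fa.
- by apply/measurable_EFinP; exact: measurable_pot_state.
- move=> w _; rewrite lee_fin lerDl mulr_ge0 ?dotv_ge0//.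
  by rewrite mulr_ge0 ?addr_ge0 ?invr_ge0 ?divr_ge0 ?mulr_ge0 ?ltW.
Qed.

End Iterations.

End Recursion.

(** * Constants, costs and number of iterations *)

Section Cost.
Context {R : realType} {dO : measure_display} {Omega : measurableType dO}.
Variables (P : probability Omega R) (p : R) (N : nat -> {RV P >-> nat}).
Hypothesis p01 : 0 < p < 1.
Hypothesis geoN : forall k, geometric_law p (N k).

Lemma Ex_geom_le k : L1 P (fun w => (N k w)%:R) /\ Ex P (fun w => (N k w)%:R) <= p^-1.
Proof.
have le_m := geom_mean_le p01 (geoN k).
have mN : measurable_fun setT (fun w => (N k w)%:R : R).
  have mn : measurable_fun setT (fun n : nat => n%:R : R) by [].
  by apply: (measurableT_comp mn); exact: measurable_funPT.
have iN : L1 P (fun w => (N k w)%:R).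
  by apply: L1_lt_pinfty => //; apply: le_lt_trans le_m _; exact: ltry.
by split=> //; rewrite -lee_fin EFin_Ex.
Qed.

Lemma expected_cost_le (a b : R) K : 0 <= b ->
  ('E_P[fun w => comm_cost a b (fun k => N k w) K] <= (K%:R * (3 * a + p^-1 * b))%:E)%E.
Proof.
move=> b0; rewrite unlock.
have iN k := (Ex_geom_le k).1.
have i1 k : L1 P (fun w => b * (N k w)%:R) by exact: L1_scale.
have i2 (k : 'I_K) : L1 P (fun w => 3 * a + (N k w)%:R * b).
  under eq_fun do rewrite [_ * b]mulrC.
  by apply: L1_add; [exact: L1_cst|exact: i1].
rewrite -EFin_Ex; last by apply: L1_sum => k; exact: i2.
rewrite lee_fin /comm_cost Ex_sum//.
apply: (@le_trans _ _ (\sum_(k < K) (3 * a + p^-1 * b))).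
  apply: ler_sum => k _; under eq_fun do rewrite [_ * b]mulrC.
  rewrite Ex_add ?Ex_cst; [|exact: L1_cst|exact: i1].
  rewrite Ex_scale// lerD2l [leRHS]mulrC.
  by apply: ler_wpM2l => //; case: (Ex_geom_le k).
by rewrite sumr_const card_ord -[_ *+ K]mulr_natl.
Qed.

End Cost.

Section Constants.
Context {R : realType}.
Variables (gamma delta mu p theta tau alpha : R).
Hypothesis gamma1 : 1 < gamma.
Hypothesis delta0 : 0 < delta.
Hypothesis mu0 : 0 < mu.
Hypothesis pE : p = 1 / gamma.
Hypothesis thetaE : theta = p `^ (3 / 2) / (24 * delta).
Hypothesis tauE : tau = Num.min (Num.sqrt mu * theta `^ (1 / 2) * p `^ (- (1 / 2)) / 18) (1 / 18).
Hypothesis alphaE : alpha = theta * p^-1 / (36 * tau).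

Lemma param_gamma : 0 < gamma. Proof. exact: lt_trans gamma1. Qed.

Lemma param_p01 : 0 < p < 1.
Proof. by rewrite pE div1r invr_gt0 param_gamma invf_lt1// param_gamma. Qed.

Lemma param_p0 : 0 < p. Proof. by case/andP: param_p01. Qed.

Lemma param_theta0 : 0 < theta.
Proof. by rewrite thetaE divr_gt0 ?powR_gt0 ?mulr_gt0 ?param_p0. Qed.

Lemma param_theta_delta : (theta * delta) ^+ 2 = p ^+ 3 / 576.
Proof.
have -> : theta * delta = p `^ (3 / 2) / 24.
  by rewrite thetaE; field; rewrite gt_eqF.
have h : (p `^ (3 / 2)) ^+ 2 = p ^+ 3.
  rewrite -(powR_mulrn 2) ?powR_ge0// -powRrM divfK ?pnatr_eq0//.
  by rewrite powR_mulrn// ltW// param_p0.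
by rewrite exprMn h; field.
Qed.

Lemma powR_half (x : R) : 0 <= x -> x `^ (1 / 2) = Num.sqrt x.
Proof. by move=> x0; rewrite div1r powR12_sqrt. Qed.

(** [tau] is the minimum of [rho / 18] and [1 / 18]. *)
Definition rho := Num.sqrt (mu * theta / p).

Lemma param_rhoE : Num.sqrt mu * theta `^ (1 / 2) * p `^ (- (1 / 2)) = rho.
Proof.
rewrite powRN !powR_half ?(ltW param_theta0) ?(ltW param_p0)//.
rewrite -sqrtrV ?(ltW param_p0)// -!sqrtrM ?mulr_ge0 ?ltW// ?param_theta0//.
Qed.

Lemma param_rho0 : 0 < rho.
Proof. by rewrite sqrtr_gt0 divr_gt0 ?mulr_gt0 ?param_theta0 ?param_p0. Qed.

Lemma param_rho2 : rho ^+ 2 = mu * theta / p.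
Proof. by rewrite sqr_sqrtr// divr_ge0 ?mulr_ge0 ?ltW ?param_theta0 ?param_p0. Qed.

Lemma param_tau : [/\ 0 < tau, tau <= 1 / 18 & tau <= rho / 18].
Proof.
rewrite tauE param_rhoE; split; last 2 first.
- by rewrite ge_min lexx orbT.
- by rewrite ge_min lexx.
- by rewrite lt_min !divr_gt0 ?param_rho0.
Qed.

Lemma param_tau01 : 0 < tau <= 1.
Proof. by have [-> t1 _] := param_tau; lra. Qed.

Lemma param_alpha0 : 0 < alpha.
Proof.
have [t0 _ _] := param_tau.
by rewrite alphaE divr_gt0 ?mulr_gt0 ?invr_gt0 ?param_theta0 ?param_p0.
Qed.

Lemma param_alpha_tau : tau * alpha = theta / (36 * p).
Proof.
have [t0 _ _] := param_tau.
by rewrite alphaE; field; rewrite !gt_eqF ?param_p0.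
Qed.

(** [alpha mu = rho^2 / (36 tau)] and [tau <= rho / 18]. *)
Lemma param_alpha_mu : 9 * tau <= alpha * mu.
Proof.
have [t0 _ tr] := param_tau.
have -> : alpha * mu = rho ^+ 2 / (36 * tau).
  by rewrite param_rho2 alphaE; field; rewrite !gt_eqF ?param_p0.
rewrite ler_pdivlMr ?mulr_gt0//.
have h : (18 * tau) ^+ 2 <= rho ^+ 2.
  have r0 : 0 <= rho by exact: ltW param_rho0.
  have t180 : 0 <= 18 * tau by lra.
  have t18 : 18 * tau <= rho by lra.
  by apply: lerXn2r; rewrite ?nnegrE.
lra.
Qed.

(** Strong convexity in the mirror step gains the factor [1 + alpha mu], which is at
    least [1 / (1 - tau)]. *)
Lemma param_contraction : tau / (2 * alpha) <= (1 - tau) * cz mu tau alpha.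
Proof.
have [t0 t1 _] := param_tau; have am := param_alpha_mu; have a0 := param_alpha0.
have -> : (1 - tau) * cz mu tau alpha = tau / (2 * alpha) * ((1 - tau) * (1 + alpha * mu)).
  by rewrite /cz; field; rewrite gt_eqF.
rewrite -[leLHS]mulr1; apply: ler_wpM2l; first by rewrite divr_ge0 ?mulr_ge0 ?ltW.
have : (1 - tau) * (1 + 9 * tau) <= (1 - tau) * (1 + alpha * mu).
  by apply: ler_wpM2l; lra.
nra.
Qed.

Lemma param_cz : cz mu tau alpha <= mu / 2.
Proof.
have [t0 t1 _] := param_tau; have am := param_alpha_mu; have a0 := param_alpha0.
have -> : cz mu tau alpha = mu / 2 * (tau / (alpha * mu) + tau).
  by rewrite /cz; field; rewrite !gt_eqF.
rewrite -[leRHS]mulr1; apply: ler_wpM2l; first by rewrite divr_ge0 ?ltW.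
have : tau / (alpha * mu) <= 1 / 9.
  by rewrite ler_pdivrMr ?mulr_gt0//; lra.
lra.
Qed.

(** [rho^2 = mu p^(1/2) / (24 delta)] and [p = 1 / gamma], whence
    [1 / rho <= 5 gamma^(1/4) sqrt (delta / mu)]. *)
Lemma param_tauV : tau^-1 <= 90 * (1 + gamma `^ (1 / 4) * Num.sqrt (delta / mu)).
Proof.
have [t0 _ _] := param_tau; have g0 := param_gamma; have p0 := param_p0.
set g := gamma `^ (1 / 4) * Num.sqrt (delta / mu).
have dm0 : 0 <= delta / mu by rewrite divr_ge0 ?ltW.
have gg0 : 0 < g by rewrite mulr_gt0 ?powR_gt0// sqrtr_gt0 divr_gt0.
have g2 : g ^+ 2 = Num.sqrt gamma * (delta / mu).
  rewrite exprMn sqr_sqrtr// -(powR_mulrn 2) ?powR_ge0// -powRrM.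
  have -> : 1 / 4 * 2%:R = 1 / 2 :> R by field.
  by rewrite powR_half// ltW.
clearbody g.
have sp : p `^ (3 / 2) = p * Num.sqrt p.
  have -> : 3 / 2 = 1 + 1 / 2 :> R by field.
  rewrite powRD; last by rewrite gt_eqF ?implybT.
  by rewrite powRr1 ?powR_half ?ltW.
have spg : Num.sqrt p * Num.sqrt gamma = 1.
  by rewrite -sqrtrM ?ltW// pE div1r mulVf ?sqrtr1// gt_eqF.
have gr : 1 <= 5 * g * rho.
  have h : 1 ^+ 2 <= (5 * g * rho) ^+ 2.
    rewrite !exprMn g2 param_rho2 thetaE sp.
    have -> : 5 ^+ 2 * (Num.sqrt gamma * (delta / mu)) *
       (mu * (p * Num.sqrt p / (24 * delta)) / p) =
       25 / 24 * (Num.sqrt p * Num.sqrt gamma) by field; rewrite !gt_eqF.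
    by rewrite spg; lra.
  rewrite -(@ler_pXn2r _ 2)// ?nnegrE ?mulr_ge0 ?(ltW gg0) ?(ltW param_rho0)//.
rewrite -[leLHS]mul1r ler_pdivrMr//.
rewrite [in leRHS]tauE param_rhoE minr_pMr; last by rewrite mulr_ge0 ?addr_ge0 ?ltW.
rewrite le_min; apply/andP; split; first by have := param_rho0; nra.
lra.
Qed.

End Constants.

(** [K] is [L / tau] rounded up; the 1 in [L] pays for the factor 2. *)
Lemma iteration_count {R : realType} (tau D eps : R) :
  0 < tau <= 1 -> 0 <= D -> 0 < eps ->
  let L := 1 + logp (D / eps) in
  exists K : nat, (1 - tau) ^+ K * (2 * D) <= eps /\ K%:R <= 2 * L / tau.
Proof.
move=> /andP[t0 t1] D0 e0 L.
have L1 : 1 <= L by rewrite lerDl le_max lexx.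
have L0 : 0 < L by exact: lt_le_trans L1.
have x0 : 0 <= L / tau by rewrite divr_ge0 ?ltW.
exists (Num.truncn (L / tau)).+1; split; last first.
  have /andP[h1 _] := truncn_itv x0.
  rewrite -natr1.
  have : 1 <= L / tau by rewrite ler_pdivlMr// mul1r (le_trans t1).
  have -> : 2 * L / tau = L / tau + L / tau by field; rewrite gt_eqF.
  lra.
set K := (Num.truncn _).+1.
have hK : L <= tau * K%:R.
  have /andP[_ /ltW h2] := truncn_itv x0.
  by rewrite mulrC -ler_pdivrMr.
have q0 : 0 <= 1 - tau by rewrite subr_ge0.
have qK : (1 - tau) ^+ K <= expR (- L).
  apply: (@le_trans _ _ (expR (- tau) ^+ K)).
    rewrite ler_pXn2r// ?nnegrE ?expR_ge0//.
    exact: (expR_ge1Dx (- tau)).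
  rewrite -expRM_natl ler_expR; lra.
apply: (@le_trans _ _ (expR (- L) * (2 * D))).
  by apply: ler_wpM2r => //; rewrite mulr_ge0.
have [->|Dn0] := eqVneq D 0; first by rewrite !mulr0 ltW.
have Dp : 0 < D by rewrite lt_def Dn0.
have e1 : 2 <= expR (1 : R) by have := expR_ge1Dx (1 : R); lra.
have De : 0 < D / eps by rewrite divr_gt0.
have eL : 2 * (D / eps) <= expR L.
  rewrite /L expRD; apply: ler_pM => //; first exact: ltW.
  rewrite -[leLHS](@lnK _ (D / eps)) ?posrE// ler_expR.
  by rewrite le_max lexx orbT.
rewrite expRN mulrC ler_pdivrMr ?expR_gt0//.
by move: eL; rewrite mulrA ler_pdivrMr// mulrC [eps * _]mulrC.
Qed.

(** * The communication complexity *)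

Theorem corollary2 (R : realType) :
  exists c : R, 0 < c /\
  forall (d M : nat) (hM : (0 < M)%N) (f : 'I_M -> 'rV[R]_d -> R)
    (delta mu : R) (xstar y0 : 'rV[R]_d)
    (dW : measure_display) (W : measurableType dW) (Q : probability W R)
    (C : W -> 'rV[R]_d -> 'rV[R]_d) (beta gamma : R)
    (bits : 'rV[R]_d -> nat) (b : nat)
    (p theta tau alpha : R)
    (dO : measure_display) (Omega : measurableType dO)
    (P : probability Omega R) (N : nat -> {RV P >-> nat})
    (seed : nat -> nat -> 'I_M -> {RV P >-> W}),
  (forall m, twice_differentiable (f m)) ->
  0 < delta -> related delta f ->
  0 < mu -> strongly_convex mu (avgf f) ->
  is_minimizer (avgf f) xstar ->
  1 < beta -> biased_compressor Q C beta ->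
  1 < gamma -> compression_power Q C bits b gamma ->
  p = 1 / gamma ->
  theta = p `^ (3 / 2) / (24 * delta) ->
  tau = Num.min (Num.sqrt mu * theta `^ (1 / 2) * p `^ (- (1 / 2)) / 18)
                (1 / 18) ->
  alpha = theta * p^-1 / (36 * tau) ->
  EF_OLGA_randomness Q p N seed ->
  let y (K : nat) (w : Omega) : 'rV[R]_d :=
    (EF_OLGA (Ordinal hM) f C mu p theta tau alpha y0
       (fun k => N k w) (fun k j m => seed k j m w) K).1 in
  let expected_cost (CC : (nat -> nat) -> nat -> R) (K : nat) : \bar R :=
    ('E_P[fun w => CC (fun k => N k w) K])%E in
  forall eps : R, 0 < eps ->
  let L : R := 1 + logp ((avgf f y0 - avgf f xstar) / eps) in
  exists K : nat,
    [/\ ('E_P[fun w => avgf f (y K w) - avgf f xstar]%R <= eps%:E)%E,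
        (expected_cost CC1 K
           <= (c * (gamma + gamma `^ (5 / 4) * Num.sqrt (delta / mu)) * L)%:E)%E,
        (expected_cost (CC2 M) K
           <= (c * (M%:R * gamma
                    + M%:R * gamma `^ (5 / 4) * Num.sqrt (delta / mu)) * L)%:E)%E &
        (expected_cost (CC3 gamma) K
           <= (c * (1 + gamma `^ (1 / 4) * Num.sqrt (delta / mu)) * L)%:E)%E].
Proof.
(* at most 180 (1 + g) L iterations, each of which costs at most four times a
   round of gamma compressed messages *)
exists 720; split; first by rewrite ltr0n.
move=> d M hM f delta mu xstar y0 dW W Q C beta gamma bits b
  p theta tau alpha dO Omega P N seed ftd delta0 frel mu0 fsc xs_min beta1 HC
  gamma1 _ pE thetaE tauE alphaE rnd y expected_cost eps eps0 L.
have p01 := param_p01 gamma1 pE.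
have theta0 := param_theta0 gamma1 delta0 pE thetaE.
have thd := param_theta_delta gamma1 delta0 pE thetaE.
have tau01 := param_tau01 gamma1 delta0 mu0 pE thetaE tauE.
have alpha0 := param_alpha0 gamma1 delta0 mu0 pE thetaE tauE alphaE.
have talpha := param_alpha_tau gamma1 delta0 mu0 pE thetaE tauE alphaE.
have contr := param_contraction gamma1 delta0 mu0 pE thetaE tauE alphaE.
have czle := param_cz gamma1 delta0 mu0 pE thetaE tauE alphaE.
have tauV := param_tauV gamma1 delta0 mu0 pE thetaE tauE.
set g := gamma `^ (1 / 4) * Num.sqrt (delta / mu) in tauV.
have gamma0 : 0 < gamma := param_gamma gamma1.
have g0 : 0 <= g by rewrite mulr_ge0 ?powR_ge0 ?sqrtr_ge0.
have tau0 : 0 < tau by case/andP: tau01.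
set D := avgf f y0 - avgf f xstar.
have D0 : 0 <= D by rewrite subr_ge0; exact: xs_min.
have L1 : 1 <= L by rewrite lerDl le_max lexx.
have [K [hK KL]] := iteration_count tau01 D0 eps0.
rewrite -/D -/L in KL.
have [geoN _ _] := rnd.
have pV : p^-1 = gamma by rewrite pE div1r invrK.
have K0 : (0 : R) <= K%:R by [].
have KB : K%:R <= 180 * (1 + g) * L.
  apply: (le_trans KL).
  have : 2 * L * tau^-1 <= 2 * L * (90 * (1 + g)).
    by apply: ler_wpM2l tauV; lra.
  lra.
have cost a bb : 0 <= a -> 0 <= bb ->
    (expected_cost (comm_cost a bb) K <=
     (180 * (1 + g) * L * (3 * a + gamma * bb))%:E)%E.
  move=> a0 b0; apply: (le_trans (expected_cost_le p01 geoN a K b0)).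
  rewrite pV lee_fin; apply: ler_wpM2r KB.
  by rewrite addr_ge0 ?mulr_ge0// ltW.
have g54 : gamma `^ (5 / 4) = gamma * gamma `^ (1 / 4).
  have -> : 5 / 4 = 1 + 1 / 4 :> R by field.
  by rewrite powRD ?powRr1 ?gt_eqF ?implybT// ltW.
have L0 : 0 <= L := le_trans ler01 L1.
have g1 : 0 <= 1 + g by exact: addr_ge0.
have gL : 0 <= (1 + g) * L by exact: mulr_ge0.
have pot2 : potential (avgf f) mu (avgf f xstar) xstar tau alpha y0 y0 <= 2 * D.
  have := fsc y0 xstar.
  rewrite (minimizer_grad0 (diff_fa ftd) xs_min) dot0v addr0 norm2_sqr => sc.
  have := ler_wpM2r (dotv_ge0 (y0 - xstar)) czle.
  rewrite /potential -/D; move: (dotv (y0 - xstar) (y0 - xstar)) sc => sq sc h.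
  by rewrite /D in D0 *; lra.
have q0 : 0 <= (1 - tau) ^+ K by rewrite exprn_ge0// subr_ge0; case/andP: tau01.
exists K; split.
- have gap := gap_decay (Ordinal hM) ftd delta0 frel mu0 fsc beta1 HC p01 theta0 thd rnd xs_min
    tau01 alpha0 talpha y0 contr K.
  rewrite unlock; apply: (le_trans gap); rewrite lee_fin.
  exact: le_trans (ler_wpM2l q0 pot2) hK.
- apply: (le_trans (cost 1 1 ler01 ler01)); rewrite lee_fin g54 -[gamma * _ * _]mulrA -/g.
  rewrite !mulr1 [leRHS](_ : _ = 180 * (1 + g) * L * (4 * gamma)); last by ring.
  by apply: ler_wpM2l; [rewrite -mulrA mulr_ge0|lra].
- have MR0 : 0 <= M%:R :> R by [].
  apply: (le_trans (cost M%:R M%:R MR0 MR0)); rewrite lee_fin g54.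
  have -> : M%:R * (gamma * gamma `^ (1 / 4)) * Num.sqrt (delta / mu) =
     M%:R * (gamma * g) by rewrite /g; ring.
  rewrite [leRHS](_ : _ = 180 * (1 + g) * L * (4 * gamma * M%:R)); last by ring.
  apply: ler_wpM2l; first by rewrite -mulrA mulr_ge0.
  by rewrite -mulrDl ler_wpM2r//; lra.
- have gV0 : 0 <= gamma^-1 by rewrite invr_ge0 ltW.
  apply: (le_trans (cost 1 gamma^-1 ler01 gV0)); rewrite lee_fin -/g.
  rewrite divff ?gt_eqF// [leRHS](_ : _ = 180 * (1 + g) * L * 4); last by ring.
  by apply: ler_wpM2l; [rewrite -mulrA mulr_ge0|lra].
Qed.
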